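(* Let $1\le d<n$, $m=n-d$, let $\boldsymbol\theta\in\mathbb{R}^n$, and let $\mathbf{w}=(w_1,\dots,w_n)$ be a weight in $\mathbb{R}^n$ satisfying $w_1=w_2=\cdots=w_d=\max_{1\le i\le n}w_i$. Let $U\subset\mathbb{R}^d$ be open and let $\mathbf{f}:U\to\mathbb{R}^n$, $\mathbf{f}(\mathbf{x})=(\mathbf{x},f_1(\mathbf{x}),\dots,f_m(\mathbf{x}))$, be nondegenerate. Then for Lebesgue almost every $\mathbf{x}\in U$, $\mathbf{f}(\mathbf{x})$ is not in $\mathbf{Bad}_{\boldsymbol\theta}(\mathbf{w})$.
   Context: A weight in $\mathbb{R}^n$ is a vector $\mathbf{w}=(w_1,\dots,w_n)$ with $w_i\ge 0$ and $\sum_i w_i=1$. $|x|_{\mathbb{Z}}$ is the distance from $x\in\mathbb{R}$ to the nearest integer. For $\boldsymbol\theta=(\theta_i)\in\mathbb{R}^n$, $$\mathbf{Bad}_{\boldsymbol\theta}(\mathbf{w}):=\Big\{\mathbf{x}\in\mathbb{R}^n:\ \liminf_{q\in\mathbb{Z}\setminus\{0\},\,|q|\to\infty}\ \max_{1\le i\le n}|qx_i-\theta_i|_{\mathbb{Z}}^{1/w_i}\,|q|>0\Big\},$$ with the convention $|x|_{\mathbb{Z}}^{1/w_i}:=0$ if $w_i=0$. A map $\mathbf{f}:U\to\mathbb{R}^n$ ($U\subset\mathbb{R}^d$ open) is $l$-nondegenerate at $\mathbf{x}\in U$ if $\mathbf{f}$ is $C^l$ on a neighbourhood of $\mathbf{x}$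 in $U$ and there are $n$ linearly independent vectors among the partial derivatives of $\mathbf{f}$ at $\mathbf{x}$ of orders between $1$ and $l$. $\mathbf{f}$ is nondegenerate if there is $l$ such that $\mathbf{f}$ is $l$-nondegenerate at Lebesgue almost every $\mathbf{x}\in U$. *)

(* Defs.v *)
From HB Require Import structures.
From mathcomp Require Import all_boot all_order all_algebra.
From mathcomp Require Import all_classical all_reals all_analysis.

Set Implicit Arguments.
Unset Strict Implicit.
Unset Printing Implicit Defensive.

Import Order.TTheory GRing.Theory Num.Theory.
Import numFieldNormedType.Exports.

Local Open Scope classical_set_scope.
Local Open Scope ring_scope.

Section lebesgue_outer_measure.
Context (R : realType) (d : nat).
Implicit Types (I : 'rV[R]_d * 'rV[R]_d) (A : set 'rV[R]_d).

Definition box I : set 'rV[R]_d :=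
  [set x | forall i, I.1 0 i <= x 0 i <= I.2 0 i].

(* The [Num.max 0] makes the volume of an empty box vanish as soon as
   [0 < d]. *)
Definition box_vol I : R := \prod_(i < d) Num.max 0 (I.2 0 i - I.1 0 i).

Definition lebesgue_outer A : \bar R :=
  ereal_inf [set (\esum_(I in C) (box_vol I)%:E)%E |
    C in [set C | countable C /\ A `<=` \bigcup_(I in C) box I]].

Let vol_ge0 I : (0 <= (box_vol I)%:E)%E.
Proof. by rewrite lee_fin; apply: prodr_ge0 => i _; rewrite le_max lexx. Qed.

Let lebesgue_outer_ge0 A : (0 <= lebesgue_outer A)%E.
Proof. by apply: le_ereal_inf_tmp => _ [C _ <-]; exact: esum_ge0. Qed.

Let lebesgue_outer0 : lebesgue_outer set0 = 0%E.
Proof.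
apply/eqP; rewrite eq_le lebesgue_outer_ge0 andbT.
apply: ereal_inf_lbound; exists set0; last exact: esum_set0.
by split => //; exact: countable0.
Qed.

Let le_lebesgue_outer : {homo lebesgue_outer : A B / A `<=` B >-> (A <= B)%E}.
Proof.
move=> A B AB; apply: ereal_inf_le_tmp => _ [C [cC BC] <-].
by exists C => //; split => //; exact: subset_trans BC.
Qed.

Let lebesgue_outer_sigma_subadditive : sigma_subadditive lebesgue_outer.
Proof.
move=> A; have [[i ioo]|] := pselect (exists i, lebesgue_outer (A i) = +oo%E).
  rewrite (eseries_pinfty _ _ ioo) ?leey// => n _.
  by rewrite -ltNye (lt_le_trans _ (lebesgue_outer_ge0 _)).
rewrite -forallNE => Aoo.
apply/lee_addgt0Pr => e e0.
rewrite (le_trans _ (epsilon_trick _ _ (ltW e0)))//.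
pose P n (C : set ('rV[R]_d * 'rV[R]_d)) :=
  [/\ countable C, A n `<=` \bigcup_(I in C) box I &
  (\esum_(I in C) (box_vol I)%:E <=
     lebesgue_outer (A n) + (e / (2 ^ n.+1)%:R)%:E)%E].
have [G PG] : {G : nat -> set ('rV[R]_d * 'rV[R]_d) & forall n, P n (G n)}.
  apply: (@choice _ _ P) => n.
  have en1 : 0 < e / (2 ^ n.+1)%:R by rewrite divr_gt0// ltr0n expn_gt0.
  have fin : lebesgue_outer (A n) \is a fin_num.
    by rewrite ge0_fin_numE// ltey; apply/eqP.
  have [_ [C [cC AC] <-] /ltW Cle] := lb_ereal_inf_adherent en1 fin.
  by exists C.
apply: (@le_trans _ _ (\esum_(I in \bigcup_n G n) (box_vol I)%:E)%E).
  apply: ereal_inf_lbound; exists (\bigcup_n G n) => //; split.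
    by apply: bigcup_countable => // n _; have [] := PG n.
  move=> x [n _ Anx]; have [_ /(_ _ Anx)[I GI xI] _] := PG n.
  by exists I => //; exists n.
rewrite seqDU_bigcup_eq nneseries_esumT; last first.
  by move=> n; rewrite adde_ge0// lee_fin divr_ge0// ltW.
have tG := @trivIset_seqDU _ G; rewrite esum_bigcupT//.
apply: le_esum => n _; have [_ _] := PG n; apply: le_trans.
apply: ereal_sup_le => _ [X [finX XG] <-].
exists X => //; split => //; exact: subset_trans (@subset_seqDU _ G n).
Qed.

HB.instance Definition _ := isOuterMeasure.Build R 'rV[R]_d lebesgue_outer
  lebesgue_outer0 lebesgue_outer_ge0 le_lebesgue_outer
  lebesgue_outer_sigma_subadditive.

(* The (complete) Lebesgue measure on R^d: the restriction of the outer measure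
   to its Caratheodory sigma-algebra. *)
Definition lebesgue_measure_rV :
  set (caratheodory_type lebesgue_outer) -> \bar R := lebesgue_outer.

HB.instance Definition _ := isMeasure.Build _ _ _ lebesgue_measure_rV
  (caratheodory_measure0 _) (@caratheodory_measure_ge0 _ _ _)
  (@caratheodory_measure_sigma_additive _ _ _).

End lebesgue_outer_measure.

Arguments lebesgue_measure_rV {R d}.

Section nondegenerate_maps.
Context (R : realType) (d n : nat).
Implicit Types (F : 'rV[R]_d -> 'rV[R]_n) (x : 'rV[R]_d) (U V : set 'rV[R]_d).

(* [partial [:: i1; ...; ik] F] is the k-th order derivative
   d_i1 (d_i2 (... (d_ik F))). *)
Fixpoint partial (s : seq 'I_d) F : 'rV[R]_d -> 'rV[R]_n :=
  if s is i :: s' then fun x => 'D_('e_i) (partial s' F) x else F.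

Definition Ck_on (l : nat) V F : Prop :=
  (forall s, (size s <= l)%N -> forall x, V x -> {for x, continuous (partial s F)})
  /\ (forall s i, (size s < l)%N ->
        forall x, V x -> derivable (partial s F) x 'e_i).

(* A map on the open set U is encoded as a total function; since V is open and
   contained in U, only its values on U matter. *)
Definition nondegenerate_at (l : nat) U F x : Prop :=
  (exists V, [/\ open V, V x, V `<=` U & Ck_on l V F]) /\
  (exists t : 'I_n -> seq 'I_d,
     (forall j, (1 <= size (t j) <= l)%N) /\
     row_free (\matrix_(j < n) partial (t j) F x)).

Definition nondegenerate_map U F : Prop :=
  exists l : nat, \forall x \ae lebesgue_measure_rV, U x -> nondegenerate_at l U F x.

End nondegenerate_maps.

(* [limf_einf] requires a [filteredType] but does not use its neighbourhoods. *)
HB.instance Definition _ := hasNbhs.Build int principal_filter.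

Section bad.
Context (R : realType).

Definition dist_int (x : R) : R := inf [set `|x - z%:~R| | z in [set: int]].

(* In the library [0^-1 = 0] and [a `^ 0 = 1], so the convention for [w = 0]
   has to be imposed. *)
Definition dist_int_pow (x w : R) : R :=
  if w == 0 then 0 else dist_int x `^ w^-1.

(* The filter "|q| tends to infinity, q a nonzero integer". *)
Definition int_infty : set_system int :=
  filter_from setT (fun N : nat => [set q : int | q != 0 /\ (N <= `|q|)%N]).

Definition weight n (w : 'rV[R]_n) : Prop :=
  (forall i, 0 <= w 0 i) /\ \sum_i w 0 i = 1.

(* All the terms of the maximum are nonnegative, so that 0 is a harmless
   default value. *)
Definition Bad n (theta w : 'rV[R]_n) : set 'rV[R]_n :=
  [set x : 'rV[R]_n | (0 < limf_einf (fun q : int =>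
     ((\big[Num.max/0]_(i < n) dist_int_pow (q%:~R * x 0 i - theta 0 i) (w 0 i))
       * `|q|%:~R)%:E) int_infty)%E].

End bad.

(* Main.v *)
Require Import Defs.
From mathcomp Require Import all_boot all_order all_algebra.
From mathcomp Require Import all_classical all_reals all_analysis.
From mathcomp Require Import ring lra zify perm.

(* Fix eps > 0. By a density argument it suffices that in every small cube P a
   fixed proportion of the points x admits q of size e^t with
   |q f_j(x) - theta_j|_Z < (eps / q)^(w_j) for all j.

   Quantitative nondivergence (Kleinbock-Margulis, here on dyadic grids) shows
   that for large t and most x in P, no nonzero integer form a has both
   |a_0 + a.f(x)| < dl e^(-t) and |a_j| < dl e^(w_j t), at finitely many
   prescribed times near t simultaneously.  At such an x, one of these times s
   also excludes the forms with |a_0 + a.f(x)| <= A e^(-s), |a_j| <= A e^(w_j s)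
   and a derivative at most e' e^(w_1 s) along the first coordinate: otherwise
   these forms at the various times would span larger and larger sublattices (two
   far apart times with the same span would force a small covolume in between,
   against the nondivergence), and finally n + 1 independent ones would have a
   determinant less than 1.

   Transference then gives q of size e^s / A with all q f_j - theta_j close to
   integers up to a multiple of the first derivative of f, which is absorbed by
   moving x by O(e^(-(1 + w_1) s)) in the first direction, w_1 being maximal.  A
   ball of comparable radius around the new point consists of good points.  *)

Set Implicit Arguments.
Unset Strict Implicit.
Unset Printing Implicit Defensive.

Import Order.TTheory GRing.Theory Num.Theory.
Import numFieldNormedType.Exports.

Local Open Scope classical_set_scope.
Local Open Scope ring_scope.

(** * Geometry of numbers *)

Section geometry_of_numbers.
Context {R : realType}.

(** The bound [A] of the excluded box must be large, since [q] of size e^t / A has to meet the given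
    [eps]. Nondivergence only excludes boxes of small size [dl], and by Minkowski's theorem a box of
    large size [A] contains a nonzero integer form at every point. Exclusion becomes possible
    through the separate bound e' on the derivative: chosen after [A], [dl] and the spread of the
    times, it makes the volume of the box small. The closeness [tau] of the jets to those at a fixed
    point comes last, so nullity is first proved on small cubes, with constants depending on that
    point; countably many rational cubes, values of [eps] and lower bounds for [q] then cover all
    cases. Measurability of the sets is never established: densities are replaced by bounds of the
    outer measure on all subcubes at once. *)

Definition int_mx m n (z : 'M[int]_(m, n)) : 'M[R]_(m, n) :=
  map_mx (intr : int -> R) z.

Lemma int_mxE m n (z : 'M[int]_(m, n)) i j : int_mx z i j = (z i j)%:~R.
Proof. exact: mxE. Qed.

Lemma int_mxM m n p (A : 'M[int]_(m, n)) (B : 'M[int]_(n, p)) :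
  int_mx (A *m B) = int_mx A *m int_mx B.
Proof. exact: map_mxM. Qed.

Lemma int_mx_unit n (A : 'M[int]_n) : A \in unitmx -> int_mx A \in unitmx.
Proof.
rewrite !unitmxE => uA.
by rewrite /int_mx det_map_mx rmorph_unit.
Qed.

Lemma norm_det_int_mx n (A : 'M[int]_n) : A \in unitmx -> `|\det (int_mx A)| = 1.
Proof.
rewrite unitmxE /int_mx det_map_mx => uA.
have /orP[] : (\det A == 1) || (\det A == -1) by move: uA; rewrite unfold_in.
- by move=> /eqP ->; rewrite normr1.
- by move=> /eqP ->; rewrite rmorphN1 normrN1.
Qed.

(** The infimum is positive, so a point where [f] is below inf + inf / 2 is a minimizer up to the
    factor 3/2. *)
Lemma near_minimizer (T : Type) (P : T -> Prop) (f : T -> R) dl :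
  0 < dl -> (exists z, P z) -> (forall z, P z -> dl <= f z) ->
  exists z, P z /\ forall z', P z' -> f z <= 3 / 2 * f z'.
Proof.
move=> dl0 [z0 Pz0] fge.
pose E := [set f z | z in P].
have E0 : E !=set0 by exists (f z0), z0.
have lE : lbound E dl by move=> _ [z Pz <-]; exact: fge.
have dlE : dl <= inf E by exact: lb_le_inf.
have hE : has_inf E by split => //; exists dl.
have i0 : 0 < inf E / 2 by rewrite divr_gt0 // (lt_le_trans dl0).
have [_ [z Pz <-] fz] := inf_adherent i0 hE.
exists z; split => // z' Pz'.
have : inf E <= f z' by apply: ge_inf; [exists dl | exists z'].
move=> h; lra.
Qed.

(** A lower bound for the first minimum, in the sup norm, of the lattice spanned by the rows of
    [B]. *)
Definition lattice_ge k n (B : 'M[R]_(k, n)) (dl : R) :=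
  forall z : 'rV[int]_k, z != 0 -> exists j, dl <= `|(int_mx z *m B) 0 j|.

(** In the Smith form of a one-row matrix only the first diagonal entry is present, so [z] is a
    multiple of the first row of the right unimodular factor: a primitive vector completed to a
    basis. *)
Lemma unimodular_multiple k (z : 'rV[int]_k.+1) :
  exists (U : 'M[int]_k.+1) (c : int), U \in unitmx /\ z = c *: row 0 U.
Proof.
have [L uL [V uV [d _ ->]]] := int_Smith_normal_form z.
exists V, (L 0 0 * d`_0); split => //.
apply/rowP => j; rewrite !mxE (bigD1 ord0) //= big1 ?addr0; last first.
  move=> i i0; rewrite !mxE big1 ?mul0r // => l _.
  by rewrite !mxE ord1 /= (_ : (0 == i :> nat)%N = false) ?mulr0n ?mulr0 //;
    apply/eqP => /esym /eqP h; move: i0; rewrite -val_eqE /= h.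
by rewrite !mxE big_ord1 !mxE /= mulr1n.
Qed.

(** The Schur complement of the pivot [B 0 p]. Column [p] is kept, as a zero column when the pivot
    is nonzero, so that column indices do not shift. *)
Definition eliminate k n (B : 'M[R]_(k.+1, n)) (p : 'I_n) : 'M[R]_(k, n) :=
  \matrix_(i, j) (B (lift 0 i) j - B (lift 0 i) p / B 0 p * B 0 j).

Lemma round_itv (x : R) : exists c : int, `|x - c%:~R| <= 1 / 2.
Proof.
exists (Num.floor (x + 1 / 2)).
have := floor_itv (x + 1 / 2); rewrite intrD => /andP[h1 h2].
by rewrite ler_norml; apply/andP; split; lra.
Qed.

(* The first row of [U] is a nearly shortest vector, and [p] is the position of
   its largest entry: rounding the [p]-th coordinate modulo this row then shows
   that the elimination keeps all vectors bounded away from 0. *)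
Lemma lattice_reduction k n (B : 'M[R]_(k.+1, n)) dl : 0 < dl -> lattice_ge B dl ->
  exists (U : 'M[int]_k.+1) (p : 'I_n), let B' := int_mx U *m B in
    [/\ U \in unitmx, forall j, `|B' 0 j| <= `|B' 0 p|, dl <= `|B' 0 p|
      & lattice_ge (eliminate B' p) (dl / 6)].
Proof.
move=> dl0 geB.
have nz1 : const_mx 1 != 0 :> 'rV[int]_k.+1.
  by apply/eqP => /rowP /(_ ord0); rewrite !mxE.
have [j0 _] := geB _ nz1.
pose nrm (z : 'rV[int]_k.+1) := `|(int_mx z *m B) 0
  [arg max_(j > j0) `|(int_mx z *m B) 0 j|]%O|.
have le_nrm z j : `|(int_mx z *m B) 0 j| <= nrm z.
  by rewrite /nrm; case: arg_maxP => // i _ /(_ j isT).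
have nrm_ge z : z != 0 -> dl <= nrm z.
  by move=> /geB[j hj]; exact: le_trans (le_nrm z j).
have [z [z0 zmin]] := near_minimizer (P := fun z : 'rV[int]_k.+1 => z != 0 : Prop)
  dl0 (ex_intro _ (const_mx 1) nz1) nrm_ge.
have [U [c [uU zU]]] := unimodular_multiple z.
have c0 : c != 0 by apply: contraNneq z0 => c0; rewrite zU c0 scale0r.
set p : 'I_n := [arg max_(j > j0) `|(int_mx (row 0 U) *m B) 0 j|]%O.
exists U, p => /=; set B' := int_mx U *m B.
have B'0 j : B' 0 j = (int_mx (row 0 U) *m B) 0 j.
  by rewrite /B' !mxE; apply: eq_bigr => i _; rewrite !mxE.
have r0 : row 0 U != 0.
  by apply: contraNneq z0 => r0; rewrite zU r0 scaler0.
have B'p : `|B' 0 p| = nrm (row 0 U) by rewrite B'0.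
(* Dividing [z] by the integer [c] only shortens it, so the primitive vector is nearly shortest as
   well. *)
have le_nrmU : nrm (row 0 U) <= nrm z.
  rewrite -B'p; apply: le_trans (le_nrm z p).
  have -> : (int_mx z *m B) 0 p = c%:~R * B' 0 p.
    rewrite zU B'0 !mxE mulr_sumr; apply: eq_bigr => i _.
    by rewrite !mxE intrM mulrA.
  rewrite normrM ler_peMl // -intr_norm ler1z.
  by rewrite -gtz0_ge1 normr_gt0.
have rmin z' : z' != 0 -> nrm (row 0 U) <= 3 / 2 * nrm z'.
  by move=> h; apply: le_trans le_nrmU (zmin _ h).
have b0 : 0 < `|B' 0 p| by rewrite B'p (lt_le_trans dl0) // nrm_ge.
have le_b j : `|B' 0 j| <= `|B' 0 p| by rewrite B'p B'0.
split => //; first by rewrite B'p nrm_ge.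
move=> y y0.
pose v j := \sum_i (y 0 i)%:~R * B' (lift 0 i) j.
have [e he] := round_itv (v p / B' 0 p).
pose y' : 'rV[int]_(1 + k) := row_mx (const_mx (- e)) y.
pose z' := (y' : 'rV[int]_k.+1) *m U.
have z'0 : z' != 0.
  apply: contraNneq y0 => h.
  have : y' = 0 by rewrite -[y'](mulmxK uU) -/z' h mul0mx.
  by move=> /rowP hy; apply/eqP/rowP => i; have := hy (rshift 1 i);
    rewrite row_mxEr !mxE.
have y'l i : y' 0 (lift 0 i : 'I_k.+1) = y 0 i.
  have := row_mxEr (const_mx (- e) : 'rV_1) y 0 i; rewrite -/y' => <-.
  by congr (y' _ _); exact/val_inj.
have y'0 : y' 0 (0 : 'I_k.+1) = - e.
  have := row_mxEl (const_mx (- e) : 'rV_1) y 0 ord0; rewrite -/y' [RHS]mxE => <-.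
  by congr (y' _ _); exact/val_inj.
have z'B j : (int_mx z' *m B) 0 j = v j - e%:~R * B' 0 j.
  rewrite /z' int_mxM -mulmxA -/B' mxE big_ord_recl addrC; congr (_ + _).
    by apply: eq_bigr => i _; rewrite int_mxE y'l.
  by rewrite int_mxE y'0 mulrNz mulNr.
have := rmin _ z'0; rewrite -B'p => hb.
have {hb} := hb; rewrite /nrm; set j := [arg max_(_ > _) _]%O => hb.
exists j; rewrite z'B in hb.
have -> : (int_mx y *m eliminate B' p) 0 j = v j - v p / B' 0 p * B' 0 j.
  rewrite /v !mulr_suml -sumrB mxE; apply: eq_bigr => i _; rewrite !mxE; ring.
(* By near minimality the first term is at least 2/3 of the pivot, and the rounding term is at most
   1/2 of it; the difference is the 1/6 of the statement. *)
have -> : v j - v p / B' 0 p * B' 0 j =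
  (v j - e%:~R * B' 0 j) - (v p / B' 0 p - e%:~R) * B' 0 j by ring.
have h1 : `|(v p / B' 0 p - e%:~R) * B' 0 j| <= 1 / 2 * `|B' 0 p|.
  by rewrite normrM ler_pM.
have h2 := lerB_dist (v j - e%:~R * B' 0 j) ((v p / B' 0 p - e%:~R) * B' 0 j).
have h3 : dl <= `|B' 0 p| by rewrite B'p nrm_ge.
lra.
Qed.

Definition ord_cons (T : Type) k (p : T) (f : 'I_k -> T) (i : 'I_k.+1) : T :=
  if unlift 0 i is Some j then f j else p.

Lemma det_eliminate k n (B : 'M[R]_(k.+1, n)) (p : 'I_n) (f : 'I_k -> 'I_n) :
  B 0 p != 0 ->
  \det (colsub (ord_cons p f) B)
  = B 0 p * \det (colsub f (eliminate B p)).
Proof.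
move=> b0.
set g := ord_cons p f.
have g0 : g 0 = p by rewrite /g /ord_cons unlift_none.
have gl i : g (lift 0 i) = f i by rewrite /g /ord_cons liftK.
pose b := B 0 p.
pose r : 'rV[R]_k := \row_j B 0 (f j).
pose c : 'cV[R]_k := \col_i B (lift 0 i) p.
have hL : lshift k (0 : 'I_1) = 0 :> 'I_k.+1 by exact/val_inj.
have hR i : rshift 1 i = lift 0 i :> 'I_k.+1 by exact/val_inj.
have eq : (colsub g B : 'M[R]_(1 + k)) =
    @block_mx R 1 k 1 k (1%:M) 0 (b^-1 *: c) (1%:M) *m
    @block_mx R 1 k 1 k (b%:M) r 0 (colsub f (eliminate B p)).
  rewrite mulmx_block !mul1mx !mul0mx !addr0 -[LHS](@submxK _ 1 k 1 k).
  congr block_mx; apply/matrixP => i j; rewrite !mxE ?ord1 /=.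
  - by rewrite hL g0 mulr1n.
  - by rewrite hL hR gl.
  - by rewrite big_ord1 !mxE hL hR g0 mulr1n mulrAC mulVf // mul1r.
  - by rewrite big_ord1 !mxE !hR gl /b; field.
rewrite [LHS](congr1 (fun M : 'M[R]_(1 + k) => \det M) eq).
by rewrite det_mulmx det_lblock det_ublock !det1 det_scalar1 mulr1 mul1r.
Qed.

(** A form of Minkowski's first theorem: a lattice without short vectors has large covolume,
    measured by one maximal minor. Each reduction step yields a pivot of size at least [dl] and
    divides the bound for the remaining rows by 6. *)
Lemma minor_ge k : exists2 c : R, 0 < c & forall n (B : 'M[R]_(k, n)) dl,
  0 < dl -> lattice_ge B dl ->
  exists f : 'I_k -> 'I_n, c * dl ^+ k <= `|\det (colsub f B)|.
Proof.
elim: k => [|k [c c0 IH]].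
  exists 1 => // n B dl _ _.
  exists (fun i : 'I_0 => match i with Ordinal m h =>
    False_rect 'I_n (notF h) end).
  by rewrite det_mx00 normr1 mul1r.
exists (c / 6 ^+ k); first by rewrite divr_gt0 // exprn_gt0.
move=> n B dl dl0 geB.
have [U [p [uU _ bp geE]]] := lattice_reduction dl0 geB.
have dl6 : 0 < dl / 6 by rewrite divr_gt0.
have [f hf] := IH _ _ _ dl6 geE.
set B' := int_mx U *m B in bp geE hf.
have b0 : B' 0 p != 0 by rewrite -normr_gt0 (lt_le_trans dl0).
exists (ord_cons p f).
have := det_eliminate f b0.
rewrite -mulmx_colsub det_mulmx => /(congr1 (fun x => `|x|)).
rewrite normrM norm_det_int_mx // mul1r normrM => ->.
have -> : c / 6 ^+ k * dl ^+ k.+1 = dl * (c * (dl / 6) ^+ k).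
  by rewrite expr_div_n exprS; ring.
apply: ler_pM => //; first exact: ltW.
by rewrite mulr_ge0 ?exprn_ge0 ?ltW.
Qed.

(* The elimination step reduces the congruences [B x = y] modulo 1 to the ones
   for the eliminated matrix, the first row being solved through [x p]. *)
Lemma transference k n : exists2 C : R, 0 < C &
  forall (B : 'M[R]_(k, n)) dl, 0 < dl -> lattice_ge B dl ->
  forall y : 'cV[R]_k, exists (x : 'cV[R]_n) (z : 'cV[int]_k),
    (forall j, `|x j 0| <= C / dl) /\ B *m x = y + int_mx z.
Proof.
elim: k => [|k [C C0 IH]].
  exists 1 => // B dl dl0 _ y; exists 0, 0; split; last first.
    by apply/matrixP => - [].
  by move=> j; rewrite mxE normr0 mul1r invr_ge0 ltW.
(* The vector [x'] is bounded by 6 C / dl, and the correction [s] by 1 / dl + n * 6 C / dl. *)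
exists (1 + (n%:R + 1) * (C * 6)).
  by rewrite ltr_pwDl // mulr_ge0 ?mulr_ge0 ?addr_ge0 // ltW.
move=> B dl dl0 geB y.
have [U [p [uU ble bp geE]]] := lattice_reduction dl0 geB.
have dl6 : 0 < dl / 6 by rewrite divr_gt0.
set B' := int_mx U *m B in ble bp geE.
have b0 : B' 0 p != 0 by rewrite -normr_gt0 (lt_le_trans dl0).
pose Y := int_mx U *m y.
have [e he] := round_itv (Y 0 0).
pose c := Y 0 0 - e%:~R.
have [x' [z' [x'C x'E]]] := IH _ _ dl6 geE
  (\col_i (Y (lift 0 i) 0 - B' (lift 0 i) p / B' 0 p * c)).
(* Moving the coordinate [p] alone solves the first row, where only a fractional part has to be
   reached; the right-hand side given to the induction hypothesis anticipates the effect on the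
   other rows. *)
pose s := (c - (B' *m x') 0 0) / B' 0 p.
pose x : 'cV[R]_n := x' + s *: delta_mx p 0.
have Bx i : (B' *m x) i 0 = (B' *m x') i 0 + s * B' i p.
  by rewrite mulmxDr -scalemxAr -colE !mxE.
pose z2 : 'cV[int]_k.+1 :=
  \col_i (if unlift 0 i is Some j then z' j 0 else - e).
have z20 : z2 0 0 = - e by rewrite mxE unlift_none.
have z2l i : z2 (lift 0 i) 0 = z' i 0 by rewrite mxE liftK.
exists x, (invmx U *m z2); split.
  move=> j; rewrite !mxE; apply: (@le_trans _ _ (`|x' j 0| + `|s|)).
    apply: le_trans (ler_normD _ _) _; rewrite lerD2l normrM.
    by rewrite ler_piMr //; case: (_ && _); rewrite ?normr1 ?normr0.
  have s1 : `|s| <= 1 / dl + n%:R * (C / (dl / 6)).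
    rewrite /s normrM normfV ler_pdivrMr ?normr_gt0 //.
    apply: le_trans (ler_normB _ _) _; rewrite mulrDl; apply: lerD.
      apply: le_trans he _; rewrite -mulrA mul1r.
      apply: (@le_trans _ _ 1); first lra.
      by rewrite mul1r mulrC ler_pdivlMr // mul1r.
    rewrite mxE; apply: le_trans (ler_norm_sum _ _ _) _.
    have -> : n%:R * (C / (dl / 6)) * `|B' 0 p| =
       \sum_(j < n) (`|B' 0 p| * (C / (dl / 6))).
      by rewrite sumr_const card_ord -mulr_natl; ring.
    by apply: ler_sum => i _; rewrite normrM ler_pM.
  have := x'C j.
  have -> : (1 + (n%:R + 1) * (C * 6)) / dl =
    1 / dl + n%:R * (C / (dl / 6)) + C / (dl / 6).
    by field; rewrite gt_eqF.
  by move: s1; lra.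
apply: (can_inj (mulKmx (int_mx_unit uU))); rewrite /=.
rewrite [in RHS]mulmxDr -int_mxM mulKVmx // mulmxA -/B' -/Y.
apply/colP => i; rewrite Bx [RHS]mxE int_mxE.
have [-> | [j ->]] : i = 0 \/ exists j, i = lift 0 j.
  by case: (unliftP 0 i) => [j ->|->]; [right; exists j | left].
  by rewrite z20 mulrNz /s divfK // /c; ring.
rewrite z2l; move/colP/(_ j): x'E; rewrite [RHS]mxE int_mxE [in RHS]mxE.
have -> : (eliminate B' p *m x') j 0 =
   (B' *m x') (lift 0 j) 0 - B' (lift 0 j) p / B' 0 p * (B' *m x') 0 0.
  rewrite !mxE mulr_sumr -sumrB; apply: eq_bigr => i' _; rewrite !mxE; ring.
move=> /eqP; rewrite subr_eq => /eqP ->; rewrite /s; field.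
exact: b0.
Qed.

End geometry_of_numbers.

(** * Grids of cubes and null sets *)

Section cubes.
Context {R : realType} {d : nat}.
Implicit Types (P Q : 'rV[R]_d * R) (x : 'rV[R]_d) (Z : set 'rV[R]_d).

Definition in_cube P : set 'rV[R]_d :=
  [set x | forall i, P.1 0 i <= x 0 i <= P.1 0 i + P.2].

Definition subcube P M (v : {ffun 'I_d -> 'I_M}) : 'rV[R]_d * R :=
  (\row_i (P.1 0 i + P.2 / M%:R * (v i)%:R), P.2 / M%:R).

Definition cube_le Q P := 0 < Q.2 /\
  forall i, P.1 0 i <= Q.1 0 i /\ Q.1 0 i + Q.2 <= P.1 0 i + P.2.

Definition cnt M P (B : set ('rV[R]_d * R)) : nat :=
  #|[pred v : {ffun 'I_d -> 'I_M} | `[< B (subcube P v) >]]|.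

Lemma cube_lexx P : 0 < P.2 -> cube_le P P.
Proof. by move=> P0; split => // i; rewrite !lexx. Qed.

Lemma cube_le_trans Q P P' : cube_le Q P -> cube_le P P' -> cube_le Q P'.
Proof.
move=> [Q0 QP] [_ PP']; split => // i.
by have [? ?] := QP i; have [? ?] := PP' i; split; lra.
Qed.

Lemma in_cube_le Q P : cube_le Q P -> in_cube Q `<=` in_cube P.
Proof.
move=> [_ QP] x Qx i; have [? ?] := QP i.
by have /andP[? ?] := Qx i; apply/andP; split; lra.
Qed.

Lemma subcube_le P M (v : {ffun 'I_d -> 'I_M}) : 0 < P.2 -> (0 < M)%N ->
  cube_le (subcube P v) P.
Proof.
move=> P0 M0; have M0' : 0 < M%:R :> R by rewrite ltr0n.
split => /= [|i]; first by rewrite divr_gt0.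
rewrite mxE; split; first by rewrite lerDl mulr_ge0 // divr_ge0 // ltW.
rewrite -addrA lerD2l -[X in _ + X]mulr1 -mulrDr natr1 -mulrA.
rewrite -[leRHS]mulr1 ler_pM2l // ler_pdivrMl // mulr1 ler_nat.
exact: ltn_ord.
Qed.

Lemma subcube_cover P M x : 0 < P.2 -> (0 < M)%N -> in_cube P x ->
  exists v : {ffun 'I_d -> 'I_M}, in_cube (subcube P v) x.
Proof.
move=> P0 M0 Px; have M0' : 0 < M%:R :> R by rewrite ltr0n.
have h i : exists k : 'I_M,
  P.1 0 i + P.2 / M%:R * k%:R <= x 0 i <= P.1 0 i + P.2 / M%:R * k.+1%:R.
  have /andP[x1 x2] := Px i.
  pose y := (x 0 i - P.1 0 i) / P.2 * M%:R.
  have y0 : 0 <= y by rewrite mulr_ge0 ?divr_ge0 ?subr_ge0 // ltW.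
  have yM : y <= M%:R.
    by rewrite /y ler_piMl ?ler0n // ler_pdivrMr // mul1r; lra.
  have xE : x 0 i = P.1 0 i + P.2 / M%:R * y.
    by rewrite /y; field; rewrite !gt_eqF.
  have [yM1 | yM1] := ltP y M%:R.
    have /andP[t1 t2] := truncn_itv y0.
    have tM : (Num.truncn y < M)%N.
      by rewrite -(ltr_nat R); exact: le_lt_trans t1 yM1.
    exists (Ordinal tM); rewrite xE /= !lerD2l !ler_pM2l ?divr_gt0 // t1 /=.
    exact: ltW.
  (* On the far face the truncation would be [M], out of range; the last subcube contains this
     face. *)
  have yE : y = M%:R by apply/eqP; rewrite eq_le yM yM1.
  case: M M0 M0' {yM yM1} @y y0 xE yE => // M _ M0' y y0 xE yE.
  exists ord_max; rewrite xE yE /= !lerD2l !ler_pM2l ?divr_gt0 //.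
  by rewrite lexx ler_nat leqnSn.
have [v hv] := choice h.
exists (finfun v) => i; rewrite mxE /= ffunE.
have := hv i; rewrite -natr1 mulrDr mulr1 addrA => /andP[-> ->] //.
Qed.

Lemma cntS M P (B B' : set ('rV[R]_d * R)) :
  (forall v : {ffun 'I_d -> 'I_M}, B (subcube P v) -> B' (subcube P v)) -> (cnt M P B <= cnt M P B')%N.
Proof.
move=> BB'; apply: subset_leq_card; apply/fintype.subsetP => v /asboolP h.
by apply/asboolP; exact: BB'.
Qed.

Lemma cntU M P (B B' : set ('rV[R]_d * R)) :
  (cnt M P (B `|` B') <= cnt M P B + cnt M P B')%N.
Proof.
rewrite /cnt -cardUI; apply: leq_trans (leq_addr _ _).
apply: subset_leq_card; apply/fintype.subsetP => v /asboolP h; apply/orP.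
by case: h => h; [left|right]; apply/asboolP.
Qed.

Lemma cntT M P (B : set ('rV[R]_d * R)) : (cnt M P B <= M ^ d)%N.
Proof. by apply: leq_trans (max_card _) _; rewrite card_ffun !card_ord. Qed.

Lemma cnt_set0 M P : cnt M P set0 = 0.
Proof. by apply: eq_card0 => v; apply/asboolP. Qed.

Lemma cnt1 P B : 0 < P.2 -> ~ B P -> cnt 1 P B = 0%N.
Proof.
move=> P0 nB; apply: eq_card0 => v; apply/asboolP.
suff -> : subcube P v = P by [].
rewrite /subcube divr1 [RHS]surjective_pairing; congr pair.
by apply/rowP => i; rewrite mxE ord1 mulr0 addr0.
Qed.

Definition ord_comb M1 M2 (i : 'I_M1) (j : 'I_M2) : 'I_(M1 * M2).
Proof.
apply: (@Ordinal _ (i * M2 + j)).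
apply: (@leq_trans (i * M2 + M2)); first by rewrite ltn_add2l.
by rewrite -mulSnr leq_mul2r (ltn_ord i) orbT.
Defined.

Lemma cnt_mul M1 M2 P (B : set ('rV[R]_d * R)) : (0 < M1)%N -> (0 < M2)%N ->
  cnt (M1 * M2) P B =
  (\sum_(v : {ffun 'I_d -> 'I_M1}) cnt M2 (subcube P v) B)%N.
Proof.
move=> M10 M20.
under eq_bigr do rewrite /cnt -sum1_card.
rewrite pair_big_dep /= /cnt -sum1_card.
pose g (p : {ffun 'I_d -> 'I_M1} * {ffun 'I_d -> 'I_M2}) :
  {ffun 'I_d -> 'I_(M1 * M2)} := [ffun i => ord_comb (p.1 i) (p.2 i)].
have lt1 (k : 'I_(M1 * M2)) : (k %/ M2 < M1)%N by rewrite ltn_divLR.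
have lt2 (k : 'I_(M1 * M2)) : (k %% M2 < M2)%N by rewrite ltn_mod.
pose g' (v : {ffun 'I_d -> 'I_(M1 * M2)}) :
  {ffun 'I_d -> 'I_M1} * {ffun 'I_d -> 'I_M2} :=
  ([ffun i => Ordinal (lt1 (v i))], [ffun i => Ordinal (lt2 (v i))]).
have gK : cancel g g'.
  move=> [v u]; congr pair; apply/ffunP => i; apply/val_inj; rewrite !ffunE /=.
    by rewrite divnMDl // divn_small ?addn0.
  by rewrite modnMDl modn_small.
have g'K : cancel g' g.
  by move=> v; apply/ffunP => i; apply/val_inj; rewrite !ffunE /= -divn_eq.
rewrite (reindex g); last by exists g' => ? _; [exact: gK | exact: g'K].
apply: eq_bigl => -[v u]; rewrite !inE /=; congr (`[< B _ >]).
have n1 : M1%:R != 0 :> R by rewrite pnatr_eq0 -lt0n.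
have n2 : M2%:R != 0 :> R by rewrite pnatr_eq0 -lt0n.
rewrite /subcube /= natrM; congr pair; last by field; rewrite n1 n2.
apply/rowP => i; rewrite !mxE !ffunE /= natrD natrM; field; by rewrite n1 n2.
Qed.

End cubes.

Section null_criterion.
Context {R : realType} {d : nat}.
Implicit Types (P Q : 'rV[R]_d * R) (x : 'rV[R]_d) (Z : set 'rV[R]_d).
Local Notation mu := (@lebesgue_outer R d).

Lemma outer_le Z Z' : Z `<=` Z' -> (mu Z <= mu Z')%E.
Proof. exact: le_outer_measure. Qed.

Lemma outer_cube P : 0 < P.2 -> (mu (in_cube P) <= (P.2 ^+ d)%:E)%E.
Proof.
move=> P0; apply: ereal_inf_lbound.
exists [set (P.1, \row_i (P.1 0 i + P.2))].
  split; first exact: countable1.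
  by move=> x Px; eexists; [reflexivity|] => i /=; rewrite mxE.
rewrite esum_set1 ?lee_fin.
  congr (_%:E); rewrite /box_vol /=.
  under eq_bigr do rewrite mxE addrAC subrr add0r (max_r (ltW P0)).
  by rewrite prodr_const card_ord.
by apply: prodr_ge0 => i _; rewrite le_max lexx.
Qed.

Lemma outer_grid Z P M : 0 < P.2 -> (0 < M)%N ->
  (mu (Z `&` in_cube P) <=
   \sum_(v : {ffun 'I_d -> 'I_M}) mu (Z `&` in_cube (subcube P v)))%E.
Proof.
move=> P0 M0.
have fin (s : seq {ffun 'I_d -> 'I_M}) :
  (mu (\bigcup_(v in [set` s]) (Z `&` in_cube (subcube P v))) <=
   \sum_(v <- s) mu (Z `&` in_cube (subcube P v)))%E.
  elim: s => [|v s IH].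
    have -> : [set` [::]] = set0 :> set {ffun 'I_d -> 'I_M}.
      by apply/seteqP; split.
    by rewrite big_nil bigcup_set0 outer_measure0.
  have -> : [set` v :: s] = v |` [set` s].
    apply/seteqP; split => x /=; rewrite in_cons.
      by move=> /orP[/eqP|]; [left | right].
    by move=> [->|->]; rewrite ?eqxx ?orbT.
  rewrite big_cons bigcup_setU1.
  by apply: le_trans (outer_measureU2 _ _ _) _; exact: leeD.
have := fin (enum {ffun 'I_d -> 'I_M}); rewrite big_enum /=.
apply: le_trans; apply: outer_le => x [Zx Px].
have [v xv] := subcube_cover P0 M0 Px.
by exists v => //=; rewrite mem_enum.
Qed.

(** A substitute for the density theorem that works for arbitrary [Z]. The trivial bound holds with
    c = 1, and each use of the hypothesis, valid for all subcubes simultaneously, multiplies [c] by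
    1 - kp. *)
Lemma null_criterion Z P0 (kp : R) : 0 < kp -> kp <= 1 -> 0 < P0.2 ->
  (forall P c, cube_le P P0 -> 0 <= c ->
     (forall Q, cube_le Q P -> (mu (Z `&` in_cube Q) <= (c * Q.2 ^+ d)%:E)%E) ->
     (mu (Z `&` in_cube P) <= ((1 - kp) * c * P.2 ^+ d)%:E)%E) ->
  mu (Z `&` in_cube P0) = 0%E.
Proof.
move=> kp0 kp1 P00 step.
have it k : forall P, cube_le P P0 ->
  (mu (Z `&` in_cube P) <= ((1 - kp) ^+ k * P.2 ^+ d)%:E)%E.
  elim: k => [|k IH] P PP0.
    rewrite expr0 mul1r; apply: le_trans (outer_cube _); last by case: PP0.
    by apply: outer_le; exact: subIsetr.
  rewrite exprS; apply: step => //; first by rewrite exprn_ge0 // subr_ge0.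
  by move=> Q QP; apply: IH; exact: cube_le_trans QP PP0.
apply/eqP; rewrite eq_le outer_measure_ge0 andbT.
have cv : ((1 - kp) ^+ k * P0.2 ^+ d)%:E @[k --> \oo] --> (0 : \bar R)%E.
  apply/fine_cvgP; split; first by apply: nearW => k.
  rewrite -[X in _ --> X](mul0r (P0.2 ^+ d)).
  apply: cvgMl; apply: cvg_expr; rewrite ger0_norm ?subr_ge0 //; lra.
apply: cvge_ge cv.
by apply: nearW => k; apply: it; exact: cube_lexx.
Qed.

Lemma outer_drop_subcube Z P M (v0 : {ffun 'I_d -> 'I_M}) c :
  0 < P.2 -> (0 < M)%N -> Z `&` in_cube (subcube P v0) = set0 ->
  (forall Q, cube_le Q P -> (mu (Z `&` in_cube Q) <= (c * Q.2 ^+ d)%:E)%E) ->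
  (mu (Z `&` in_cube P) <= ((1 - (M ^ d)%:R^-1) * c * P.2 ^+ d)%:E)%E.
Proof.
move=> P0 M0 Z0 hc; apply: le_trans (outer_grid _ P0 M0) _.
rewrite (bigD1 v0) //= Z0 outer_measure0 add0e.
have Mn0 : (M ^ d)%:R != 0 :> R by rewrite pnatr_eq0 -lt0n expn_gt0 M0.
apply: (@le_trans _ _ (\sum_(v | v != v0) (c * (P.2 / M%:R) ^+ d)%:E)%E).
  by apply: lee_sum => v _; apply: hc; exact: subcube_le.
rewrite sumEFin lee_fin sumr_const cardC1 card_ffun !card_ord.
rewrite -[leLHS]mulr_natr -subn1 natrB ?expn_gt0 ?M0 // expr_div_n.
by rewrite -natrX le_eqVlt; apply/orP; left; apply/eqP; field.
Qed.

Lemma outer_half_subcubes Z P M (B : set ('rV[R]_d * R)) c kp :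
  0 < P.2 -> (0 < M)%N -> 0 <= c -> 0 <= kp -> (M ^ d <= 2 * cnt M P B)%N ->
  (forall v : {ffun 'I_d -> 'I_M}, B (subcube P v) ->
    (mu (Z `&` in_cube (subcube P v)) <=
      ((1 - kp) * c * (P.2 / M%:R) ^+ d)%:E)%E) ->
  (forall Q, cube_le Q P -> (mu (Z `&` in_cube Q) <= (c * Q.2 ^+ d)%:E)%E) ->
  (mu (Z `&` in_cube P) <= ((1 - kp / 2) * c * P.2 ^+ d)%:E)%E.
Proof.
move=> P0 M0 c0 kp0 cB hB hc; apply: le_trans (outer_grid _ P0 M0) _.
have Mn0 : (M ^ d)%:R != 0 :> R by rewrite pnatr_eq0 -lt0n expn_gt0 M0.
pose V := (P.2 / M%:R) ^+ d.
have V0 : 0 <= V by rewrite exprn_ge0 // divr_ge0 // ltW.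
apply: (@le_trans _ _ (\sum_(v : {ffun 'I_d -> 'I_M})
    (c * V - (if `[< B (subcube P v) >] then kp * c * V else 0))%:E)%E).
  apply: lee_sum => v _; case: asboolP => [/hB|_].
    by rewrite mulrBl mul1r mulrBl.
  by rewrite subr0; apply: hc; exact: subcube_le.
rewrite sumEFin lee_fin sumrB sumr_const card_ffun !card_ord -big_mkcond.
rewrite sumr_const -[X in X - _ <= _]mulr_natr -[X in _ - X <= _]mulr_natr.
have -> : #|[pred v : {ffun 'I_d -> 'I_M} | `[< B (subcube P v) >]]| = cnt M P B.
  by [].
have -> : (1 - kp / 2) * c * P.2 ^+ d =
   c * V * (M ^ d)%:R - kp * c * V * ((M ^ d)%:R / 2).
  by rewrite /V expr_div_n -natrX; field.
rewrite lerD2l lerN2; apply: ler_wpM2l; first by rewrite !mulr_ge0.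
by rewrite ler_pdivrMr // mulrC -natrM ler_nat.
Qed.

End null_criterion.

(** * Sublevel sets of functions with controlled derivatives *)

Section one_variable.
Context {R : realType}.

Lemma mvt (f df : R -> R) (a b : R) : a < b ->
  (forall x, a <= x <= b -> is_derive x (1 : R) f (df x)) ->
  exists c, [/\ a < c, c < b & f b - f a = df c * (b - a)].
Proof.
move=> ab fd.
have [x xab||c] := @MVT _ f df a b ab.
- by apply: fd; move: xab; rewrite in_itv /= => /andP[/ltW -> /ltW ->].
- apply: derivable_within_continuous => x; rewrite in_itv /= => xab.
  exact: (ex_derive (is_derive := fd x xab)).
by rewrite in_itv /= => /andP[ac cb] e; exists c.
Qed.

Lemma mvt_norm (f df : R -> R) (a L B : R) : 0 < L ->
  (forall x, a <= x <= a + L -> is_derive x (1 : R) f (df x)) ->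
  (forall x, a <= x <= a + L -> `|df x| <= B) ->
  forall x y, a <= x <= a + L -> a <= y <= a + L -> `|f x - f y| <= B * L.
Proof.
move=> L0 fd dB.
have B0 : 0 <= B.
  by apply: le_trans (normr_ge0 _) (dB a _); rewrite lexx lerDl ltW.
have wlog x y : a <= x <= a + L -> a <= y <= a + L -> x < y ->
  `|f x - f y| <= B * L.
  move=> /andP[x1 x2] /andP[y1 y2] xy.
  have [|c [c1 c2 e]] := @mvt f df x y xy.
    by move=> t /andP[t1 t2]; apply: fd; apply/andP; split; lra.
  rewrite distrC e normrM; apply: ler_pM => //.
    by apply: dB; apply/andP; split; lra.
  by rewrite ger0_norm; lra.
move=> x y hx hy; have [xy|yx|->] := ltgtP x y.
- exact: wlog.
- by rewrite distrC; exact: wlog.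
- by rewrite subrr normr0 mulr_ge0 // ltW.
Qed.

(* Between two consecutive points where [g 0] is small there is one where [g 1]
   is small: halving the number of points [l] times reaches [g l]. *)
Lemma small_at_separated_points l (lam : R) : 0 < lam ->
  exists2 C, 0 < C & forall (g : nat -> R -> R) (a L e om : R) (t : nat -> R),
  0 < L ->
  (forall k x, (k < l)%N -> a <= x <= a + L -> is_derive x (1 : R) (g k) (g k.+1 x)) ->
  (forall x y, a <= x <= a + L -> a <= y <= a + L -> `|g l x - g l y| <= om) ->
  (forall k, (k < 2 ^ l)%N -> a <= t k <= a + L) ->
  (forall k, (k.+1 < 2 ^ l)%N -> t k + lam * L <= t k.+1) ->
  (forall k, (k < 2 ^ l)%N -> `|g 0 (t k)| <= e) ->
  forall x, a <= x <= a + L -> `|g 0 x| <= C * e + L ^+ l * om.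
Proof.
move=> lam0; elim: l => [|l [C C0 IH]].
  exists 1 => // g a L e om t L0 gd osc tab _ te x xab.
  have := osc _ _ xab (tab 0%N isT); have := te 0%N isT.
  have := ler_normD (g 0%N x - g 0%N (t 0%N)) (g 0%N (t 0%N)).
  by rewrite subrK expr0 !mul1r; lra.
exists (1 + C * (2 / lam)); first by rewrite addr_gt0 // mulr_gt0 ?divr_gt0.
move=> g a L e om t L0 gd osc tab tsep te x xab.
have d2 k : (k < 2 ^ l -> k.*2.+1 < 2 ^ l.+1)%N by rewrite expnS; lia.
have hk k : exists xi, (k < 2 ^ l)%N ->
  [/\ t k.*2 <= xi, xi <= t k.*2.+1 & `|g 1%N xi| <= 2 * e / (lam * L)].
  have [kl|] := ltnP k (2 ^ l); last by move=> _; exists 0.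
  have k2 := d2 _ kl.
  have k1 : (k.*2 < 2 ^ l.+1)%N by exact: ltn_trans k2.
  have sep := tsep _ k2.
  have lL : 0 < lam * L by exact: mulr_gt0.
  have tt : t k.*2 < t k.*2.+1 by lra.
  have [|c [c1 c2 ce]] := @mvt (g 0%N) (g 1%N) _ _ tt.
    move=> y /andP[y1 y2]; apply: gd => //.
    have /andP[? ?] := tab _ k1; have /andP[? ?] := tab _ k2.
    by apply/andP; split; lra.
  exists c => _; split; [exact: ltW | exact: ltW |].
  rewrite ler_pdivlMr //.
  have -> : 2 * e = e + e by ring.
  apply: le_trans (lerD (te _ k2) (te _ k1)).
  apply: le_trans (ler_normB _ _); rewrite ce normrM.
  apply: ler_wpM2l => //; rewrite ger0_norm; lra.
have [xi hxi] := choice hk.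
have g1 y : a <= y <= a + L ->
    `|g 1%N y| <= C * (2 * e / (lam * L)) + L ^+ l * om.
  apply: (IH (fun k => g k.+1) a L _ om xi) => //.
  - by move=> k z kl; exact: gd.
  - move=> k kl; have [x1 x2 _] := hxi k kl.
    have /andP[? ?] := tab _ (d2 _ kl).
    have /andP[? ?] := tab _ (ltn_trans (ltnSn _) (d2 _ kl)).
    by apply/andP; split; lra.
  (* As [xi k] is at most [t] at 2k + 1 and [xi] at k + 1 is at least [t] at 2k + 2, the new points
     inherit the separation. *)
  - move=> k kl; have kl' := ltn_trans (ltnSn _) kl.
    have [x1 x2 _] := hxi k kl'; have [y1 y2 _] := hxi _ kl.
    have := tsep k.*2.+1 (ltn_trans (ltnSn _) (d2 _ kl)).
    by move: y1 y2; rewrite doubleS; lra.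
  - by move=> k kl; have [_ _] := hxi k kl.
have h0 : (0 < 2 ^ l.+1)%N by rewrite expn_gt0.
have := mvt_norm L0 (fun y hy => gd 0%N y isT hy) g1 xab (tab 0%N h0).
have := te 0%N h0; have := ler_normD (g 0%N x - g 0%N (t 0%N)) (g 0%N (t 0%N)).
rewrite subrK.
have -> : (C * (2 * e / (lam * L)) + L ^+ l * om) * L =
  C * (2 / lam) * e + L ^+ l.+1 * om.
  by rewrite exprS; field; rewrite !gt_eqF.
lra.
Qed.

(** List [I] increasingly and keep every [s]-th point, with [s] the quotient of its cardinal by 2^l:
    this gives 2^l separated points. The threshold [K] ensures 0 < s, and the exponent l + 1 in
    [lam] pays for the rounding of the quotient. *)
Lemma small_on_grid_points l (eta : R) : 0 < eta ->
  exists2 C, 0 < C & exists K : nat,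
  forall (g : nat -> R -> R) (a L e om : R) M (I : {set 'I_M}),
  0 < L -> (K <= M)%N -> eta * M%:R <= #|I|%:R ->
  (forall k x, (k < l)%N -> a <= x <= a + L -> is_derive x (1 : R) (g k) (g k.+1 x)) ->
  (forall x y, a <= x <= a + L -> a <= y <= a + L -> `|g l x - g l y| <= om) ->
  (forall k, k \in I -> `|g 0 (a + L / M%:R * k%:R)| <= e) ->
  forall x, a <= x <= a + L -> `|g 0 x| <= C * e + L ^+ l * om.
Proof.
move=> eta0; pose lam := eta / (2 ^ l.+1)%:R.
have lam0 : 0 < lam by rewrite divr_gt0 // ltr0n expn_gt0.
have [C C0 HC] := small_at_separated_points l lam0.
exists C => //; exists (Num.truncn ((2 ^ l)%:R / eta)).+1.
move=> g a L e om M I L0 KM cI gd osc gI.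
have M0 : (0 < M)%N by exact: leq_trans KM.
have M0' : 0 < M%:R :> R by rewrite ltr0n.
have cI2 : (2 ^ l <= #|I|)%N.
  rewrite -(ler_nat R); apply: le_trans cI.
  rewrite mulrC -ler_pdivrMr //; apply: le_trans (_ : _ <= M%:R) => //.
  by apply/ltW/(lt_le_trans (truncnS_gt _)); rewrite ler_nat.
pose s := (#|I| %/ 2 ^ l)%N.
have s0 : (0 < s)%N by rewrite divn_gt0 // expn_gt0.
pose us := [seq val k | k <- enum I].
have sz : size us = #|I| by rewrite size_map -cardE.
have us_sorted : sorted ltn us.
  apply: (subseq_sorted ltn_trans _ (iota_ltn_sorted 0 M)).
  by rewrite -val_enum_ord; apply: map_subseq; rewrite enumT; exact: filter_subseq.
pose u := nth 0%N us.
have uD i m : (i + m < #|I|)%N -> (u i + m <= u (i + m)%N)%N.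
  elim: m => [|m IH]; first by rewrite !addn0.
  rewrite !addnS => im; apply: leq_ltn_trans (IH (ltnW im)) _.
  by apply: (sorted_ltn_nth ltn_trans 0%N us_sorted); rewrite ?inE ?sz ?ltnS // ltnW.
have ks k : (k < 2 ^ l)%N -> (k * s < #|I|)%N.
  move=> kl; apply: (@leq_trans (2 ^ l * s)); first by rewrite ltn_pmul2r.
  by rewrite mulnC leq_divM.
have uI k : (k < #|I|)%N -> exists2 k' : 'I_M, k' \in I & u k = k'.
  move=> kI; have : u k \in us by rewrite mem_nth ?sz.
  by move=> /mapP[k' k'I ->]; exists k' => //; move: k'I; rewrite mem_enum.
apply: (HC g a L e om (fun k => a + L / M%:R * (u (k * s)%N)%:R)) => //.
- move=> k /ks /uI [k' _ ->].
  apply/andP; split.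
    by rewrite lerDl mulr_ge0 // divr_ge0 // ltW.
  rewrite lerD2l -mulrA ler_piMr //; first exact: ltW.
  by rewrite ler_pdivrMl // mulr1 ler_nat ltnW.
- move=> k /ks kl; rewrite -addrA lerD2l.
  apply: (@le_trans _ _ (L / M%:R * ((u (k * s) + s)%N)%:R)); last first.
    apply: ler_wpM2l; first by rewrite divr_ge0 // ltW.
    by rewrite ler_nat mulSn [(s + _)%N]addnC; apply: uD; rewrite addnC -mulSn.
  rewrite natrD mulrDr lerD2l.
  rewrite [lam * L]mulrC -mulrA ler_pM2l // mulrC ler_pdivlMr //.
  rewrite /lam mulrAC ler_pdivrMr ?ltr0n ?expn_gt0 //.
  apply: le_trans cI _; rewrite -natrM ler_nat.
  have := ltn_ceil #|I| (_ : 0 < 2 ^ l)%N; rewrite expn_gt0 => /(_ isT).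
  by rewrite -/s expnS; nia.
- by move=> k /ks /uI [k' k'I ->]; exact: gI.
Qed.

End one_variable.

Section jets.
Context {R : realType} {d : nat}.
Implicit Types (P Q : 'rV[R]_d * R) (x : 'rV[R]_d) (H : seq 'I_d -> 'rV[R]_d -> R).

Definition upd x (i : 'I_d) (t : R) : 'rV[R]_d :=
  \row_j (if j == i then t else x 0 j).

Lemma updE x i t : upd x i t 0 i = t.
Proof. by rewrite mxE eqxx. Qed.

Lemma upd_id x i : upd x i (x 0 i) = x.
Proof. by apply/rowP => j; rewrite mxE; case: eqP => [->|]. Qed.

Lemma upd_upd x i t t' : upd (upd x i t) i t' = upd x i t'.
Proof. by apply/rowP => j; rewrite !mxE; case: eqP. Qed.

(* [H s] plays the role of the iterated partial derivative of [H [::]] along the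
   list of directions [s], the head of [s] being the last one applied. *)
Definition jet_on l (V : set 'rV[R]_d) H := forall s i x, (size s < l)%N -> V x ->
  is_derive (x 0 i) (1 : R) (fun t => H s (upd x i t)) (H (i :: s) x).

Lemma jet_onS l l' (V V' : set 'rV[R]_d) H :
  (l' <= l)%N -> V' `<=` V -> jet_on l V H -> jet_on l' V' H.
Proof.
by move=> ll VV hH s i x sl Vx; apply: hH; [exact: leq_trans ll | exact: VV].
Qed.

Lemma jet_upd l V H s i x t : jet_on l V H -> (size s < l)%N -> V (upd x i t) ->
  is_derive t (1 : R) (fun t => H s (upd x i t)) (H (i :: s) (upd x i t)).
Proof.
move=> hH sl Vx; have := hH s i _ sl Vx; rewrite updE.
by under eq_fun do rewrite upd_upd.
Qed.

Lemma in_cube_upd P x i t : in_cube P x -> P.1 0 i <= t <= P.1 0 i + P.2 ->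
  in_cube P (upd x i t).
Proof. by move=> Px ht j; rewrite mxE; case: eqP => [->|_]. Qed.

Definition corner P M (v : {ffun 'I_d -> 'I_M}) := (subcube P v).1.

(** Interpolates between the corner alone, for empty [J], and the whole cube, when [J] contains
    every direction. *)
Definition free_corner (J : seq 'I_d) P M (v : {ffun 'I_d -> 'I_M}) x :=
  in_cube P x /\ forall i, i \notin J -> x 0 i = corner P v 0 i.

Definition updf M (v : {ffun 'I_d -> 'I_M}) i k : {ffun 'I_d -> 'I_M} :=
  [ffun j => if j == i then k else v j].

(** Double counting: exchanging [v i] and [k] is an involution of the pairs, so each element of [A]
    is met [M] times. *)
Lemma sum_updf M i (A : {set {ffun 'I_d -> 'I_M}}) :
  (\sum_(v : {ffun 'I_d -> 'I_M}) #|finset (fun k => updf v i k \in A)| = M * #|A|)%N.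
Proof.
pose sw (p : {ffun 'I_d -> 'I_M} * 'I_M) := (updf p.1 i p.2, p.1 i).
have swK : involutive sw.
  move=> [v k]; rewrite /sw /=; congr pair; last by rewrite ffunE eqxx.
  by apply/ffunP => j; rewrite !ffunE; case: eqP => [->|].
under eq_bigr do rewrite -sum1_card.
rewrite pair_big_dep /= (reindex_inj (inv_inj swK)) /=.
transitivity (\sum_(v in A) \sum_(k < M) 1)%N.
  rewrite pair_big_dep; apply: eq_bigl => -[v k].
  by have /(congr1 fst) /= e := swK (v, k); rewrite /= !inE e andbT.
under eq_bigr do rewrite sum1_card card_ord.
by rewrite sum_nat_const mulnC.
Qed.

(** A discrete Fubini and Markov argument: lines with a proportion of [A] below eta / 2 account for
    at most half of the guaranteed eta, so the other lines must supply the rest. *)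
Lemma half_lines M i (A : {set {ffun 'I_d -> 'I_M}}) (eta : R) :
  (0 < M)%N -> eta * (M ^ d)%:R <= #|A|%:R ->
  eta / 2 * (M ^ d)%:R <=
    #|finset (fun v => eta / 2 * M%:R <= #|finset (fun k => updf v i k \in A)|%:R)|%:R.
Proof.
move=> M0 hA; set A' := finset (fun v => _).
have M0' : 0 < M%:R :> R by rewrite ltr0n.
have [e0|e0] := leP eta 0.
  apply: le_trans (ler0n _ _); rewrite mulr_le0_ge0 //; lra.
rewrite -(ler_pM2r M0').
have : M%:R * #|A|%:R <= #|A'|%:R * M%:R + (M ^ d)%:R * (eta / 2 * M%:R).
  rewrite -natrM -(sum_updf i) natr_sum.
  rewrite (bigID (mem A')) /=; apply: lerD.
    apply: (@le_trans _ _ (\sum_(v in A') M%:R)).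
      apply: ler_sum => v _; rewrite ler_nat.
      by apply: leq_trans (max_card _) _; rewrite card_ord.
    by rewrite sumr_const -[leLHS]mulr_natl.
  apply: (@le_trans _ _ (\sum_(v : {ffun 'I_d -> 'I_M}) (eta / 2 * M%:R))).
    rewrite [leLHS]big_mkcond; apply: ler_sum => v _.
    case: ifP => [|_]; last by rewrite mulr_ge0 ?ler0n // divr_ge0 // ltW.
    by rewrite inE -ltNge => /ltW.
  by rewrite sumr_const card_ffun !card_ord -[leLHS]mulr_natl.
have : M%:R * (eta * (M ^ d)%:R) <= M%:R * #|A|%:R by rewrite ler_pM2l.
lra.
Qed.

Definition osc_le l P H (om : R) := forall i x y, in_cube P x -> in_cube P y ->
  `|H (nseq l i) x - H (nseq l i) y| <= om.

Lemma free_step l (eta : R) : 0 < eta ->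
  exists2 C, 0 < C & exists K : nat, forall P H om M J i
    (A : {set {ffun 'I_d -> 'I_M}}) E,
  0 < P.2 -> jet_on l (in_cube P) H -> osc_le l P H om ->
  (0 < M)%N -> (K <= M)%N -> eta * (M ^ d)%:R <= #|A|%:R ->
  (forall v, v \in A -> forall x, free_corner J P v x -> `|H [::] x| <= E) ->
  exists A' : {set {ffun 'I_d -> 'I_M}}, eta / 2 * (M ^ d)%:R <= #|A'|%:R /\
    forall v, v \in A' -> forall x, free_corner (i :: J) P v x ->
      `|H [::] x| <= C * E + P.2 ^+ l * om.
Proof.
move=> eta0; have eta20 : 0 < eta / 2 by rewrite divr_gt0.
have [C C0 [K HC]] := small_on_grid_points l eta20.
exists C => //; exists K => P H om M J i A E P0 hH osc M0 KM hA AE.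
eexists; split; first exact: (half_lines i M0 hA).
move=> v; rewrite inE => hv x [Px fx].
have M0' : 0 < M%:R :> R by rewrite ltr0n.
rewrite -[x](upd_id x i).
apply: (HC (fun k t => H (nseq k i) (upd x i t)) (P.1 0 i) P.2 _ _ M
  (finset (fun k => updf v i k \in A))) => //.
- move=> k t kl ht; apply: (@jet_upd l (in_cube P) H (nseq k i)) => //.
    by rewrite size_nseq.
  exact: in_cube_upd.
- by move=> t t' ht ht'; apply: osc; exact: in_cube_upd.
- move=> k; rewrite inE => kA; apply: (AE _ kA).
  have kP : P.1 0 i <= P.1 0 i + P.2 / M%:R * k%:R <= P.1 0 i + P.2.
    apply/andP; split; first by rewrite lerDl mulr_ge0 // divr_ge0 // ltW.
    rewrite lerD2l -mulrA ler_piMr //; first exact: ltW.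
    by rewrite ler_pdivrMl // mulr1 ler_nat ltnW.
  split; first exact: in_cube_upd.
  move=> j jJ; rewrite /corner !mxE ffunE; case: eqP => [->|/eqP ji] //.
  by rewrite fx ?inE ?(negbTE ji) // /corner mxE.
Qed.

(** The coordinates are freed one at a time, each at the cost of halving the proportion of good
    corners. When all directions are free, one surviving corner controls the whole cube. *)
Lemma grid_small l (eta : R) : 0 < eta ->
  exists2 C, 0 < C & exists K : nat, forall P H om M
    (A : {set {ffun 'I_d -> 'I_M}}) E,
  0 < P.2 -> jet_on l (in_cube P) H -> osc_le l P H om ->
  (0 < M)%N -> (K <= M)%N -> eta * (M ^ d)%:R <= #|A|%:R ->
  (forall v, v \in A -> `|H [::] (corner P v)| <= E) ->
  0 <= E -> 0 <= om ->
  forall x, in_cube P x -> `|H [::] x| <= C * (E + P.2 ^+ l * om).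
Proof.
move=> eta0.
have it (s : seq 'I_d) : forall eta : R, 0 < eta ->
  exists2 C, 0 < C & exists K : nat, forall P H om M J
    (A : {set {ffun 'I_d -> 'I_M}}) E,
  0 < P.2 -> jet_on l (in_cube P) H -> osc_le l P H om ->
  (0 < M)%N -> (K <= M)%N -> eta * (M ^ d)%:R <= #|A|%:R ->
  (forall v, v \in A -> forall x, free_corner J P v x -> `|H [::] x| <= E) ->
  0 <= E -> 0 <= om ->
  exists v : {ffun 'I_d -> 'I_M}, forall x, free_corner (s ++ J) P v x ->
      `|H [::] x| <= C * (E + P.2 ^+ l * om).
  elim: s => [|i s IH] {}eta {}eta0.
    exists 1 => //; exists 0%N => P H om M J A E P0 _ _ M0 _ hA AE E0 om0.
    have : (0 < #|A|)%N.
      rewrite -(ltr_nat R); apply: lt_le_trans hA.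
      by rewrite mulr_gt0 // ltr0n expn_gt0 M0.
    move=> /card_gt0P[v vA]; exists v => x fx; rewrite mul1r.
    apply: le_trans (AE v vA x fx) _.
    by rewrite lerDl mulr_ge0 // exprn_ge0 // ltW.
  have eta20 : 0 < eta / 2 by rewrite divr_gt0.
  have [C1 C10 [K1 H1]] := free_step l eta0.
  have [C2 C20 [K2 H2]] := IH _ eta20.
  exists (C2 * (C1 + 2)); first by rewrite mulr_gt0 // addr_gt0.
  exists (maxn K1 K2) => P H om M J A E P0 hH osc M0.
  rewrite geq_max => /andP[KM1 KM2] hA AE E0 om0.
  have [A' [hA' A'E]] := H1 P H om M J i A E P0 hH osc M0 KM1 hA AE.
  have r0 : 0 <= P.2 ^+ l * om by rewrite mulr_ge0 // exprn_ge0 // ltW.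
  have E'0 : 0 <= C1 * E + P.2 ^+ l * om by rewrite addr_ge0 // mulr_ge0 // ltW.
  have [v hv] := H2 P H om M (i :: J) A' _ P0 hH osc M0 KM2 hA' A'E E'0 om0.
  exists v => x [Px fx]; apply: le_trans (hv x _) _.
    split=> // j; rewrite mem_cat inE !negb_or => /and3P[js ji jJ]; apply: fx.
    by rewrite mem_cat inE !negb_or ji js jJ.
  rewrite -mulrA ler_pM2l //.
  have : 0 <= C1 * (P.2 ^+ l * om) by rewrite mulr_ge0 // ltW.
  lra.
have [C C0 [K HC]] := it (enum 'I_d) eta eta0.
exists C => //; exists K => P H om M A E P0 hH osc M0 KM hA AE E0 om0 x Px.
have [|v hv] := HC P H om M [::] A E P0 hH osc M0 KM hA _ E0 om0.
  move=> v vA y [Py fy]; suff -> : y = corner P v by exact: AE.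
  by apply/rowP => j; apply: fy.
by apply: hv; split => // i; rewrite mem_cat mem_enum inE.
Qed.

(* Iterated differences with steps [P.2 / 2 ^ k] bound some value of every
   derivative on a cube by the supremum of the function. *)
Lemma some_derivative_le k :
  exists2 C, 0 < C & forall (s : seq 'I_d) P H S, size s = k -> 0 < P.2 -> jet_on (size s) (in_cube P) H ->
  (forall x, in_cube P x -> `|H [::] x| <= S) ->
  exists2 x, in_cube P x & `|H s x| * P.2 ^+ size s <= C * S.
Proof.
elim: k => [|k [C C0 IH]].
  exists 1 => // -[] // P H S _ P0 _ hS; exists P.1; last first.
    rewrite expr0 mulr1 mul1r; apply: hS => j.
    by rewrite lexx lerDl ltW.
  by move=> j; rewrite lexx lerDl ltW.
exists (4 * 2 ^+ k * C); first by rewrite !mulr_gt0 // exprn_gt0.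
move=> [//|i s] P H S [sk] P0 hH hS; rewrite -sk.
pose h := P.2 / 2; have h0 : 0 < h by rewrite divr_gt0.
have h2 : P.2 = h + h by rewrite /h; field.
pose Q : 'rV[R]_d * R := (P.1, h).
pose sh x := upd x i (x 0 i + h).
have QP x : in_cube Q x -> in_cube P x.
  move=> Qx j; have /andP[a b] := Qx j; move: a b; rewrite /Q /= => a b.
  by apply/andP; split => //; lra.
have shP x : in_cube Q x -> in_cube P (sh x).
  move=> Qx; apply: in_cube_upd; first exact: QP.
  have := Qx i; rewrite /Q /= => /andP[a b]; apply/andP; split; lra.
(* Differences in direction [i] commute with differentiation, so [G] is a jet on the half cube [Q].
   The mean value theorem later turns [G s] into [h] times a value of [H (i :: s)]. *)
pose G (s : seq 'I_d) x := H s (sh x) - H s x.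
have sh_upd x j t : sh (upd x j t) = upd (sh x) j (if j == i then t + h else t).
  apply/rowP => q; rewrite !mxE.
  by case: (eqVneq q i) => [->|ki]; case: (eqVneq j i) => [ji|ji];
    rewrite ?ji ?eqxx ?(negbTE ki) // ?mxE ?[i == j]eq_sym ?(negbTE ji).
have hG : jet_on (size s) (in_cube Q) G.
  move=> s' j x sl Qx; rewrite /G; apply: is_deriveB; last first.
    by apply: hH; [exact: ltnW | exact: QP].
  under eq_fun do rewrite sh_upd.
  have := hH s' j (sh x) (ltnW sl) (shP x Qx).
  rewrite (_ : sh x 0 j = if j == i then x 0 j + h else x 0 j); last first.
    by rewrite mxE; case: eqP => [->|].
  case: eqP => // _ hd.
  have -> : (fun t => H s' (upd (sh x) j (t + h))) =
     (fun t => H s' (upd (sh x) j t)) \o (fun t => t + h) by [].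
  have <- : H (j :: s') (sh x) * 1 = H (j :: s') (sh x) by rewrite mulr1.
  apply: is_derive1_comp.
  have := is_deriveD (is_derive_id (x 0 j) (1 : R)) (is_derive_cst h (x 0 j) (1 : R)).
  by rewrite addr0.
have GS x : in_cube Q x -> `|G [::] x| <= S + S.
  move=> Qx; apply: le_trans (ler_normB _ _) _; apply: lerD; apply: hS.
    exact: shP.
  exact: QP.
have [x Qx] := IH s Q G _ sk h0 hG GS; rewrite {1}/Q /= => Gx.
have ab : x 0 i < x 0 i + h by rewrite ltrDl.
have Px t : x 0 i <= t <= x 0 i + h -> in_cube P (upd x i t).
  move=> /andP[t1 t2]; apply: in_cube_upd; first exact: QP.
  by have := Qx i; rewrite /Q /= => /andP[? ?]; apply/andP; split; lra.
have [|c [c1 c2]] := @mvt _ (fun t => H s (upd x i t))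
   (fun t => H (i :: s) (upd x i t)) _ _ ab.
  by move=> t /Px ht; apply: (@jet_upd (size s).+1 (in_cube P)).
rewrite upd_id -/(sh x) addrAC subrr add0r -/(G s x) => Ge.
exists (upd x i c); first by apply: Px; rewrite !ltW.
move: Gx; rewrite Ge normrM (ger0_norm (ltW h0)) /=.
have -> : P.2 ^+ (size s).+1 = 2 * 2 ^+ size s * (h * h ^+ size s).
  have -> : P.2 = 2 * h by rewrite h2; ring.
  by rewrite exprMn !exprS; ring.
move=> Gx.
have -> : `|H (i :: s) (upd x i c)| * (2 * 2 ^+ size s * (h * h ^+ size s)) =
  2 * 2 ^+ size s * (`|H (i :: s) (upd x i c)| * h * h ^+ size s) by ring.
have -> : 4 * 2 ^+ size s * C * S = 2 * 2 ^+ size s * (C * (S + S)) by ring.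
by rewrite ler_pM2l // mulr_gt0 // exprn_gt0.
Qed.

End jets.

Section linear_forms.
Context {R : realType} {d n : nat}.
Implicit Types (P Q : 'rV[R]_d * R) (x : 'rV[R]_d) (b : 'rV[R]_n.+1)
  (phi : 'I_n -> seq 'I_d -> 'rV[R]_d -> R).

(** The constant term occurs only for the empty list of directions, which makes [form phi b] a jet
    again. *)
Definition form phi b (s : seq 'I_d) x : R :=
  (if s is [::] then b 0 0 else 0) + \sum_j b 0 (lift 0 j) * phi j s x.

Definition form_norm b : R := \sum_j `|b 0 (lift 0 j)|.

(* The dual form of nondegeneracy, which is inherited by subfamilies of the
   coordinates: this allows to discard the coordinates of weight 0. *)
Definition nondegenerate_jet phi l (c : R) x0 := forall b, exists s : seq 'I_d,
  (1 <= size s <= l)%N /\ c * form_norm b <= `|form phi b s x0|.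

Definition jets_near phi l (tau : R) x0 (V : set 'rV[R]_d) :=
  forall x j s, V x -> (size s <= l)%N -> `|phi j s x - phi j s x0| <= tau.

Lemma form_norm_ge0 b : 0 <= form_norm b.
Proof. by apply: sumr_ge0 => j _. Qed.

Lemma form_jet phi l V b : (forall j, jet_on l V (phi j)) ->
  jet_on l V (form phi b).
Proof.
move=> hphi s i x sl Vx.
have -> : (fun t => form phi b s (upd x i t)) =
  cst (if s is [::] then b 0 0 else 0) +
  \sum_j (b 0 (lift 0 j) \*: (fun t => phi j s (upd x i t))).
  by apply/funext => t; rewrite /form /= fctE /= fct_sumE.
apply: is_deriveD.
apply: is_derive_sum => j; apply: is_deriveZ; exact: hphi.
Qed.

Lemma form_near phi l tau x0 V b s x : jets_near phi l tau x0 V -> V x ->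
  (size s <= l)%N -> `|form phi b s x - form phi b s x0| <= tau * form_norm b.
Proof.
move=> near Vx sl; rewrite /form opprD addrACA subrr add0r -sumrB.
apply: le_trans (ler_norm_sum _ _ _) _; rewrite /form_norm mulr_sumr.
apply: ler_sum => j _; rewrite -mulrBr normrM mulrC.
by apply: ler_wpM2r => //; exact: near.
Qed.

(** Nondegeneracy provides a derivative of the form that stays above c / 2 times [form_norm b] on
    the whole cube, while [some_derivative_le] bounds this derivative at some point by the supremum
    of the form. *)
Lemma form_lower l (c : R) : 0 < c ->
  exists2 C, 0 < C & forall phi x0 P b S tau,
  nondegenerate_jet phi l c x0 -> (forall j, jet_on l (in_cube P) (phi j)) ->
  jets_near phi l tau x0 (in_cube P) -> tau <= c / 2 -> 0 < P.2 -> P.2 <= 1 ->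
  (forall x, in_cube P x -> `|form phi b [::] x| <= S) ->
  form_norm b * P.2 ^+ l <= C * S.
Proof.
move=> c0.
have hk k : exists C, 0 < C /\ forall (s : seq 'I_d) P H S, size s = k ->
  0 < P.2 -> jet_on (size s) (in_cube P) H ->
  (forall x, in_cube P x -> `|H [::] x| <= S) ->
  exists2 x : 'rV[R]_d, in_cube P x & `|H s x| * P.2 ^+ size s <= C * S.
  by have [C C0 HC] := some_derivative_le (R := R) (d := d) k; exists C.
have [C HC] := choice hk.
pose C' := \sum_(k < l.+1) C k.
have C'0 : 0 < C'.
  rewrite /C' big_ord_recl; apply: ltr_pwDl; first by case: (HC 0%N).
  by apply: sumr_ge0 => k _; apply: ltW; case: (HC (bump 0 k)).
exists (2 / c * C'); first by rewrite mulr_gt0 // divr_gt0.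
move=> phi x0 P b S tau nd hphi near tauc P0 P1 hS.
have S0 : 0 <= S.
  apply: le_trans (normr_ge0 _) (hS P.1 _) => j.
  by rewrite lexx lerDl ltW.
have [s [/andP[s1 sl] hs]] := nd b.
have [_ HCs] := HC (size s).
have [|x Px hx] := HCs s P (form phi b) S erefl P0 _ hS.
  exact: (jet_onS sl (@subset_refl _ _) (form_jet b hphi)).
have := form_near b near Px sl => hn.
have fx : c / 2 * form_norm b <= `|form phi b s x|.
  have h1 := ler_normD (form phi b s x0 - form phi b s x) (form phi b s x).
  rewrite subrK distrC in h1.
  have : tau * form_norm b <= c / 2 * form_norm b.
    by apply: ler_wpM2r => //; exact: form_norm_ge0.
  lra.
have C'S : C (size s) * S <= C' * S.
  apply: ler_wpM2r => //; rewrite /C'.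
  have sl' : (size s < l.+1)%N by [].
  rewrite (bigD1 (Ordinal sl')) //= lerDl.
  by apply: sumr_ge0 => k _; apply: ltW; case: (HC k).
have rl : P.2 ^+ l <= P.2 ^+ size s by apply: ler_wiXn2l => //; exact: ltW.
have : c / 2 * form_norm b * P.2 ^+ l <= C' * S.
  apply: le_trans C'S; apply: le_trans hx.
  apply: ler_pM => //; last by rewrite exprn_ge0 // ltW.
  by rewrite mulr_ge0 ?form_norm_ge0 // divr_ge0 // ltW.
move=> h.
have -> : form_norm b * P.2 ^+ l = 2 / c * (c / 2 * form_norm b * P.2 ^+ l).
  by field; rewrite gt_eqF.
by rewrite -[leRHS]mulrA ler_pM2l // divr_gt0.
Qed.

(** The counterpart of the good functions of Kleinbock and Margulis. The remainder term of
    [grid_small] is at most a multiple of [tau] times [form_norm b * P.2 ^+ l], which [form_lower]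
    bounds by the supremum estimate itself; for small [tau] it is absorbed. *)
Lemma form_good l (c eta : R) : 0 < c -> 0 < eta ->
  exists2 tau, 0 < tau & exists2 C, 0 < C & exists K : nat,
  forall phi x0 P b M (A : {set {ffun 'I_d -> 'I_M}}) e tau',
  nondegenerate_jet phi l c x0 -> (forall j, jet_on l (in_cube P) (phi j)) ->
  0 <= tau' -> tau' <= tau ->
  jets_near phi l tau' x0 (in_cube P) -> 0 < P.2 -> P.2 <= 1 ->
  (0 < M)%N -> (K <= M)%N -> 0 <= e -> eta * (M ^ d)%:R <= #|A|%:R ->
  (forall v, v \in A -> `|form phi b [::] (corner P v)| <= e) ->
  forall x, in_cube P x -> `|form phi b [::] x| <= C * e.
Proof.
move=> c0 eta0.
have [C1 C10 H1] := form_lower l c0.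
have [C3 C30 [K H3]] := grid_small (R := R) (d := d) l eta0.
(* The two summands give [tau <= c / 2], for [form_lower], and a remainder of at most half of
   [S]. *)
pose tau := (2 / c + 4 * C3 * C1)^-1.
have C31 : 0 < C3 * C1 by exact: mulr_gt0.
have D0 : 0 < 2 / c + 4 * C3 * C1 by rewrite addr_gt0 ?divr_gt0 // -mulrA mulr_gt0.
have tau0 : 0 < tau by rewrite invr_gt0.
have tauc : tau <= c / 2.
  rewrite /tau -[leRHS]invf_div lef_pV2 ?posrE ?divr_gt0 //.
  by rewrite lerDl -mulrA mulr_ge0 // ltW.
have tauC : 4 * C3 * C1 * tau <= 1.
  rewrite /tau ler_pdivrMr // mul1r lerDr; by rewrite divr_ge0 // ltW.
exists tau => //; exists (2 * C3); first by rewrite mulr_gt0.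
exists K => phi x0 P b M A e tau' nd hphi tau'0 tau't near P0 P1 M0 KM e0 hA hv.
pose om := 2 * tau' * form_norm b.
have om0 : 0 <= om by rewrite !mulr_ge0 // form_norm_ge0.
pose S := C3 * (e + P.2 ^+ l * om).
have osc : osc_le l P (form phi b) om.
  move=> i x y Px Py.
  have sz : (size (nseq l i) <= l)%N by rewrite size_nseq.
  have := form_near b near Px sz; have := form_near b near Py sz.
  set u := form _ _ _ x; set v := form _ _ _ y; set w := form _ _ _ x0.
  move=> h1 h2; have := ler_normB (u - w) (v - w).
  by rewrite opprB addrA subrK /om; lra.
have hS := H3 P (form phi b) om M A e P0 (form_jet b hphi) osc M0 KM hA hv e0 om0.
have low := H1 phi x0 P b S tau' nd hphi near (le_trans tau't tauc) P0 P1 hS.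
have S0 : 0 <= S.
  apply: mulr_ge0; first exact: ltW.
  by rewrite addr_ge0 // mulr_ge0 // exprn_ge0 // ltW.
suff : S <= C3 * e + S / 2 by move=> hS2 x /hS; rewrite -/S; lra.
rewrite {1}/S mulrDr lerD2l.
have -> : C3 * (P.2 ^+ l * om) = 2 * C3 * tau' * (form_norm b * P.2 ^+ l).
  by rewrite /om; ring.
apply: (@le_trans _ _ (2 * C3 * tau * (C1 * S))).
  apply: ler_pM => //.
  - by rewrite mulr_ge0 // mulr_ge0 // ltW.
  - by rewrite mulr_ge0 ?form_norm_ge0 // exprn_ge0 // ltW.
  - by rewrite ler_wpM2l // mulr_ge0 // ltW.
have : (4 * C3 * C1 * tau) * S <= 1 * S by apply: ler_wpM2r.
lra.
Qed.

End linear_forms.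

(** * Quantitative nondivergence *)

(* A dyadic form of the Kleinbock-Margulis nondivergence argument, with
   [sm s Q], resp. [tiny s Q], standing for the bound of the size of [s] on [Q]
   by a fixed, resp. by a much smaller, constant. *)
Section dyadic_nondivergence.
Context {R : realType} {d : nat} {T : eqType}.
Implicit Types (P Q : 'rV[R]_d * R) (s : T) (S : seq T).
Variables (ok : T -> Prop) (comp : T -> T -> Prop) (sm tiny : T -> set ('rV[R]_d * R)).
Variables (n : nat) (eta : R) (P0 : 'rV[R]_d * R).

Definition compat s S := ok s /\ forall s', s' \in S -> comp s s'.

Fixpoint flag S : Prop := if S is s :: S' then compat s S' /\ flag S' else True.

(** The marked points of Kleinbock and Margulis: a flag extending [S0] by elements of moderate size,
    and maximal in that no element compatible with it is small on [Q]. *)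
Definition marked S0 Q := exists S, [/\ flag (S ++ S0),
  forall s, s \in S -> sm s Q /\ ~ tiny s Q &
  forall s, compat s (S ++ S0) -> ~ sm s Q].

(** One level loses [eta] to tiny elements, plus the fraction for the flags with one more element
    fixed. Both are proportions in the parent of a dyadic cube, whence the factor 2^d. *)
Fixpoint bad_fraction k : R :=
  if k is k'.+1 then 2 ^+ d * (eta + bad_fraction k') else 0.

Hypothesis eta_ge0 : 0 <= eta.
Hypothesis sm_le : forall s Q Q', cube_le Q' Q -> sm s Q -> sm s Q'.
Hypothesis sm_good : forall s Q, cube_le Q P0 -> ~ sm s Q ->
  forall D, (cnt (2 ^ D) Q (tiny s))%:R <= eta * ((2 ^ D) ^ d)%:R.
Hypothesis flag_size : forall S, flag S -> (size S <= n)%N.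

Lemma bad_fraction_ge0 k : 0 <= bad_fraction k.
Proof. by elim: k => //= k IH; rewrite mulr_ge0 ?exprn_ge0 ?addr_ge0. Qed.

Lemma marked0 S0 Q : flag S0 -> (forall s, compat s S0 -> ~ sm s Q) -> marked S0 Q.
Proof. by move=> fS h; exists [::]; split. Qed.

Lemma marked_cons s S0 Q : sm s Q -> ~ tiny s Q -> marked (s :: S0) Q -> marked S0 Q.
Proof.
move=> sQ tQ [S [fS hS cS]]; exists (rcons S s); rewrite cat_rcons; split => // s'.
by rewrite mem_rcons inE => /orP[/eqP ->|/hS].
Qed.

(** A stopping-time argument: no element compatible with [S0] is small on [P]. On a child where some
    [s] becomes small, [s] joins the flag; since it is not small on the parent, [sm_good] limits the
    leaves where it is tiny, and the induction on the room left in the flag handles the others. The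
    remaining children are treated by induction on the depth. *)
Lemma cnt_unmarked k : forall S0, flag S0 -> (n <= k + size S0)%N ->
  forall D P, cube_le P P0 -> (forall s, compat s S0 -> ~ sm s P) ->
  (cnt (2 ^ D) P [set Q | ~ marked S0 Q])%:R <= bad_fraction k * ((2 ^ D) ^ d)%:R.
Proof.
elim: k => [|k IH] S0 fS0 nk D P PP0 hP.
  rewrite mul0r lern0 -leqn0; apply: leq_trans (_ : _ <= cnt (2 ^ D) P set0)%N _.
    apply: cntS => v /= h; apply: h; apply: marked0 => // s cs.
    by have /= := @flag_size (s :: S0) (conj cs fS0); rewrite ltnNge nk.
  by rewrite cnt_set0.
elim: D P PP0 hP => [|D IHD] P PP0 hP; have Ppos : 0 < P.2 by case: PP0.
  rewrite expn0 cnt1 //; last by move=> h; apply: h; exact: marked0.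
  by rewrite mulr_ge0 // bad_fraction_ge0.
have e0 : (0 < 2 ^ D)%N by rewrite expn_gt0.
have eD : ((2 ^ D.+1) ^ d)%:R = 2 ^+ d * ((2 ^ D) ^ d)%:R :> R.
  by rewrite expnS expnMn natrM natrX.
have child (v : {ffun 'I_d -> 'I_2}) :
  (cnt (2 ^ D) (subcube P v) [set Q | ~ marked S0 Q])%:R <=
   bad_fraction k.+1 * ((2 ^ D) ^ d)%:R.
  have vP : cube_le (subcube P v) P by exact: subcube_le.
  have [[s [cs sv]]|none] := pselect (exists s, compat s S0 /\ sm s (subcube P v)).
    pose B := tiny s `|` [set Q | ~ marked (s :: S0) Q].
    apply: (@le_trans _ _ (cnt (2 ^ D) (subcube P v) B)%:R).
      rewrite ler_nat; apply: cntS => u /= hu.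
      have su : sm s (subcube (subcube P v) u).
        by apply: sm_le sv; apply: subcube_le => //; case: vP.
      have [tu|tu] := pselect (tiny s (subcube (subcube P v) u)); first by left.
      by right => h; apply: hu; exact: marked_cons h.
    (* The leaves of the child are counted among those of the parent, the cube on which the
       hypotheses about [s] and [s :: S0] hold. *)
    apply: (@le_trans _ _ (cnt (2 ^ D.+1) P B)%:R).
      by rewrite ler_nat expnS cnt_mul // (bigD1 v) //= leq_addr.
    apply: (@le_trans _ _ ((cnt (2 ^ D.+1) P (tiny s)) +
        (cnt (2 ^ D.+1) P [set Q | ~ marked (s :: S0) Q]))%:R).
      by rewrite ler_nat cntU.
    rewrite natrD /= [2 ^+ d * _]mulrC -mulrA -eD mulrDl; apply: lerD.
      by apply: sm_good => //; exact: hP.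
    apply: IH => //; first by rewrite /= addnS -addSn.
    move=> s' [oks' cs']; apply: hP; split=> // s'' h; apply: cs'.
    by rewrite inE h orbT.
  apply: IHD; first exact: cube_le_trans vP PP0.
  by move=> s cs ss; apply: none; exists s.
rewrite expnS cnt_mul // natr_sum.
apply: le_trans (ler_sum _ (fun v _ => child v)) _.
rewrite sumr_const card_ffun !card_ord -[leLHS]mulr_natr -expnS eD natrX natrX [(2 ^ d)%:R]natrX.
by rewrite le_eqVlt; apply/orP; left; apply/eqP; ring.
Qed.

End dyadic_nondivergence.

(** * Minors of sublattices under the diagonal flow *)

Section unipotent_matrix.
Context {R : realType} {n : nat}.
Implicit Types (y : 'I_n -> R).

(* [a *m umx y] lists the value [a_0 + a_1 y_1 + ... + a_n y_n] of the linear form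
   [a], followed by its coefficients [a_1, ..., a_n]. *)
Definition umx y : 'M[R]_n.+1 := \matrix_(i, j)
  if unlift 0 j is Some _ then (i == j)%:R else
  if unlift 0 i is Some i' then y i' else 1.

Definition aform (b : 'rV[R]_n.+1) y : R := b 0 0 + \sum_j b 0 (lift 0 j) * y j.

Lemma mul_umx0 k (A : 'M[R]_(k, n.+1)) y i :
  (A *m umx y) i 0 = aform (row i A) y.
Proof.
rewrite !mxE big_ord_recl !mxE !unlift_none mulr1 /aform !mxE; congr (_ + _).
by apply: eq_bigr => j _; rewrite !mxE unlift_none liftK.
Qed.

Lemma mul_umxS k (A : 'M[R]_(k, n.+1)) y i j :
  (A *m umx y) i (lift 0 j) = A i (lift 0 j).
Proof.
rewrite !mxE (bigD1 (lift 0 j)) //= mxE liftK eqxx mulr1 big1 ?addr0 // => l lj.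
by rewrite mxE liftK (negbTE lj) mulr0.
Qed.

Lemma det_umx y : \det (umx y) = 1.
Proof.
rewrite det_trig; last first.
  apply/is_trig_mxP => i j ij; rewrite mxE.
  case: (unliftP 0 j) => [j' _|j0]; last by move: ij; rewrite j0.
  by rewrite -val_eqE /= ltn_eqF.
by apply: big1 => i _; rewrite mxE; case: (unliftP 0 i) => // i' _; rewrite eqxx.
Qed.

Definition flow_diag (w : 'I_n -> R) (t : R) : 'rV[R]_n.+1 :=
  \row_j if unlift 0 j is Some j' then expR (- (w j' * t)) else expR t.

Definition flow w t y : 'M[R]_n.+1 := umx y *m diag_mx (flow_diag w t).

Lemma mul_flow0 k (A : 'M[R]_(k, n.+1)) w t y i :
  (A *m flow w t y) i 0 = aform (row i A) y * expR t.
Proof.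
by rewrite mulmxA mul_mx_diag mxE mul_umx0 [flow_diag _ _ _ _]mxE unlift_none.
Qed.

Lemma mul_flowS k (A : 'M[R]_(k, n.+1)) w t y i j :
  (A *m flow w t y) i (lift 0 j) = A i (lift 0 j) * expR (- (w j * t)).
Proof.
by rewrite mulmxA mul_mx_diag mxE mul_umxS [flow_diag _ _ _ _]mxE liftK.
Qed.

Lemma det_flow w t y : \sum_j w j = 1 -> \det (flow w t y) = 1.
Proof.
move=> w1; rewrite det_mulmx det_umx mul1r det_diag big_ord_recl mxE unlift_none.
under eq_bigr do rewrite mxE liftK.
by rewrite -expR_sum -expRD sumrN -mulr_suml w1 mul1r subrr expR0.
Qed.

Definition minor k (A : 'M[R]_(k, n.+1)) (f : 'I_k -> 'I_n.+1) : R :=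
  \det (colsub f A).

Lemma minor_mul k (C : 'M[R]_k) (A : 'M[R]_(k, n.+1)) f :
  minor (C *m A) f = \det C * minor A f.
Proof. by rewrite /minor -mulmx_colsub det_mulmx. Qed.

Lemma minor_flow k (A : 'M[R]_(k, n.+1)) w t y f :
  minor (A *m flow w t y) f =
  (\prod_j flow_diag w t 0 (f j)) * minor (A *m umx y) f.
Proof.
rewrite /minor mulmxA mul_mx_diag.
have -> : colsub f (\matrix_(i, j) ((A *m umx y) i j * flow_diag w t 0 j)) =
  colsub f (A *m umx y) *m diag_mx (\row_j flow_diag w t 0 (f j)).
  by apply/matrixP => i j; rewrite mul_mx_diag !mxE.
rewrite det_mulmx det_diag mulrC; congr (_ * _).
by apply: eq_bigr => j _; rewrite mxE.
Qed.

Lemma cofactor_eq k (A B : 'M[R]_k) i j :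
  (forall i' j', j' != j -> A i' j' = B i' j') -> cofactor A i j = cofactor B i j.
Proof.
move=> AB; rewrite /cofactor; congr (_ * \det _).
by apply/matrixP => i' j'; rewrite !mxE; apply: AB; rewrite eq_sym neq_lift.
Qed.

(** Only column 0 of [A *m umx y] depends on [y]; in the expansion along it the cofactors are
    constants, which combine the rows of [A] into a single form. *)
Lemma minor_umx_form k (A : 'M[R]_(k, n.+1)) (f : 'I_k -> 'I_n.+1) j0 y :
  f j0 = 0 -> (forall j, j != j0 -> f j != 0) ->
  minor (A *m umx y) f =
  aform ((\row_i cofactor (colsub f A) i j0) *m A) y.
Proof.
move=> f0 fn; rewrite /minor (expand_det_col _ j0).
transitivity (((\row_i cofactor (colsub f A) i j0) *m (A *m umx y)) 0 0); last first.
  rewrite mulmxA mul_umx0; congr (aform _ y).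
  by apply/rowP => j; rewrite mxE.
rewrite mxE; apply: eq_bigr => i _; rewrite mulrC; congr (_ * _); last first.
  by rewrite mxE f0.
rewrite [RHS]mxE; apply: cofactor_eq => i' j' /fn; rewrite [LHS]mxE [RHS]mxE.
by case: (unliftP 0 (f j')) => [j'' -> _|->]; rewrite ?mul_umxS // eqxx.
Qed.

Lemma minor_alternate k (A : 'M[R]_(k, n.+1)) f j1 j2 :
  j1 != j2 -> f j1 = f j2 -> minor A f = 0.
Proof.
move=> j12 f12; rewrite /minor -det_tr; apply: (determinant_alternate j12) => i.
by rewrite !mxE f12.
Qed.

(** Every maximal minor is a linear form in 1 and [y], which is what brings [form_good] to bear on
    sublattices of any rank: column 0 is selected once, repeatedly (the minor vanishes) or not at
    all (it is constant). *)
Lemma minor_umx_aform k (A : 'M[R]_(k, n.+1)) (f : 'I_k -> 'I_n.+1) :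
  exists b : 'rV[R]_n.+1, forall y, minor (A *m umx y) f = aform b y.
Proof.
have [[j0 f0]|nf] := pselect (exists j, f j = 0).
  have [[j1 [j10 f1]]|nf1] := pselect (exists j, j != j0 /\ f j = 0).
    exists 0 => y; rewrite (minor_alternate _ j10) ?f0 //.
    by rewrite /aform mxE add0r big1 // => j _; rewrite mxE mul0r.
  eexists => y; apply: (minor_umx_form _ y f0) => j jj0.
  by apply/eqP => fj; apply: nf1; exists j.
exists (minor A f *: delta_mx 0 0) => y; rewrite /aform big1 ?addr0; last first.
  by move=> j _; rewrite !mxE eqxx eq_sym (negbTE (neq_lift _ _)) mulr0 mul0r.
rewrite !mxE !eqxx mulr1; congr (\det _); apply/matrixP => i j.
rewrite [LHS]mxE [RHS]mxE.
case: (unliftP 0 (f j)) => [j'' ->|fj]; first by rewrite mul_umxS.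
by case: nf; exists j.
Qed.

Lemma minor_col_mx k (a : 'rV[R]_n.+1) (A : 'M[R]_(k, n.+1)) (dl B : R) f :
  (forall j, `|a 0 j| <= dl) -> (forall f, `|minor A f| <= B) ->
  `|minor (col_mx a A : 'M[R]_(k.+1, n.+1)) f| <= k.+1%:R * (dl * B).
Proof.
move=> adl AB; rewrite /minor (expand_det_row _ 0).
apply: le_trans (ler_norm_sum _ _ _) _.
rewrite mulr_natl -[X in _ *+ X](card_ord k.+1) -sumr_const.
apply: ler_sum => j _; rewrite normrM; apply: ler_pM => //.
  have -> : colsub f (col_mx a A : 'M[R]_(k.+1, n.+1)) 0 j = a 0 (f j).
    rewrite mxE; have := col_mxEu a A 0 (f j).
    by rewrite (_ : lshift k (0 : 'I_1) = 0 :> 'I_k.+1) //; exact/val_inj.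
  exact: adl.
rewrite /cofactor normrM normrX normrN1 expr1n mul1r.
apply: le_trans (AB (fun i => f (lift j i))); rewrite le_eqVlt; apply/orP; left.
apply/eqP; congr (`|\det _|); apply/matrixP => i i'; rewrite [LHS]mxE [LHS]mxE [LHS]mxE [RHS]mxE.
have := col_mxEd a A i (f (lift j i')).
by rewrite (_ : rshift 1 i = lift 0 i :> 'I_k.+1) //; exact/val_inj.
Qed.

Lemma row_free_minor k (A : 'M[R]_(k, n.+1)) :
  row_free A -> exists f, minor A f != 0.
Proof.
move=> fA.
have rA : row_full A^T by rewrite /row_full mxrank_tr.
exists (fullrankfun rA); rewrite /minor.
have := fullrowsub_unit rA; rewrite unitmxE unitfE -det_tr.
by congr (\det _ != 0); apply/matrixP => i j; rewrite !mxE.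
Qed.

(** In a nonvanishing minor, one selected column is replaced by column 0, unless 0 was already
    selected. The cofactors along it do not see this change, and they cannot all vanish. *)
Lemma row_free_cofactor k (A : 'M[R]_(k.+1, n.+1)) : row_free A ->
  exists (f : 'I_k.+1 -> 'I_n.+1) j0, [/\ f j0 = 0,
    forall j, j != j0 -> f j != 0,
    forall i j, i != j0 -> j != j0 -> f i = f j -> i = j &
    \row_i cofactor (colsub f A) i j0 != 0].
Proof.
move=> /row_free_minor[g gA].
have ginj i j : g i = g j -> i = j.
  by move=> gij; apply: contraNeq gA => ij; apply/eqP/(minor_alternate _ ij).
have [j0 hj0] : exists j0, forall j, j != j0 -> g j != 0.
  have [[j0 g0]|ng] := pselect (exists j, g j = 0).
    by exists j0 => j; apply: contraNneq => gj; apply/eqP/ginj; rewrite gj g0.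
  by exists 0 => j _; apply/eqP => gj; apply: ng; exists j.
pose f j := if j == j0 then 0 else g j.
have fE j : j != j0 -> f j = g j by rewrite /f => /negbTE ->.
exists f, j0; split.
- by rewrite /f eqxx.
- by move=> j jj0; rewrite fE // hj0.
- by move=> i j ij0 jj0; rewrite !fE //; exact: ginj.
- apply: contraNneq gA => c0; rewrite /minor (expand_det_col _ j0) big1 // => i _.
  have -> : cofactor (colsub g A) i j0 = cofactor (colsub f A) i j0.
    by apply: cofactor_eq => i' j' /fE jj; rewrite !mxE jj.
  by move/rowP/(_ i): c0; rewrite !mxE => ->; rewrite mulr0.
Qed.

End unipotent_matrix.

Section nondivergence.
Context {R : realType} {d n : nat}.
Variables (w : 'I_n -> R) (phi : 'I_n -> seq 'I_d -> 'rV[R]_d -> R).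
Hypothesis w1 : \sum_j w j = 1.
Hypothesis w_gt0 : forall j, 0 < w j.
Implicit Types (P Q : 'rV[R]_d * R) (x : 'rV[R]_d).

Local Notation sublattice := {k : nat & 'M[int]_(k, n.+1)}.
Implicit Types (s : sublattice).

Definition value x : 'I_n -> R := fun j => phi j [::] x.

Definition lmx s : 'M[R]_(tag s, n.+1) := int_mx (tagged s).

(** Stands for primitivity of the sublattice: its covolume is least among the integer bases of its
    span. *)
Definition minimal_basis k (S : 'M[int]_(k, n.+1)) :=
  forall (X : 'M[int]_(k, n.+1)) (C : 'M[R]_k),
  int_mx X = C *m int_mx S -> \det C != 0 -> 1 <= `|\det C|.

Definition proper_sublattice s :=
  [/\ (0 < tag s <= n)%N, row_free (lmx s) & minimal_basis (tagged s)].

Definition comparable_lattice s s' := (lmx s < lmx s')%MS \/ (lmx s' < lmx s)%MS.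

Definition small_on t B s Q := forall x, in_cube Q x ->
  forall f, `|minor (lmx s *m flow w t (value x)) f| < B.

Lemma rank_lmx s : row_free (lmx s) -> \rank (lmx s) = tag s.
Proof. by move=> /eqP. Qed.

Lemma comparable_lattice_sym s s' :
  comparable_lattice s s' -> comparable_lattice s' s.
Proof. by case; [right | left]. Qed.

Lemma flag_ok S s : flag proper_sublattice comparable_lattice S -> s \in S ->
  proper_sublattice s.
Proof. by elim: S => //= s' S IH [[ok _] /IH{}IH]; rewrite inE => /orP[/eqP ->|/IH]. Qed.

Lemma flag_comp S s s' : flag proper_sublattice comparable_lattice S ->
  s \in S -> s' \in S -> s != s' -> comparable_lattice s s'.
Proof.
elim: S => //= s0 S IH [[_ c0] /IH{}IH]; rewrite !inE.
move=> /orP[/eqP ->|sS] /orP[/eqP ->|s'S]; first by rewrite eqxx.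
- by move=> _; exact: c0.
- by move=> _; apply: comparable_lattice_sym; exact: c0.
- exact: IH.
Qed.

(** Comparability is strict, so the ranks in a flag are distinct elements of 1, ..., n. *)
Lemma lattice_flag_size S : flag proper_sublattice comparable_lattice S ->
  (size S <= n)%N.
Proof.
move=> fS.
have rS : {subset [seq tag s | s <- S] <= iota 1 n}.
  move=> k /mapP[s /(flag_ok fS)[/andP[k0 kn] _ _] ->].
  by rewrite mem_iota k0 add1n ltnS.
have uS : uniq [seq tag s | s <- S].
  elim: S fS {rS} => //= s S IH fsS; have [[oks cs] fS] := fsS.
  rewrite IH // andbT; apply/mapP => -[s' s'S ts].
  have [_ /rank_lmx fs _] := oks.
  have [_ /rank_lmx fs' _] := flag_ok fS s'S.
  by case: (cs _ s'S) => /rank_ltmx; rewrite fs fs' ts ltnn.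
by have := uniq_leq_size uS rS; rewrite size_map size_iota.
Qed.

Lemma small_on_le t B s Q Q' : cube_le Q' Q -> small_on t B s Q -> small_on t B s Q'.
Proof. by move=> QQ h x /(in_cube_le QQ); exact: h. Qed.

Lemma cnt_refine P M1 M2 (B : set ('rV[R]_d * R)) : 0 < P.2 ->
  (0 < M1)%N -> (0 < M2)%N ->
  (forall Q Q', cube_le Q' Q -> B Q -> B Q') ->
  (cnt M1 P B * M2 ^ d <= cnt (M1 * M2) P B)%N.
Proof.
move=> P0 M10 M20 hB; rewrite cnt_mul // /cnt -sum1_card big_distrl /=.
rewrite big_mkcond /=; apply: leq_sum => v _; case: ifP => // /asboolP Bv.
rewrite mul1n -{1}[M2]card_ord -[d in (_ ^ d)%N]card_ord -card_ffun.
apply: subset_leq_card; apply/fintype.subsetP => u _; apply/asboolP.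
apply: hB Bv; apply: subcube_le => //=; by rewrite divr_gt0 // ltr0n.
Qed.

Lemma corner_subcube P M (v : {ffun 'I_d -> 'I_M}) : 0 < P.2 ->
  in_cube (subcube P v) (corner P v).
Proof. by move=> P0 i; rewrite lexx lerDl divr_ge0 // ltW. Qed.

Lemma aform_scale (c : R) (b : 'rV[R]_n.+1) y : aform (c *: b) y = c * aform b y.
Proof.
rewrite /aform mxE mulrDr mulr_sumr; congr (_ + _).
by apply: eq_bigr => j _; rewrite mxE mulrA.
Qed.

(** This is the hypothesis [sm_good] of the dyadic argument: if all minors were below [eps] on more
    than a proportion [eta] of the leaves, each of them, being a form, would be at most C * eps < 1
    on all of [Q]. *)
Lemma small_on_good l (c eta tau C eps : R) K x0 P0 t : 0 < eta -> 0 <= eps ->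
  (forall P b M (A : {set {ffun 'I_d -> 'I_M}}) e,
    cube_le P P0 -> (0 < M)%N -> (K <= M)%N -> 0 <= e ->
    eta * (M ^ d)%:R <= #|A|%:R ->
    (forall v, v \in A -> `|form phi b [::] (corner P v)| <= e) ->
    forall x, in_cube P x -> `|form phi b [::] x| <= C * e) ->
  C * eps < 1 ->
  nondegenerate_jet phi l c x0 -> jets_near phi l tau x0 (in_cube P0) ->
  forall s Q, cube_le Q P0 -> ~ small_on t 1 s Q ->
  forall D, (cnt (2 ^ D) Q (small_on t eps s))%:R <= eta * ((2 ^ D) ^ d)%:R.
Proof.
move=> eta0 eps0 good Ceps nd near s Q QP0 nsm D; rewrite leNgt; apply/negP => big.
have Q0 : 0 < Q.2 by case: QP0.
apply: nsm => x Qx f; apply: le_lt_trans Ceps.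
have [b hb] := minor_umx_aform (lmx s) f.
set cst := \prod_j flow_diag w t 0 (f j).
have fE x' : minor (lmx s *m flow w t (value x')) f = form phi (cst *: b) [::] x'.
  by rewrite minor_flow hb -aform_scale.
rewrite fE.
(* Refining by 2^K reaches the threshold [K <= M] even for small [D], and does not lower the
   proportion of tiny leaves. *)
pose M := (2 ^ D * 2 ^ K)%N.
have p0 m : (0 < 2 ^ m)%N by rewrite expn_gt0.
pose A := finset (fun v : {ffun 'I_d -> 'I_M} => `[< small_on t eps s (subcube Q v) >]).
have Acnt : #|A| = cnt M Q (small_on t eps s).
  by rewrite cardsE.
apply: (good Q _ M A) => //.
- by rewrite muln_gt0 !p0.
- by apply: leq_trans (ltnW (ltn_expl K (ltnSn 1))) _; rewrite leq_pmull.
- have := cnt_refine Q0 (p0 D) (p0 K) (@small_on_le t eps s).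
  rewrite Acnt -(ler_nat R); apply: le_trans.
  rewrite expnMn !natrM mulrA ler_wpM2r //; exact: ltW.
- move=> v; rewrite inE => /asboolP /(_ _ (corner_subcube v Q0) f).
  by rewrite fE => /ltW.
Qed.

Lemma int_norm_ge1 (z : int) : z != 0 -> 1 <= `|z%:~R : R|.
Proof. by move=> z0; rewrite -intr_norm ler1z -gtz0_ge1 normr_gt0. Qed.

(** Here [w0] is the smallest weight: fewer than [n] distinct indices omit one, hence at least [w0]
    of the total. For n = 0 both claims are vacuous and 1 serves. *)
Lemma weight_gap : exists2 w0, 0 < w0 & (forall j, w0 <= w j) /\
  forall k (f : 'I_k -> 'I_n),
  (k < n)%N -> injective f -> \sum_i w (f i) <= 1 - w0.
Proof.
have [j0|none] := pselect (exists j : 'I_n, True); last first.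
  exists 1 => //; split=> [j|k f kn]; case: none; first by exists j.
  by exists (Ordinal kn).
case: j0 => j0 _; exists (w [arg min_(j < j0) w j]%O); first exact: w_gt0.
case: arg_minP => // j1 _ hj1; split=> [j|k f kn finj]; first exact: hj1.
have [j hj] : exists j, j \notin codom f.
  apply/existsP; rewrite -negb_forall; apply/negP => /forallP h.
  have : (#|'I_n| <= #|codom f|)%N by apply: subset_leq_card; apply/fintype.subsetP.
  by rewrite card_codom // !card_ord leqNgt kn.
rewrite -w1 (bigD1 j) //=; rewrite lerBrDr [leLHS]addrC; apply: lerD; first exact: hj1.
rewrite [leRHS](bigID (mem (codom f))) /=.
apply: ler_wpDr; first by apply: sumr_ge0 => i _; exact/ltW/w_gt0.
rewrite (eq_bigl (mem (codom f))); last first.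
  by move=> i /=; rewrite andb_idl // => h; apply: contraNneq hj => <-.
rewrite -big_uniq /=; last by rewrite map_inj_uniq ?enum_uniq.
by rewrite codomE big_map big_enum.
Qed.

(** Starts the dyadic argument on the fixed cube [P]. A sublattice of rank at most [n] has a minor
    through column 0 that the flow stretches by at least e^(w0 t) and that is the value of a nonzero
    integer form. Such a form cannot be tiny on all of [P]: by [form_lower] if it is not constant,
    by integrality otherwise. *)
Lemma not_small_on_top l (C : R) P : 0 < C -> 0 < P.2 ->
  (forall b S, (forall x, in_cube P x -> `|form phi b [::] x| <= S) ->
     form_norm b * P.2 ^+ l <= C * S) ->
  exists t0, forall t, t0 <= t -> forall s, proper_sublattice s ->
    ~ small_on t 1 s P.
Proof.
move=> C0 P0 low; have [w0 w00 [_ gap]] := weight_gap.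
have r0 : 0 < P.2 ^+ l by rewrite exprn_gt0.
exists (1 / w0 + C / P.2 ^+ l / w0) => t tt0 [k S] [/andP[/= k0 kn] fS _] sm.
have t0 : 0 < t.
  by apply: lt_le_trans tt0; rewrite addr_gt0 // !divr_gt0.
case: k k0 kn S fS sm => // k _ kn S fS sm.
have [f [j0 [f0 fn finj c0]]] := row_free_cofactor fS.
set c := \row_i _ in c0.
(* The cofactors of an integer matrix are integers, so the form is an integer one; freeness of the
   rows makes it nonzero. *)
pose ci : 'rV[int]_k.+1 := \row_i cofactor (colsub f S) i j0.
have cE : c = int_mx ci.
  apply/rowP => i; rewrite !mxE /cofactor rmorphM rmorphXn rmorphN1.
  rewrite -det_map_mx; congr (_ * \det _).
  by apply/matrixP => i' j'; rewrite !mxE.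
pose bi := ci *m S.
have bE : c *m int_mx S = int_mx bi by rewrite int_mxM cE.
have bi0 : bi != 0.
  apply: contraNneq c0 => b0; apply/eqP/(row_free_inj fS).
  by rewrite mul0mx bE b0; apply/matrixP => i j; rewrite !mxE.
have cst_ge : expR (w0 * t) <= \prod_j flow_diag w t 0 (f j).
  pose g (i : 'I_k) : 'I_n := odflt (Ordinal (leq_trans (ltn0Sn k) kn))
    (unlift 0 (f (lift j0 i))).
  have gE i : f (lift j0 i) = lift 0 (g i).
    rewrite /g; case: (unliftP 0 (f (lift j0 i))) => [j ->//|fj].
    by have := fn (lift j0 i); rewrite eq_sym neq_lift fj eqxx => /(_ isT).
  have ginj : injective g.
    move=> i i' gii'; apply: (@lift_inj _ j0); apply: finj.
    - by rewrite eq_sym neq_lift.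
    - by rewrite eq_sym neq_lift.
    - by rewrite !gE gii'.
  rewrite (bigD1_ord j0) //= f0 mxE unlift_none.
  under eq_bigr do rewrite gE mxE liftK.
  rewrite -expR_sum -expRD ler_expR sumrN -mulr_suml.
  have : (\sum_i w (g i)) * t <= (1 - w0) * t.
    by apply: ler_wpM2r; [exact: ltW | exact: gap].
  lra.
have wt : 1 <= w0 * t /\ C / P.2 ^+ l < w0 * t.
  have : w0 * (1 / w0 + C / P.2 ^+ l / w0) <= w0 * t by rewrite ler_pM2l.
  have -> : w0 * (1 / w0 + C / P.2 ^+ l / w0) = 1 + C / P.2 ^+ l.
    by field; rewrite !gt_eqF.
  have : 0 < C / P.2 ^+ l by rewrite divr_gt0.
  by split; lra.
have E1 := expR_ge1Dx (w0 * t).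
have low' : forall x, in_cube P x ->
    `|form phi (int_mx bi) [::] x| <= (expR (w0 * t))^-1.
  move=> x Px; have := sm x Px f; rewrite /= minor_flow.
  rewrite (minor_umx_form _ _ f0 fn) -/c bE normrM => /ltW h.
  rewrite -[leRHS]mul1r ler_pdivlMr ?expR_gt0 // mulrC.
  apply: le_trans h; apply: ler_wpM2r => //.
  by apply: le_trans cst_ge (ler_norm _).
have inv1 : (expR (w0 * t))^-1 < 1.
  by rewrite invf_lt1 ?expR_gt0 //; case: wt; lra.
have [[j bj]|bz] := pselect (exists j, bi 0 (lift 0 j) != 0).
  have fn1 : 1 <= form_norm (int_mx bi : 'rV[R]_n.+1).
    rewrite /form_norm (bigD1 j) //= -[leLHS]addr0; apply: lerD.
      by rewrite int_mxE int_norm_ge1.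
    exact: sumr_ge0.
  have := low _ _ low'.
  apply/negP; rewrite -ltNge; apply: (@lt_le_trans _ _ (P.2 ^+ l)); last first.
    by rewrite ler_peMl // ltW.
  rewrite ltr_pdivrMr ?expR_gt0 // mulrC -ltr_pdivrMr //.
  by case: wt; lra.
have b00 : bi 0 0 != 0.
  apply: contraNneq bi0 => b00; apply/eqP/rowP => j; rewrite [RHS]mxE.
  case: (unliftP 0 j) => [j' ->|->] //.
  by apply/eqP; apply: contra_notT bz => h; exists j'.
have Pp : in_cube P P.1 by move=> i; rewrite lexx lerDl ltW.
have := low' _ Pp; rewrite /form big1 ?addr0; last first.
  move=> j _; rewrite int_mxE (_ : bi 0 (lift 0 j) = 0) ?mul0r //.
  by apply/eqP; apply: contra_notT bz => h; exists j.
rewrite int_mxE; apply/negP; rewrite -ltNge.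
exact: lt_le_trans inv1 (int_norm_ge1 b00).
Qed.

End nondivergence.

Section marked_leaf.
Context {R : realType} {d n : nat}.
Variables (w : 'I_n -> R) (phi : 'I_n -> seq 'I_d -> 'rV[R]_d -> R).
Hypothesis w1 : \sum_j w j = 1.
Implicit Types (P Q : 'rV[R]_d * R) (x : 'rV[R]_d).

Local Notation sublattice := {k : nat & 'M[int]_(k, n.+1)}.
Implicit Types (s : sublattice).
Local Notation small_on := (small_on w phi).
Local Notation lmx := (@lmx R n).
Local Notation proper_sublattice := (@proper_sublattice R n).
Local Notation comparable_lattice := (@comparable_lattice R n).

(* Among the integer bases of a rational subspace, one minimizes a fixed nonzero
   minor. *)
Lemma exists_minimal_basis k (W : 'M[int]_(k, n.+1)) :
  row_free (int_mx W : 'M[R]_(k, n.+1)) ->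
  exists (X : 'M[int]_(k, n.+1)) (C : 'M[R]_k),
    [/\ int_mx W = C *m int_mx X, 1 <= `|\det C| & minimal_basis (R := R) X].
Proof.
move=> fW; have [g gW] := row_free_minor fW.
have mi (X : 'M[int]_(k, n.+1)) :
    minor (int_mx X : 'M[R]__) g = (\det (colsub g X))%:~R.
  rewrite /minor -[RHS](det_map_mx (intr : int -> R)); congr (\det _).
  by apply/matrixP => i j; rewrite !mxE.
pose p m := `[< exists (X : 'M[int]_(k, n.+1)) (C : 'M[R]_k),
   [/\ int_mx X = C *m int_mx W, \det C != 0 & m = `|\det (colsub g X)|%N] >].
have ex : exists m, p m.
  exists `|\det (colsub g W)|%N; apply/asboolP; exists W, 1%:M.
  by rewrite mul1mx det1 oner_neq0.
case: (ex_minnP ex) => m /asboolP[X [C [XC C0 mE]]] mmin.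
have uC : C \in unitmx by rewrite unitmxE unitfE.
have WX : int_mx W = invmx C *m int_mx X by rewrite XC mulKmx.
have gX : \det (colsub g X) != 0.
  have := minor_mul C (int_mx W) g; rewrite -XC mi => e.
  by rewrite -(intr_eq0 R) e mulf_neq0.
have minX : minimal_basis (R := R) X.
  move=> Y D YD D0.
  have : p `|\det (colsub g Y)|%N.
    apply/asboolP; exists Y, (D *m C).
    by rewrite det_mulmx mulf_neq0 // -mulmxA -XC.
  move=> /mmin; rewrite mE => le.
  have := minor_mul D (int_mx X) g; rewrite -YD !mi => /(congr1 (fun x : R => `|x|)).
  rewrite normrM -!intr_norm => e.
  have X0 : 0 < (`|\det (colsub g X)|%:~R : R) by rewrite ltr0z normr_gt0.
  by rewrite -(ler_pM2r X0) mul1r -e ler_int -!abszE lez_nat.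
exists X, (invmx C); split => //.
have [|h] := leP 1 `|\det (invmx C)| => //.
have := mi W; rewrite WX minor_mul mi => /(congr1 (fun x : R => `|x|)).
rewrite normrM -!intr_norm => e.
have : p `|\det (colsub g W)|%N.
  by apply/asboolP; exists W, 1%:M; rewrite mul1mx det1 oner_neq0.
move=> /mmin; rewrite mE => le.
have X0 : 0 < (`|\det (colsub g X)|%:~R : R) by rewrite ltr0z normr_gt0.
have := h; rewrite -(ltr_pM2r X0) mul1r e ltr_int ltNge -!abszE lez_nat le.
by [].
Qed.

(** The vector [a] cuts the flag in two; [V] is the largest member whose span does not contain
    it. *)
Lemma flag_gap S (a : 'rV[R]_n.+1) t Q : a != 0 ->
  flag proper_sublattice comparable_lattice S ->
  (forall s, s \in S -> small_on t 1 s Q) ->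
  exists V : sublattice, [/\ row_free (lmx V), ~~ (a <= lmx V)%MS,
    (forall x, in_cube Q x ->
       forall f, `|minor (lmx V *m flow w t (value phi x)) f| <= 1),
    (forall s, s \in S -> ~~ (a <= lmx s)%MS -> (lmx s <= lmx V)%MS) &
    (forall s, s \in S -> (a <= lmx s)%MS -> (lmx V <= lmx s)%MS)].
Proof.
move=> a0' fS smS.
pose p m := has (fun s => ~~ (a <= lmx s)%MS && (tag s == m)) S.
have [[m0 pm0]|none] := pselect (exists m, p m); last first.
  have all_a s : s \in S -> (a <= lmx s)%MS.
    move=> sS; rewrite -[(_ <= _)%MS]negbK; apply/negP => h; apply: none.
    by exists (tag s); apply/hasP; exists s; rewrite ?h ?eqxx.
  (* If every member contains [a], the zero lattice fills the gap. Its only minor is the empty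
     determinant 1, whence the non-strict bound in the statement. *)
  pose V : sublattice := existT _ 0%N (0 : 'M[int]_(0, n.+1)).
  have V0 : lmx V = 0 by apply/matrixP => - [].
  exists V; split.
  - by rewrite V0 /row_free mxrank0.
  - by apply: contra a0'; rewrite V0 => /submx0null ->.
  - by move=> x _ f; rewrite /minor det_mx00 normr1.
  - by move=> s /all_a ->.
  - by move=> s _ _; rewrite V0 sub0mx.
have bound m : p m -> (m <= n)%N.
  move=> /hasP[s sS /andP[_ /eqP <-]].
  by have [/andP[]] := flag_ok fS sS.
case: (ex_maxnP (ex_intro _ m0 pm0) bound) => m /hasP[V VS /andP[aV /eqP Vm]] mmax.
have [_ fV _] := flag_ok fS VS.
exists V; split => //.
- by move=> x Qx f; apply/ltW; exact: smS.
- move=> s sS as_; have [<-//|/(flag_comp fS sS VS)[/ltmxW //|/rank_ltmx]] := eqVneq s V.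
  have [_ fs _] := flag_ok fS sS.
  rewrite !rank_lmx // => lt.
  have : (tag s <= m)%N by apply: mmax; apply/hasP; exists s; rewrite ?as_ ?eqxx.
  by rewrite -Vm leqNgt lt.
- move=> s sS as_; have [<-//|/(flag_comp fS sS VS)[/ltmxW sV|/ltmxW//]] := eqVneq s V.
  by rewrite (submx_trans as_ sV) in aV.
Qed.

(** Adding a short [a] to [V] gives [W] with all minors below [eps]. In rank n + 1 its determinant
    would be a nonzero integer of absolute value below 1. Otherwise a minimal basis of its span fits
    into the flag, against maximality, unless a member already has this span; that member would then
    be tiny. *)
Lemma marked_no_short t (eps dl : R) Q : 0 < Q.2 -> 0 < dl -> eps <= 1 ->
  n.+1%:R * dl < eps ->
  marked proper_sublattice comparable_lattice (small_on t 1) (small_on t eps)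
    [::] Q ->
  forall a : 'rV[int]_n.+1, a != 0 ->
  ~ (forall x, in_cube Q x -> forall j,
       `|(int_mx a *m flow w t (value phi x)) 0 j| < dl).
Proof.
move=> Q0 dl0 eps1 ndl [S]; rewrite cats0 => -[fS smS maxS] a a0 short.
have a0' : (int_mx a : 'rV[R]_n.+1) != 0.
  apply: contraNneq a0 => h; apply/eqP/rowP => j; rewrite mxE.
  by move/rowP/(_ j): h; rewrite !mxE => /eqP; rewrite intr_eq0 => /eqP.
have [V [fV aV Vle lV gV]] := flag_gap a0' fS (fun s sS => (smS s sS).1).
case: V fV aV Vle lV gV => k V fV aV Vle lV gV.
pose W : 'M[int]_(k.+1, n.+1) := col_mx a V : 'M[int]_(1 + k, n.+1).
have WE : int_mx W = (col_mx (int_mx a) (int_mx V : 'M[R]__) : 'M[R]_(1 + k, n.+1)).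
  exact: (map_col_mx (intr : int -> R) a V).
have eqW : (int_mx W :=: int_mx a + (int_mx V : 'M[R]__))%MS.
  by rewrite WE; apply: eqmx_sym; exact: addsmxE.
have VW : (lmx (existT _ k V) < int_mx W)%MS.
  rewrite ltmxE eqW addsmxSr /=; apply: contra aV => h.
  by apply: submx_trans h; rewrite eqW; exact: addsmxSl.
have fW : row_free (int_mx W : 'M[R]__).
  rewrite /row_free eqn_leq rank_leq_row /=.
  by have := rank_ltmx VW; rewrite rank_lmx.
have Wmin x : in_cube Q x ->
    forall f, `|minor (int_mx W *m flow w t (value phi x)) f| < eps.
  move=> Qx f; rewrite WE.
  have := mul_col_mx (int_mx a) (int_mx V) (flow w t (value phi x)) => ->.
  apply: le_lt_trans (minor_col_mx (dl := dl) (B := 1) f _ _) _.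
  - by move=> j; apply/ltW; exact: short.
  - by move=> g; exact: Vle.
  apply: le_lt_trans ndl; rewrite mulr1 ler_wpM2r //; first exact: ltW.
  rewrite ler_nat; have := rank_leq_col (int_mx W : 'M[R]__).
  by move: fW => /eqP ->.
have kn : (k.+1 <= n.+1)%N.
  by have := rank_leq_col (int_mx W : 'M[R]__); move: fW => /eqP ->.
have [kn' | kn'] := ltnP k n; last first.
  have kE : k = n by apply/eqP; rewrite eqn_leq -ltnS kn kn'.
  subst k.
  have Qq : in_cube Q Q.1 by move=> i; rewrite lexx lerDl ltW.
  have := Wmin _ Qq id; apply/negP; rewrite -leNgt; apply: le_trans eps1 _.
  have -> : minor (int_mx W *m flow w t (value phi Q.1)) id = \det (int_mx W : 'M[R]__).
    rewrite /minor -[RHS]mulr1 -(det_flow t (value phi Q.1) w1) -det_mulmx.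
    by congr (\det _); apply/matrixP => i j; rewrite mxE.
  rewrite /int_mx det_map_mx; apply: int_norm_ge1.
  move: fW; rewrite row_free_unit unitmxE unitfE /int_mx det_map_mx.
  by rewrite intr_eq0.
have [X [C [WX C1 minX]]] := exists_minimal_basis fW.
have uC : C \in unitmx.
  by rewrite unitmxE unitfE -normr_gt0 (lt_le_trans _ C1).
have eqX : ((int_mx X : 'M[R]__) :=: int_mx W)%MS.
  by rewrite WX; apply: eqmx_sym; apply: eqmxMfull; rewrite row_full_unit.
pose s0 : sublattice := existT _ k.+1 X.
have okX : proper_sublattice s0.
  by split; [rewrite /= kn' | rewrite /row_free eqX | ].
have smX : small_on t 1 s0 Q.
  move=> x Qx f; apply: lt_le_trans eps1; apply: le_lt_trans (Wmin x Qx f).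
  by rewrite WX -mulmxA minor_mul normrM ler_peMl.
apply: (maxS s0 _ smX); split => // s sS.
have [|as_] := boolP (int_mx a <= lmx s)%MS; last first.
  right; apply: sub_ltmx_trans (lV s sS as_) _.
  by rewrite /comparable_lattice ltmxE /lmx /= !eqX -ltmxE.
move=> as_; left.
have Ws : (int_mx W <= lmx s)%MS by rewrite eqW addsmx_sub as_ gV.
rewrite ltmxE /lmx /= !eqX Ws /=; apply/negP => sW.
have [_ nt] := smS s sS; apply: nt.
(* Since the basis of [s] is minimal, its minors are at most those of [W], hence below [eps]. *)
have [_ fs mins] := flag_ok fS sS.
have ts : k.+1 = tag s.
  apply/eqP; rewrite eqn_leq -(rank_lmx fs) -[k.+1](eqP fW).
  by rewrite (mxrankS Ws) (mxrankS sW).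
clear sS; case: s ts sW fs mins {as_} Ws => ks Vs /= ts; subst ks => sW fs mins Ws.
have /submxP[D WD] := Ws.
have fD : row_free D.
  rewrite /row_free eqn_leq rank_leq_row /= -{1}(eqP fW) WD.
  exact: mxrankM_maxl.
have D0 : \det D != 0 by move: fD; rewrite row_free_unit unitmxE unitfE.
have D1 := mins _ _ WD D0.
move=> x Qx f; apply: le_lt_trans (Wmin x Qx f).
by rewrite WD -mulmxA minor_mul normrM ler_peMl.
Qed.

Lemma bad_fraction_scale (eta : R) k :
  bad_fraction (d := d) eta k = eta * bad_fraction (d := d) 1 k.
Proof.
elim: k => [|k IH] /=; first by rewrite mulr0.
by rewrite IH -[X in X + _]mulr1 -mulrDr mulrCA.
Qed.

End marked_leaf.

Definition short_on {R : realType} d n (w : 'I_n -> R)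
    (phi : 'I_n -> seq 'I_d -> 'rV[R]_d -> R) t dl : set ('rV[R]_d * R) :=
  [set Q | exists2 a : 'rV[int]_n.+1, a != 0 &
     forall x, in_cube Q x -> forall j,
       `|(int_mx a *m flow w t (value phi x)) 0 j| < dl].

(** Both [tau] and [dl] are uniform in the map, the weights and the cube; only [t0] depends on them.
    This uniformity yields the fixed proportion in the density argument. *)
Lemma cnt_short_on (R : realType) d n l (c eta : R) : (0 < d)%N -> 0 < c -> 0 < eta ->
  exists2 tau, 0 < tau & exists2 dl, 0 < dl &
  forall (w : 'I_n -> R) (phi : 'I_n -> seq 'I_d -> 'rV[R]_d -> R) x0 P0,
  \sum_j w j = 1 -> (forall j, 0 < w j) ->
  nondegenerate_jet phi l c x0 -> (forall j, jet_on l (in_cube P0) (phi j)) ->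
  jets_near phi l tau x0 (in_cube P0) -> P0.2 <= 1 ->
  forall P, cube_le P P0 -> exists t0, forall t, t0 <= t -> forall D,
  (cnt (2 ^ D) P (short_on w phi t dl))%:R <= eta * ((2 ^ D) ^ d)%:R.
Proof.
move=> d0 c0 eta0.
(* The fraction [bad_fraction] is linear in its first parameter, so this choice brings the total
   below [eta]. *)
pose eta' := eta / (bad_fraction (d := d) 1 n + 1).
have b0 : 0 < bad_fraction (d := d) 1 n + 1 :> R.
  by rewrite ltr_pwDr // bad_fraction_ge0.
have eta'0 : 0 < eta' by rewrite divr_gt0.
have [tau tau0 [C C0 [K good]]] := form_good (d := d) (n := n) l c0 eta'0.
have [C1 C10 low] := form_lower (R := R) (d := d) (n := n) l c0.
pose eps := (C + 1)^-1.
have eps0 : 0 < eps by rewrite invr_gt0 addr_gt0.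
have eps1 : eps <= 1 by rewrite invf_le1 ?addr_gt0 // lerDr ltW.
have Ceps : C * eps < 1 by rewrite /eps ltr_pdivrMr ?addr_gt0 // mul1r ltrDl.
have n0 : 0 < n.+1%:R :> R by [].
pose dl := eps / 2 / n.+1%:R.
have dl0 : 0 < dl by rewrite !divr_gt0.
have ndl : n.+1%:R * dl < eps.
  by rewrite /dl mulrC divfK ?gt_eqF //; lra.
exists (Num.min tau (c / 2)); first by rewrite lt_min tau0 divr_gt0.
exists dl => // w phi x0 P0 w1 w0 nd jets near P01 P PP0.
have Pin := in_cube_le PP0.
have jetsQ Q (QP0 : cube_le Q P0) j : jet_on l (in_cube Q) (phi j).
  by apply: jet_onS (jets j) => //; exact: in_cube_le.
have side Q : cube_le Q P0 -> Q.2 <= 1.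
  move=> QP0; have [Q0 h] := QP0.
  by have [] := h (Ordinal d0); move: P01; lra.
have nearQ Q : cube_le Q P0 -> jets_near phi l (Num.min tau (c / 2)) x0 (in_cube Q).
  by move=> QP0 x j s Qx; apply: near; exact: in_cube_le QP0 _ Qx.
have [P0' _] := PP0.
have lowP b S : (forall x, in_cube P x -> `|form phi b [::] x| <= S) ->
    form_norm b * P.2 ^+ l <= C1 * S.
  apply: (low phi x0 P b S _ nd (jetsQ _ PP0) (nearQ _ PP0)) => //.
    by rewrite ge_min lexx orbT.
  exact: side.
have [t0 top] := not_small_on_top w1 w0 C10 P0' lowP.
exists t0 => t tt0 D.
apply: (@le_trans _ _ (cnt (2 ^ D) P [set Q | ~ marked (@proper_sublattice R n)
    (@comparable_lattice R n) (small_on w phi t 1) (small_on w phi t eps)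
    [::] Q])%:R).
  rewrite ler_nat; apply: cntS => v [a a0 ha] mk.
  have v0 : 0 < (subcube P v).2.
    by rewrite divr_gt0 // ltr0n expn_gt0.
  apply: (@marked_no_short R d n w phi w1 t eps dl _ v0 dl0 eps1 ndl mk a a0).
  exact: ha.
apply: (@le_trans _ _ (bad_fraction (d := d) eta' n * ((2 ^ D) ^ d)%:R)).
  apply: (@cnt_unmarked R d _ (@proper_sublattice R n) (@comparable_lattice R n)
    (fun s => small_on w phi t 1 s) (fun s => small_on w phi t eps s) n eta' P0).
  - exact: ltW.
  - by move=> s Q Q'; exact: small_on_le.
  - move=> s Q QP0 ns D'.
    apply: (@small_on_good R d n w phi l c eta' (Num.min tau (c / 2)) C eps K x0 P0 t) => //.
      exact: ltW.
    move=> Q' b M A e Q'P0 M0 KM e0 hA hv.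
    apply: (good phi x0 Q' b M A e (Num.min tau (c / 2))) => //.
    + exact: jetsQ.
    + by rewrite le_min !ltW // divr_gt0.
    + by rewrite ge_min lexx.
    + exact: nearQ.
    + by case: Q'P0.
    + exact: side.
  - exact: lattice_flag_size.
  - by [].
  - by rewrite addn0.
  - by [].
  - by move=> s [oks _]; exact: top.
apply: ler_wpM2r => //; rewrite bad_fraction_scale /eta' mulrAC.
rewrite ler_pdivrMr // ler_pM2l // lerDl.
by [].
Qed.

(** * Lattices at several times *)

Section window.
Context {R : realType} {n : nat}.
Variable w : 'I_n -> R.
Hypothesis w1 : \sum_j w j = 1.
Hypothesis w_gt0 : forall j, 0 < w j.
Implicit Types (y : 'I_n -> R) (t u : R).

Lemma weight_le1 j : w j <= 1.
Proof.
by rewrite -w1 (bigD1 j) //= lerDl; apply: sumr_ge0 => i _; exact/ltW/w_gt0.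
Qed.

Lemma det_le k (M : 'M[R]_k) (B : 'I_k -> R) :
  (forall i j, `|M i j| <= B j) -> `|\det M| <= (k`!)%:R * \prod_j B j.
Proof.
move=> MB; rewrite /determinant; apply: le_trans (ler_norm_sum _ _ _) _.
have -> : (k`!)%:R * \prod_j B j = \sum_(s : 'S_k) \prod_j B j.
  by rewrite sumr_const card_Sn mulr_natl.
apply: ler_sum => s _; rewrite normrM normr_sign mul1r normr_prod.
rewrite [leRHS](reindex_inj (@perm_inj _ s)) /=.
by apply: ler_prod => i _; rewrite normr_ge0 MB.
Qed.

Lemma flow_diagD t u j : flow_diag w (t + u) 0 j = flow_diag w u 0 j * flow_diag w t 0 j.
Proof.
rewrite !mxE; case: (unlift 0 j) => [j'|]; rewrite -expRD; congr expR; ring.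
Qed.

Lemma flow_diag_gt0 t j : 0 < flow_diag w t 0 j.
Proof. by rewrite mxE; case: (unlift 0 j) => [j'|]; exact: expR_gt0. Qed.

Lemma flow_diag_le t j : flow_diag w t 0 j <= expR `|t|.
Proof.
rewrite mxE; case: (unlift 0 j) => [j'|]; rewrite ler_expR; last exact: ler_norm.
rewrite -mulrN; apply: le_trans (ler_norm _) _; rewrite normrM normrN.
by rewrite ler_piMl // ger0_norm ?weight_le1 // ltW.
Qed.

Lemma mul_flowD k (A : 'M[R]_(k, n.+1)) t u y i j :
  (A *m flow w (t + u) y) i j = (A *m flow w t y) i j * flow_diag w u 0 j.
Proof.
by rewrite !mulmxA !mul_mx_diag mxE [in RHS]mxE flow_diagD mulrA mulrAC.
Qed.

Lemma minor_flowD k (A : 'M[R]_(k, n.+1)) t u y f :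
  minor (A *m flow w (t + u) y) f =
  (\prod_j flow_diag w u 0 (f j)) * minor (A *m flow w t y) f.
Proof.
rewrite !minor_flow mulrA -big_split /=; congr (_ * _).
by apply: eq_bigr => j _; rewrite flow_diagD.
Qed.

Lemma int_lattice_ge k (S : 'M[int]_(k, n.+1)) (B : 'M[R]_n.+1) dl :
  row_free (int_mx S : 'M[R]__) -> lattice_ge B dl -> lattice_ge (int_mx S *m B) dl.
Proof.
move=> fS hB z z0; have [|j hj] := hB (z *m S); last first.
  by exists j; rewrite mulmxA -int_mxM.
apply: contraNneq z0 => h; have : int_mx z = 0 :> 'M[R]__.
  apply: (row_free_inj fS); rewrite mul0mx -int_mxM h.
  by apply/matrixP => i j; rewrite !mxE.
move=> /rowP h0; apply/eqP/rowP => i; rewrite mxE.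
by have := h0 i; rewrite !mxE => /eqP; rewrite intr_eq0 => /eqP.
Qed.

(** Column 0 contributes e^s and the others e^(-s W), where W is at most 1 - w0; for negative [s]
    the product is at most e^(w0 s). *)
Lemma prod_flow_diag_le k (w0 u s : R) (f : 'I_k -> 'I_n.+1) j0 :
  (forall j, w0 <= w j) ->
  (forall k (f : 'I_k -> 'I_n), (k < n)%N -> injective f ->
     \sum_i w (f i) <= 1 - w0) ->
  0 < w0 -> 0 <= u -> s <= - u -> (k <= n)%N -> f j0 = 0 -> injective f ->
  \prod_j flow_diag w s 0 (f j) <= expR (- (w0 * u)).
Proof.
case: k f j0 => [f []//|k] f j0 w0j gap w00 u0 su kn f0 finj.
have hg i : exists j, f (lift j0 i) = lift 0 j.
  case: (unliftP 0 (f (lift j0 i))) => [j ->|fj]; first by exists j.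
  have := finj _ _ (etrans fj (esym f0)) => /eqP.
  by rewrite eq_sym (negbTE (neq_lift _ _)).
have [g gE] := choice hg.
have ginj : injective g.
  by move=> i i' gii'; apply: (@lift_inj _ j0); apply: finj; rewrite !gE gii'.
rewrite (bigD1_ord j0) //= f0 mxE unlift_none.
under eq_bigr do rewrite gE mxE liftK.
rewrite -expR_sum -expRD ler_expR sumrN -mulr_suml.
have h : (\sum_i w (g i)) * (- s) <= (1 - w0) * (- s).
  by apply: ler_wpM2r; [lra | exact: gap].
have h2 : w0 * u <= w0 * (- s) by apply: ler_wpM2l; lra.
rewrite mulrN in h; lra.
Qed.

(* A minor without the column 0 has decayed since [t1], and one with it has not
   yet grown as much as it will at [t2]: in between, all are tiny. *)
Lemma same_span_small k (c dl A w0 u : R) : (0 < k <= n)%N ->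
  (forall j, w0 <= w j) ->
  (forall k (f : 'I_k -> 'I_n), (k < n)%N -> injective f ->
     \sum_i w (f i) <= 1 - w0) ->
  0 < w0 -> 0 <= u -> 0 < dl -> 0 <= A ->
  (forall n' (B : 'M[R]_(k, n')) dl, 0 < dl -> lattice_ge B dl ->
    exists f : 'I_k -> 'I_n', c * dl ^+ k <= `|\det (colsub f B)|) ->
  forall y t t1 t2 (S S' : 'M[int]_(k, n.+1)) (C : 'M[R]_k),
  row_free (int_mx S : 'M[R]__) -> \det C != 0 -> int_mx S' = C *m int_mx S ->
  t1 + u <= t -> t + u <= t2 ->
  (forall i j, `|(int_mx S *m flow w t1 y) i j| <= A) ->
  (forall i j, `|(int_mx S' *m flow w t2 y) i j| <= A) ->
  lattice_ge (flow w t y) dl ->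
  c * dl ^+ k <= (k`!)%:R * A ^+ k * expR (- (w0 * u)).
Proof.
move=> /andP[k0 kn] w0j gap w00 u0 dl0 A0 ge y t t1 t2 S S' C fS C0 S'E t1t tt2 SA S'A good.
have uC : row_full C by rewrite row_full_unit unitmxE unitfE.
have fS' : row_free (int_mx S' : 'M[R]__).
  by rewrite /row_free S'E (eqmxMfull _ uC).
have Ak0 : 0 <= (k`!)%:R * A ^+ k by rewrite mulr_ge0 // exprn_ge0.
have minA (X : 'M[int]_(k, n.+1)) s f :
    (forall i j, `|(int_mx X *m flow w s y) i j| <= A) ->
    `|minor (int_mx X *m flow w s y) f| <= (k`!)%:R * A ^+ k.
  move=> XA; have := @det_le k (colsub f (int_mx X *m flow w s y)) (fun _ => A).
  rewrite prodr_const card_ord; apply => i j; rewrite [X in `|X|]mxE; exact: XA.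
(* Whichever of [S] and [S'] has the smaller covolume is bounded at both times. *)
have [X [fX XS XS']] : exists X : 'M[int]_(k, n.+1), [/\ row_free (int_mx X : 'M[R]__),
    forall f, `|minor (int_mx X *m flow w t1 y) f| <= (k`!)%:R * A ^+ k &
    forall f, `|minor (int_mx X *m flow w t2 y) f| <= (k`!)%:R * A ^+ k].
  have [C1|C1] := leP 1 `|\det C|.
    exists S; split => // f; first exact: minA.
    apply: le_trans (minA _ _ f S'A).
    by rewrite S'E -mulmxA minor_mul normrM ler_peMl.
  exists S'; split => // f; last exact: minA.
  apply: le_trans (minA _ _ f SA).
  by rewrite S'E -mulmxA minor_mul normrM ler_piMl // ltW.
have [f hf] := ge _ _ _ dl0 (int_lattice_ge fX good).
apply: le_trans hf _; rewrite -/(minor _ f).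
have exp0 s : 0 <= expR s :> R by exact: expR_ge0.
have [j12|finj] := pselect (exists j1 j2, j1 != j2 /\ f j1 = f j2).
  case: j12 => j1 [j2 [j12 f12]].
  by rewrite (minor_alternate _ j12 f12) normr0 mulr_ge0.
have {}finj i j : f i = f j -> i = j.
  by move=> fij; apply: contra_notP finj => /eqP ij; exists i, j.
have [[j0 f0]|nf] := pselect (exists j, f j = 0).
  have -> : t = t2 + (t - t2) by rewrite addrC subrK.
  rewrite minor_flowD normrM mulrC; apply: ler_pM => //.
  rewrite ger0_norm; last by apply: prodr_ge0 => j _; exact/ltW/flow_diag_gt0.
  by apply: (prod_flow_diag_le w0j gap w00 u0 _ kn f0 finj); lra.
have -> : t = t1 + (t - t1) by rewrite addrC subrK.
rewrite minor_flowD normrM mulrC; apply: ler_pM => //.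
rewrite ger0_norm; last by apply: prodr_ge0 => j _; exact/ltW/flow_diag_gt0.
have fle j : flow_diag w (t - t1) 0 (f j) <= expR (- (w0 * u)).
  case: (unliftP 0 (f j)) => [j' fj|fj]; last by case: nf; exists j.
  rewrite fj mxE liftK ler_expR lerN2; apply: ler_pM => //; first exact: ltW.
  by rewrite lerBrDl.
rewrite (bigD1 (Ordinal k0)) //= -[leRHS]mulr1; apply: ler_pM => //.
- exact/ltW/flow_diag_gt0.
- by apply: prodr_ge0 => j _; exact/ltW/flow_diag_gt0.
- have big1le (s : seq 'I_k) : \prod_(j <- s | j != Ordinal k0) flow_diag w (t - t1) 0 (f j) <= 1.
    elim: s => [|j s IH]; first by rewrite big_nil.
    rewrite big_cons; case: ifP => // _; rewrite mulr_ile1 //.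
    + exact/ltW/flow_diag_gt0.
    + by apply: prodr_ge0 => i _; exact/ltW/flow_diag_gt0.
    + apply: le_trans (fle j) _; rewrite -[leRHS]expR0 ler_expR oppr_le0.
      by rewrite mulr_ge0 // ltW.
  exact: big1le.
Qed.

End window.

(** Two copies of the previous window and one time between them. *)
Fixpoint window_size k : nat := if k is k'.+1 then (window_size k').*2.+1 else 1.

Section window_basis.
Context {R : realType} {n : nat}.
Variable w : 'I_n -> R.
Hypothesis w1 : \sum_j w j = 1.
Hypothesis w_gt0 : forall j, 0 < w j.
Implicit Types (y : 'I_n -> R) (t u s : R) (g : 'cV[R]_n.+1).

(** Both bounds carry the same factor [A], so that moving to another time affects [A] only and
    leaves [e] untouched. *)
Definition bounded_at y g (wm A e s : R) k (S : 'M[int]_(k, n.+1)) :=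
  (forall i j, `|(int_mx S *m flow w s y) i j| <= A) /\
  (forall i, `|(int_mx S *m g) i 0| <= A * e * expR (wm * s)).

Lemma bounded_move y g wm A B e s s' k (S : 'M[int]_(k, n.+1)) :
  0 <= wm -> wm <= 1 -> 0 <= A -> 0 <= e -> expR `|s' - s| * A <= B ->
  bounded_at y g wm A e s S -> bounded_at y g wm B e s' S.
Proof.
move=> wm0 wm1 A0 e0 AB [h1 h2]; split=> [i j|i].
  apply: le_trans AB; have -> : s' = s + (s' - s) by rewrite addrC subrK.
  rewrite mul_flowD normrM mulrC addrAC subrr add0r; apply: ler_pM => //.
  rewrite ger0_norm; last exact/ltW/flow_diag_gt0.
  exact: flow_diag_le.
apply: le_trans (h2 i) _.
apply: (@le_trans _ _ (expR `|s' - s| * A * e * expR (wm * s'))); last first.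
  by rewrite ler_wpM2r ?expR_ge0 // ler_wpM2r.
have -> : expR `|s' - s| * A * e * expR (wm * s') =
  A * e * (expR `|s' - s| * expR (wm * s')) by ring.
apply: ler_wpM2l; first exact: mulr_ge0.
rewrite -expRD ler_expR.
have : wm * (s - s') <= `|s' - s|.
  rewrite distrC; apply: le_trans (ler_norm _) _; rewrite normrM.
  by rewrite ler_piMl // ger0_norm.
lra.
Qed.

Lemma bounded_row y g wm A e s k (S : 'M[int]_(k, n.+1)) i :
  bounded_at y g wm A e s S -> bounded_at y g wm A e s (row i S).
Proof.
have rE m (F : 'M[R]_(n.+1, m)) j :
  (int_mx (row i S) *m F) 0 j = (int_mx S *m F) i j.
  by rewrite !mxE; apply: eq_bigr => l _; rewrite !mxE.
by move=> [h1 h2]; split=> [i' j|i']; rewrite ord1 rE.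
Qed.

Lemma bounded_col_mx y g wm A e s k (a : 'rV[int]_n.+1) (S : 'M[int]_(k, n.+1)) :
  bounded_at y g wm A e s a -> bounded_at y g wm A e s S ->
  bounded_at y g wm A e s (col_mx a S : 'M[int]_(1 + k, n.+1)).
Proof.
move=> [a1 a2] [h1 h2].
have E m (F : 'M[R]_(n.+1, m)) : int_mx (col_mx a S) *m F =
    col_mx (int_mx a *m F) (int_mx S *m F).
  by rewrite -mul_col_mx; congr (_ *m _); exact: (map_col_mx (intr : int -> R) a S).
split=> [i j|i]; rewrite E; case: (split_ordP i) => i' ->.
- by rewrite col_mxEu.
- by rewrite col_mxEd.
- by rewrite col_mxEu.
- by rewrite col_mxEd.
Qed.

Lemma expR_decay (X Y w0 : R) : 0 < Y -> 0 < w0 -> 0 <= X ->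
  exists2 u, 0 <= u & X * expR (- (w0 * u)) < Y.
Proof.
move=> Y0 w00 X0; exists (X / Y / w0); first by rewrite !divr_ge0 // ltW.
rewrite [w0 * _]mulrC divfK ?gt_eqF // expRN ltr_pdivrMr ?expR_gt0 //.
rewrite mulrC -ltr_pdivrMr //; have := expR_ge1Dx (X / Y); lra.
Qed.

(** The two windows are compared at a good time lying [u] away from each: equal spans would
    contradict [same_span_small], so the second window supplies a new row, which is carried back to
    a time of the first. The final [A] is independent of [e], which can thus be chosen small against
    it. *)
Lemma window_basis k : (k <= n)%N -> forall dl A0 : R, 0 < dl -> 0 <= A0 ->
  exists (T : seq R) (A L : R), [/\ size T = window_size k, 0 <= A, 0 <= L,
    forall o, o \in T -> 0 <= o <= L &
    forall t y g wm e, 0 <= wm -> wm <= 1 -> 0 <= e ->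
    (forall o, o \in T -> lattice_ge (flow w (t + o) y) dl) ->
    (forall o, o \in T -> exists a : 'rV[int]_n.+1, a != 0 /\
       bounded_at y g wm A0 e (t + o) a) ->
    exists o, o \in T /\ exists S : 'M[int]_(k.+1, n.+1),
      row_free (int_mx S : 'M[R]__) /\ bounded_at y g wm A e (t + o) S].
Proof.
move=> kn dl A0 dl0 A00; elim: k kn => [|k IH] kn.
  exists [:: 0], A0, 0; split => //.
    by move=> o; rewrite inE => /eqP ->; rewrite lexx.
  move=> t y g wm e wm0 wm1 e0 _ bd; exists 0; rewrite inE eqxx; split => //.
  have [a [a0 ha]] := bd 0 (mem_head _ _); exists a; split => //.
  rewrite /row_free rank_rV (_ : int_mx a != 0) //.
  apply: contraNneq a0 => h; apply/eqP/rowP => j.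
  by move/rowP/(_ j): h; rewrite !mxE => /eqP; rewrite intr_eq0 => /eqP.
have [T [A [L [sO A_0 L0 OL HO]]]] := IH (ltnW kn).
have [w0 w00 [w0j gap]] := weight_gap w1 w_gt0.
have [c c0 ge] := minor_ge (R := R) k.+1.
(* The gap [u] is long enough for the decay to beat the lower bound of [minor_ge]. *)
have [u u0 hu] := @expR_decay ((k.+1)`!%:R * A ^+ k.+1) (c * dl ^+ k.+1) w0
  (mulr_gt0 c0 (exprn_gt0 _ dl0)) w00 (mulr_ge0 (ler0n _ _) (exprn_ge0 _ A_0)).
pose D := L + (u + u).
exists (L + u :: T ++ [seq o + D | o <- T]), (expR (L + D) * A), (L + D); split.
- by rewrite /= size_cat size_map sO addnn.
- by rewrite mulr_ge0 // expR_ge0.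
- by rewrite /D; lra.
- move=> o; rewrite inE mem_cat => /or3P[/eqP ->| /OL | /mapP[r /OL h ->]];
    rewrite /D; [|move=> /andP[? ?]|case/andP: h => ? ?]; apply/andP; split; lra.
move=> t y g wm e wm0 wm1 e0 good bd.
have inO1 o : o \in T -> o \in L + u :: T ++ [seq o + D | o <- T].
  by move=> h; rewrite inE mem_cat h orbT.
have inO2 o : o \in T -> o + D \in L + u :: T ++ [seq o + D | o <- T].
  by move=> h; rewrite inE mem_cat (map_f (fun o => o + D) h) !orbT.
have [p1 [p1O [S [fS bS]]]] := HO t y g wm e wm0 wm1 e0
  (fun o h => good o (inO1 o h)) (fun o h => bd o (inO1 o h)).
have tD o : t + D + o = t + (o + D) by ring.
have [p2 [p2O [S' [fS' bS']]]] : exists o, o \in T /\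
    exists S : 'M[int]_(k.+1, n.+1),
      row_free (int_mx S : 'M[R]__) /\ bounded_at y g wm A e (t + D + o) S.
  apply: HO => // o h; rewrite tD; [exact/good/inO2 | exact/bd/inO2].
have /andP[q1a q1b] := OL _ p1O; have /andP[q2a q2b] := OL _ p2O.
have [/submxP[C S'C]|/row_subPn[i ni]] :=
    boolP ((int_mx S' : 'M[R]__) <= int_mx S)%MS.
  have fC : row_free C.
    rewrite /row_free eqn_leq rank_leq_row /= -{1}(eqP fS') S'C.
    exact: mxrankM_maxl.
  have C0 : \det C != 0 by move: fC; rewrite row_free_unit unitmxE unitfE.
  have := hu; rewrite ltNge.
  have -> // : c * dl ^+ k.+1 <= (k.+1)`!%:R * A ^+ k.+1 * expR (- (w0 * u)).
  apply: (@same_span_small _ _ w k.+1 c dl A w0 u _ w0j gap w00 u0 dl0 A_0 ge y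
    (t + (L + u)) (t + p1) (t + D + p2) S S' C) => //.
  - by lra.
  - by rewrite /D; lra.
  - by case: bS.
  - by case: bS'.
  - by apply: good; rewrite inE eqxx.
exists p1; split; first exact: inO1.
exists (col_mx (row i S') S); split.
  have WE : int_mx (col_mx (row i S') S : 'M[int]_(1 + k.+1, n.+1)) =
    (col_mx (row i (int_mx S')) (int_mx S) : 'M[R]_(1 + k.+1, n.+1)).
    rewrite -[row i (int_mx S')](map_row (intr : int -> R)).
    exact: (map_col_mx (intr : int -> R) (row i S') S).
  have eqW : ((int_mx (col_mx (row i S') S : 'M[int]_(1 + k.+1, n.+1)) : 'M[R]__)
      :=: row i (int_mx S') + (int_mx S : 'M[R]__))%MS.
    by rewrite WE; apply: eqmx_sym; exact: addsmxE.
  rewrite /row_free eqn_leq rank_leq_row /= -{1}(eqP fS); apply: rank_ltmx.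
  rewrite ltmxE eqW addsmxSr /=; apply: contra ni => h.
  by apply: submx_trans h; rewrite eqW; exact: addsmxSl.
apply: bounded_col_mx.
  apply: bounded_row; apply: bounded_move bS' => //.
  apply: ler_wpM2r => //; rewrite ler_expR ler_norml; rewrite /D.
  by apply/andP; split; lra.
apply: bounded_move bS => //; apply: ler_wpM2r => //.
rewrite ler_expR subrr normr0 /D; lra.
Qed.

End window_basis.

Section sheared_window.
Context {R : realType} {n : nat}.
Variables (w : 'I_n -> R) (j1 : 'I_n).
Hypothesis w1 : \sum_j w j = 1.
Hypothesis w_gt0 : forall j, 0 < w j.
Hypothesis w_max : forall j, w j <= w j1.
Implicit Types (y g : 'I_n -> R) (t s A e : R).

Definition col_of g : 'cV[R]_n.+1 :=
  \col_i if unlift 0 i is Some i' then g i' else 0.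

(* The coefficient of index [j1] is replaced by the derivative of the linear form
   in the direction of the coordinate [j1], [g] being the derivative of the map. *)
Definition shear_mx g : 'M[R]_n.+1 :=
  \matrix_(i, j) if j == lift 0 j1 then col_of g i 0 else (i == j)%:R.

Definition shear_diag s A e : 'rV[R]_n.+1 :=
  \row_j (flow_diag w s 0 j / (if j == lift 0 j1 then e else A)).

Definition sheared_flow s A e y g : 'M[R]_n.+1 :=
  umx y *m shear_mx g *m diag_mx (shear_diag s A e).

Lemma det_shear g : \det (shear_mx g) = g j1.
Proof.
rewrite (expand_det_col _ (lift 0 j1)).
have cE i : cofactor (shear_mx g) i (lift 0 j1) = (lift 0 j1 == i)%:R.
  have -> : cofactor (shear_mx g) i (lift 0 j1) =
      cofactor (1%:M : 'M[R]_n.+1) i (lift 0 j1).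
    by apply: cofactor_eq => i' j' /negbTE jj; rewrite !mxE jj.
  have := mul_mx_adj (1%:M : 'M[R]_n.+1); rewrite mul1mx det1.
  by move=> /matrixP /(_ (lift 0 j1) i); rewrite !mxE.
rewrite (bigD1 (lift 0 j1)) //= big1 ?addr0 => [|i /negbTE ij].
  by rewrite cE eqxx mulr1 !mxE eqxx liftK.
by rewrite cE eq_sym ij mulr0.
Qed.

Lemma umx_col_of y g : umx y *m col_of g = col_of g.
Proof.
apply/colP => i; rewrite mxE (bigD1 i) //= big1 ?addr0; last first.
  move=> j ji; rewrite !mxE; case: (unliftP 0 j) => [j' jE|_]; last by rewrite mulr0.
  by rewrite eq_sym (negbTE ji) mul0r.
rewrite !mxE; case: (unliftP 0 i) => [i' _|_]; last by rewrite mulr0.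
by rewrite eqxx mul1r.
Qed.

Lemma mul_sheared k (S : 'M[R]_(k, n.+1)) s A e y g i j : j != lift 0 j1 ->
  (S *m sheared_flow s A e y g) i j = (S *m flow w s y) i j / A.
Proof.
move=> jj; rewrite /sheared_flow /flow !mulmxA !mul_mx_diag !mxE (negbTE jj) mulrA.
congr (_ * _ / _); rewrite (bigD1 j) //= big1 ?addr0 => [|l lj].
  by rewrite !mxE (negbTE jj) eqxx mulr1.
by rewrite [shear_mx g _ _]mxE (negbTE jj) (negbTE lj) mulr0.
Qed.

Lemma mul_sheared_grad k (S : 'M[R]_(k, n.+1)) s A e y g i :
  (S *m sheared_flow s A e y g) i (lift 0 j1) =
  (S *m col_of g) i 0 * expR (- (w j1 * s)) / e.
Proof.
rewrite /sheared_flow !mulmxA mul_mx_diag mxE.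
rewrite [shear_diag _ _ _ _ _]mxE eqxx mxE [flow_diag _ _ _ _]mxE liftK mulrA.
congr (_ * _ / _).
rewrite -(umx_col_of y) mulmxA [RHS]mxE; apply: eq_bigr => l _.
by rewrite [shear_mx g _ _]mxE eqxx.
Qed.

(** The sheared box bounds the derivative instead of the coefficient of index [j1]. As g j1 = 1,
    that coefficient is the derivative minus the other terms, whose bounds A e^(w_j s) are at most A
    e^(w_j1 s); this produces the summands 1 and n * (Kg * A). *)
Lemma short_sheared_bounded s A e y g Kg (a : 'rV[int]_n.+1) :
  0 <= s -> 0 < A -> 0 < e -> e <= 1 -> g j1 = 1 -> 0 <= Kg ->
  (forall j, `|g j| <= Kg) ->
  (forall j, `|(int_mx a *m sheared_flow s A e y g) 0 j| < 1) ->
  bounded_at w y (col_of g) (w j1) (1 + A + n%:R * (Kg * A)) e s a.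
Proof.
move=> s0 A0 e0 e1 gj1 Kg0 gK ha.
set B := 1 + A + _.
have nKA : 0 <= n%:R * (Kg * A) by rewrite !mulr_ge0 // ltW.
have AB : A <= B by rewrite /B; lra.
have hj j : j != lift 0 j1 -> `|(int_mx a *m flow w s y) 0 j| <= A.
  move=> jj; have := ha j; rewrite mul_sheared // normrM normfV (gtr0_norm A0).
  by rewrite ltr_pdivrMr // mul1r => /ltW.
have hg : `|(int_mx a *m col_of g) 0 0| <= e * expR (w j1 * s).
  have := ha (lift 0 j1); rewrite mul_sheared_grad !normrM normfV (gtr0_norm e0).
  rewrite ltr_pdivrMr // mul1r expRN normfV (gtr0_norm (expR_gt0 _)).
  by rewrite ltr_pdivrMr ?expR_gt0 // => /ltW.
split=> [i j|i]; rewrite ord1; last first.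
  apply: le_trans hg _; rewrite ler_wpM2r ?expR_ge0 // ler_peMl ?(ltW e0) //.
  by rewrite /B; lra.
have [->|jj] := eqVneq j (lift 0 j1); last exact: le_trans (hj j jj) AB.
have aE : (int_mx a *m col_of g) 0 0 = (a 0 (lift 0 j1))%:~R +
    \sum_(j | j != j1) (a 0 (lift 0 j))%:~R * g j.
  rewrite mxE big_ord_recl [col_of g _ _]mxE unlift_none mulr0 add0r.
  rewrite (bigD1 j1) //= int_mxE mxE liftK gj1 mulr1; congr (_ + _).
  by apply: eq_bigr => l _; rewrite int_mxE mxE liftK.
rewrite mul_flowS int_mxE normrM (gtr0_norm (expR_gt0 _)).
have -> : (a 0 (lift 0 j1))%:~R = (int_mx a *m col_of g) 0 0 -
   \sum_(j | j != j1) (a 0 (lift 0 j))%:~R * g j :> R by rewrite aE addrK.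
rewrite expRN ler_pdivrMr ?expR_gt0 //.
apply: le_trans (ler_normB _ _) _.
rewrite /B -addrA mulrDl mul1r; apply: lerD.
  by apply: le_trans hg _; rewrite ler_piMl ?expR_ge0.
apply: le_trans (ler_norm_sum _ _ _) _.
apply: (@le_trans _ _ (\sum_(j : 'I_n) (Kg * A) * expR (w j1 * s))); last first.
  rewrite sumr_const card_ord -[leLHS]mulr_natl mulrA ler_wpM2r ?expR_ge0 //.
  by rewrite lerDr ltW.
rewrite big_mkcond; apply: ler_sum => l _; case: ifP => ll; last first.
  by rewrite mulr_ge0 ?expR_ge0 // mulr_ge0 // ltW.
rewrite normrM mulrC -mulrA; apply: ler_pM => //.
have ll' : lift 0 l != lift 0 j1 by rewrite (inj_eq lift_inj) ll.
have := hj _ ll'; rewrite mul_flowS int_mxE normrM (gtr0_norm (expR_gt0 _)).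
rewrite expRN ler_pdivrMr ?expR_gt0 // => h; apply: le_trans h _.
apply: ler_wpM2l; first exact: ltW.
by rewrite ler_expR ler_wpM2r.
Qed.

(** If every time failed, [window_basis] with k = n would give n + 1 independent forms at one time.
    After shearing, which preserves the determinant because g j1 = 1, one column carries the factor
    [e], and the choice of [e] makes a nonzero integer determinant smaller than 1. *)
Lemma sheared_window (dl A Kg : R) : 0 < dl -> 0 < A -> 0 <= Kg ->
  exists (T : seq R) (L e : R), [/\ size T = window_size n, 0 < e,
    forall o, o \in T -> 0 <= o <= L &
    forall t y g, 0 <= t -> g j1 = 1 -> (forall j, `|g j| <= Kg) ->
    (forall o, o \in T -> lattice_ge (flow w (t + o) y) dl) ->
    exists2 o, o \in T & lattice_ge (sheared_flow (t + o) A e y g) 1].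
Proof.
move=> dl0 A0 Kg0; pose B := 1 + A + n%:R * (Kg * A).
have B0 : 0 <= B by rewrite !addr_ge0 ?mulr_ge0 // ltW.
have [T [A1 [L [sT A10 L0 TL HT]]]] := window_basis w1 w_gt0 (leqnn n) dl0 B0.
pose X := (n.+1`!)%:R * A1 ^+ n.+1.
have X0 : 0 <= X by rewrite mulr_ge0 // exprn_ge0.
pose e := (X + 1)^-1.
have e0 : 0 < e by rewrite invr_gt0 ltr_wpDl.
have e1 : e <= 1 by rewrite invf_le1 ?ltr_wpDl // lerDr.
have Xe : X * e < 1 by rewrite /e ltr_pdivrMr ?ltr_wpDl // mul1r ltrDl.
exists T, L, e; split => // t y g t0 gj1 gK good.
apply: contrapT => none.
have wj0 : 0 <= w j1 by exact: ltW.
have [] := HT t y (col_of g) (w j1) e wj0 (weight_le1 w1 w_gt0 j1) (ltW e0) good.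
  move=> r rT; apply: contrapT => na; apply: none; exists r => // a a0.
  apply: contrapT => nj; apply: na; exists a; split => //.
  apply: short_sheared_bounded gK _ => //.
    by have /andP[r0 _] := TL r rT; rewrite addr_ge0.
  by move=> j; rewrite ltNge; apply/negP => h; apply: nj; exists j.
move=> r [rT [S [fS [b1 b2]]]].
have detS : 1 <= `|\det (int_mx S : 'M[R]__)|.
  rewrite /int_mx det_map_mx; apply: int_norm_ge1.
  by move: fS; rewrite row_free_unit unitmxE unitfE /int_mx det_map_mx intr_eq0.
pose M := int_mx S *m (umx y *m shear_mx g *m diag_mx (flow_diag w (t + r))).
have detM : \det M = \det (int_mx S : 'M[R]__).
  rewrite /M !det_mulmx det_shear gj1 mulr1 -[RHS]mulr1; congr (_ * _).
  by rewrite -(det_flow (t + r) y w1) det_mulmx.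
have shE : sheared_flow (t + r) 1 1 y g =
    umx y *m shear_mx g *m diag_mx (flow_diag w (t + r)).
  congr (_ *m diag_mx _); apply/rowP => j; rewrite mxE.
  by case: ifP; rewrite divr1.
move: detS; rewrite -detM; apply/negP; rewrite -ltNge.
apply: le_lt_trans Xe.
apply: le_trans (det_le (B := fun j => A1 * (if j == lift 0 j1 then e else 1)) _) _.
  move=> i j; rewrite /M -shE; case: eqVneq => [->|jj]; last first.
    by rewrite mul_sheared // divr1 mulr1.
  rewrite mul_sheared_grad divr1 normrM (gtr0_norm (expR_gt0 _)).
  by rewrite expRN ler_pdivrMr ?expR_gt0.
rewrite big_split /= prodr_const card_ord -big_mkcond big_pred1_eq mulrA.
by [].
Qed.

End sheared_window.

(** * Inhomogeneous approximation near a good point *)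

Section lipschitz.
Context {R : realType} {d : nat}.
Implicit Types (P Q : 'rV[R]_d * R) (x : 'rV[R]_d) (H : seq 'I_d -> 'rV[R]_d -> R).

Lemma jet_lipschitz P H (K B : R) x x' : 0 < P.2 -> jet_on 1 (in_cube P) H ->
  0 <= K -> 0 <= B ->
  (forall i z, in_cube P z -> `|H [:: i] z| <= K) ->
  in_cube P x -> in_cube P x' -> (forall i, `|x 0 i - x' 0 i| <= B) ->
  `|H [::] x - H [::] x'| <= d%:R * (K * B).
Proof.
move=> P0 hH K0 B0 HK Px Px' xx'.
pose mix (s : seq 'I_d) : 'rV[R]_d := \row_i if i \in s then x 0 i else x' 0 i.
have Pmix s : in_cube P (mix s) by move=> i; rewrite mxE; case: ifP.
have it s : `|H [::] (mix s) - H [::] x'| <= (size s)%:R * (K * B).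
  elim: s => [|i s IH].
    have -> : mix [::] = x' by apply/rowP => i; rewrite mxE.
    by rewrite subrr normr0 mul0r.
  have -> : mix (i :: s) = upd (mix s) i (x 0 i).
    by apply/rowP => j; rewrite !mxE inE; case: eqP => [->|].
  rewrite -natr1 mulrDl mul1r [leRHS]addrC.
  have -> : H [::] (upd (mix s) i (x 0 i)) - H [::] x' =
    (H [::] (upd (mix s) i (x 0 i)) - H [::] (mix s)) + (H [::] (mix s) - H [::] x').
    by ring.
  apply: le_trans (ler_normD _ _) _; apply: lerD IH.
  rewrite -[X in _ - H [::] X](upd_id (mix s) i).
  set t := x 0 i; set t' := mix s 0 i.
  have tt' : `|t - t'| <= B.
    by rewrite /t /t' mxE; case: ifP => _ //; rewrite subrr normr0.
  have Pt r : P.1 0 i <= r <= P.1 0 i + P.2 -> in_cube P (upd (mix s) i r).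
    by apply: in_cube_upd.
  have wlog u v : P.1 0 i <= u <= P.1 0 i + P.2 -> P.1 0 i <= v <= P.1 0 i + P.2 ->
      u < v -> `|H [::] (upd (mix s) i u) - H [::] (upd (mix s) i v)| <= K * `|u - v|.
    move=> /andP[u1 u2] /andP[v1 v2] uv.
    have [r /andP[r1 r2]|r [r1 r2 e]] := @mvt _ (fun t => H [::] (upd (mix s) i t))
       (fun t => H [:: i] (upd (mix s) i t)) _ _ uv.
      by apply: (jet_upd hH) => //; apply: Pt; apply/andP; split; lra.
    rewrite distrC e normrM [`|u - v|]distrC ler_wpM2r //.
    by apply: HK; apply: Pt; apply/andP; split; lra.
  have ht : P.1 0 i <= t <= P.1 0 i + P.2 by exact: Px.
  have ht' : P.1 0 i <= t' <= P.1 0 i + P.2 by exact: Pmix.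
  apply: (@le_trans _ _ (K * `|t - t'|)); last exact: ler_wpM2l.
  have [lt|lt|->] := ltgtP t t'.
  - exact: wlog.
  - by rewrite distrC [`|t - t'|]distrC; exact: wlog.
  - by rewrite !subrr normr0 mulr0.
have := it (enum 'I_d); rewrite size_enum_ord.
suff -> : mix (enum 'I_d) = x by [].
by apply/rowP => i; rewrite mxE mem_enum.
Qed.

Lemma dyadic_scale (r r0 : R) : 0 < r0 -> r0 <= r ->
  exists D : nat, r0 <= r / (2 ^ D)%:R /\ r / (2 ^ D)%:R < 2 * r0.
Proof.
move=> r00 r0r; have r20 : 0 < 2 * r0 by rewrite mulr_gt0.
have p2 D : 0 < (2 ^ D)%:R :> R by rewrite ltr0n expn_gt0.
have ex : exists D, r / (2 ^ D)%:R < 2 * r0.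
  exists (Num.truncn (r / (2 * r0))).+1.
  rewrite ltr_pdivrMr // mulrC -ltr_pdivrMr //.
  by apply: lt_trans (truncnS_gt _) _; rewrite ltr_nat ltn_expl.
case: (ex_minnP ex) => -[|D] hD Dmin; [exists 0%N | exists D.+1]; split => //.
  by rewrite expn0 divr1.
have [h|h] := leP (2 * r0) (r / (2 ^ D)%:R); last first.
  by have := Dmin _ h; rewrite ltnn.
rewrite expnS natrM invfM mulrCA mulrC ler_pdivlMr //; lra.
Qed.

Lemma mem_subcube_cover P M x (B : R) : 0 < P.2 -> (0 < M)%N -> in_cube P x ->
  P.2 / M%:R <= B ->
  exists v : {ffun 'I_d -> 'I_M}, forall x', in_cube (subcube P v) x' ->
    in_cube P x' /\ forall i, `|x' 0 i - x 0 i| <= B.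
Proof.
move=> P0 M0 Px PB; have [v xv] := subcube_cover P0 M0 Px.
exists v => x' x'v; split.
  exact: in_cube_le (subcube_le v P0 M0) _ x'v.
move=> i; apply: le_trans PB.
have /andP[a b] := xv i; have /andP[a' b'] := x'v i.
rewrite ler_norml; move: a b a' b'; rewrite /=; set p := (\row__ _) 0 i.
by move=> a b a' b'; apply/andP; split; lra.
Qed.

(** Index 1 out of 4 in each direction leaves a margin of at least a quarter of the side, the room
    in which a good point may be moved. *)
Definition inner_cube P : 'rV[R]_d * R :=
  subcube P [ffun=> Ordinal (isT : (1 < 4)%N)].

Definition has_inner_leaf D (B : set ('rV[R]_d * R)) : set ('rV[R]_d * R) :=
  [set Q | exists u : {ffun 'I_d -> 'I_(2 ^ D)}, ~ B (subcube (inner_cube Q) u)].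

(** A cube without a good inner leaf has at least a proportion 4^-d of bad leaves; if bad leaves
    make up at most half of 4^-d overall, at most half of the cubes are of this kind. *)
Lemma cnt_inner_leaf P D0 D1 (B : set ('rV[R]_d * R)) (eta : R) : 0 < P.2 ->
  eta * 4 ^+ d <= 1 / 2 ->
  (cnt (2 ^ (D0 + (2 + D1))) P B)%:R <= eta * ((2 ^ (D0 + (2 + D1))) ^ d)%:R ->
  ((2 ^ D0) ^ d <= 2 * cnt (2 ^ D0) P (has_inner_leaf D1 B))%N.
Proof.
move=> P0 eta4; have p D : (0 < 2 ^ D)%N by rewrite expn_gt0.
rewrite !expnD cnt_mul ?muln_gt0 ?p //.
have child (v : {ffun 'I_d -> 'I_(2 ^ D0)}) :
    ((if `[< has_inner_leaf D1 B (subcube P v) >] then 0 else (2 ^ D1) ^ d) <=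
     cnt (2 ^ 2 * 2 ^ D1) (subcube P v) B)%N.
  case: asboolP => [//|none].
  have v0 : 0 < (subcube P v).2 by rewrite divr_gt0 // ltr0n.
  rewrite cnt_mul ?p // (bigD1 [ffun=> Ordinal (isT : (1 < 4)%N)]) //=.
  apply: leq_trans (leq_addr _ _).
  rewrite /cnt -{1}[(2 ^ D1)%N]card_ord -[d in (_ ^ d)%N]card_ord -card_ffun.
  apply: subset_leq_card; apply/fintype.subsetP => u _; apply/asboolP.
  by apply: contrapT => h; apply: none; exists u.
move=> h; pose G := cnt (2 ^ D0) P (has_inner_leaf D1 B).
have sum_le : (((2 ^ D0) ^ d - G) * (2 ^ D1) ^ d <=
  \sum_(v : {ffun 'I_d -> 'I_(2 ^ D0)}) cnt (2 ^ 2 * 2 ^ D1) (subcube P v) B)%N.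
  apply: (@leq_trans (\sum_(v : {ffun 'I_d -> 'I_(2 ^ D0)})
    (if `[< has_inner_leaf D1 B (subcube P v) >] then 0 else (2 ^ D1) ^ d))%N);
    last by apply: leq_sum => v _; exact: child.
  rewrite (eq_bigr (fun v : {ffun 'I_d -> 'I_(2 ^ D0)} => if ~~ `[< has_inner_leaf D1 B (subcube P v) >]
     then (2 ^ D1) ^ d else 0)%N); last by move=> v _; case: ifP.
  rewrite -big_mkcond sum_nat_const leq_mul2r; apply/orP; right.
  rewrite leq_subLR /G /cnt.
  have := cardC (fun v : {ffun 'I_d -> 'I_(2 ^ D0)} =>
    `[< has_inner_leaf D1 B (subcube P v) >]).
  by rewrite card_ffun !card_ord => <-.
have := le_trans _ h; rewrite -(ler_nat R) in sum_le.
have -> : ((2 ^ D0 * (2 ^ 2 * 2 ^ D1)) ^ d)%:R =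
    ((2 ^ D0) ^ d)%:R * (4 ^+ d * ((2 ^ D1) ^ d)%:R) :> R.
  by rewrite expnMn natrM expnMn natrM [((2 ^ 2) ^ d)%:R]natrX.
move=> /(_ _ sum_le); rewrite natrM => h2.
have q0 : 0 < ((2 ^ D1) ^ d)%:R :> R by rewrite ltr0n expn_gt0 p.
have {h2} : ((2 ^ D0) ^ d - G)%:R <= 1 / 2 * ((2 ^ D0) ^ d)%:R :> R.
  rewrite -(ler_pM2r q0); apply: le_trans h2 _.
  have -> : eta * (((2 ^ D0) ^ d)%:R * (4 ^+ d * ((2 ^ D1) ^ d)%:R)) =
    (eta * 4 ^+ d) * (((2 ^ D0) ^ d)%:R * ((2 ^ D1) ^ d)%:R) by ring.
  by rewrite -[leRHS]mulrA ler_wpM2r // mulr_ge0.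
rewrite natrB; last exact: cntT.
move=> h3; rewrite -(ler_nat R) natrM; rewrite -/G; lra.
Qed.

End lipschitz.

Section good_points.
Context {R : realType} {d n : nat}.
Variables (w : 'I_n -> R) (phi : 'I_n -> seq 'I_d -> 'rV[R]_d -> R).
Hypothesis w1 : \sum_j w j = 1.
Hypothesis w_gt0 : forall j, 0 < w j.
Implicit Types (P Q : 'rV[R]_d * R) (x : 'rV[R]_d).

(** The leaf is small compared with e^(-2s): a form whose coefficients are at most dl / 2 * e^s
    varies by at most dl / 4 * e^(-s) on it, so a vector shorter than dl / 2 at [x] would be shorter
    than [dl] throughout. *)
Lemma lattice_ge_of_leaf s (dl lam : R) Q x : 0 <= s -> 0 < dl -> 0 <= lam ->
  n%:R * lam * expR (s + s) <= 1 / 2 ->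
  (forall j z, in_cube Q z -> `|phi j [::] z - phi j [::] x| <= lam) ->
  ~ short_on w phi s dl Q -> in_cube Q x ->
  lattice_ge (flow w s (value phi x)) (dl / 2).
Proof.
move=> s0 dl0 lam0 hlam lip ns Qx a a0; apply: contrapT => none.
have small j : `|(int_mx a *m flow w s (value phi x)) 0 j| < dl / 2.
  by rewrite ltNge; apply/negP => h; apply: none; exists j.
apply: ns; exists a => // z Qz j.
have [j' ->|->] := unliftP 0 j.
  have := small (lift 0 j'); rewrite !mul_flowS; lra.
have asmall j' : `|(int_mx a : 'rV[R]_n.+1) 0 (lift 0 j')| <= dl / 2 * expR s.
  have := small (lift 0 j'); rewrite mul_flowS normrM (gtr0_norm (expR_gt0 _)).
  rewrite expRN ltr_pdivrMr ?expR_gt0 // => /ltW h; apply: le_trans h _.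
  apply: ler_wpM2l; first by rewrite divr_ge0 // ltW.
  by rewrite ler_expR ler_piMl // (weight_le1 w1 w_gt0).
rewrite mul_flow0 normrM (gtr0_norm (expR_gt0 _)).
have := small 0; rewrite mul_flow0 normrM (gtr0_norm (expR_gt0 _)) => h0.
have row0 : row 0 (int_mx a : 'rV[R]_n.+1) = int_mx a.
  by apply/rowP => i; rewrite mxE.
rewrite row0 in h0 *.
have diff : `|aform (int_mx a) (value phi z) - aform (int_mx a) (value phi x)| <=
    n%:R * (dl / 2 * expR s * lam).
  rewrite /aform opprD addrACA subrr add0r -sumrB.
  apply: le_trans (ler_norm_sum _ _ _) _.
  rewrite mulr_natl -[X in _ *+ X](card_ord n) -sumr_const.
  by apply: ler_sum => j' _; rewrite -mulrBr normrM ler_pM // lip.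
have := ler_normD (aform (int_mx a) (value phi z) - aform (int_mx a) (value phi x))
  (aform (int_mx a) (value phi x)); rewrite subrK => h1.
have h2 : n%:R * (dl / 2 * expR s * lam) * expR s <= dl / 4.
  have -> : n%:R * (dl / 2 * expR s * lam) * expR s =
    dl / 2 * (n%:R * lam * expR (s + s)) by rewrite expRD; ring.
  have -> : dl / 4 = dl / 2 * (1 / 2) by field.
  by apply: ler_wpM2l => //; rewrite divr_ge0 // ltW.
have := ler_wpM2r (expR_ge0 s) (le_trans h1 (lerD diff (lexx _))).
rewrite mulrDl; lra.
Qed.

Variable j1 : 'I_n.

Lemma row_sheared s A e y g (x : 'cV[R]_n.+1) : let M := sheared_flow w j1 s A e y g in
  let D j := shear_diag w j1 s A e 0 j * x j 0 in
  (M *m x) 0 0 = D 0 /\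
  forall j, (M *m x) (lift 0 j) 0 = y j * D 0 + g j * D (lift 0 j1) +
     (if j == j1 then 0 else D (lift 0 j)).
Proof.
move=> M D.
pose X : 'cV[R]_n.+1 := \col_j D j.
have MX : M *m x = umx y *m (shear_mx j1 g *m X).
  rewrite /M /sheared_flow -!mulmxA; congr (_ *m (_ *m _)).
  by apply/colP => i; rewrite mul_diag_mx mxE [RHS]mxE.
have Y0 : (shear_mx j1 g *m X) 0 0 = D 0.
  rewrite mxE big_ord_recl !mxE /= mulr1n mul1r big1 ?addr0 // => j _.
  by rewrite !mxE unlift_none; case: eqP => _; rewrite mul0r.
have YS j : (shear_mx j1 g *m X) (lift 0 j) 0 =
    g j * D (lift 0 j1) + (if j == j1 then 0 else D (lift 0 j)).
  rewrite mxE (bigD1 (lift 0 j1)) //= !mxE eqxx liftK; congr (_ + _).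
  case: eqP => [->|/eqP jj].
    rewrite big1 // => l /negbTE lj.
    by rewrite !mxE lj eq_sym lj mul0r.
  have jj' : lift 0 j != lift 0 j1 by rewrite (inj_eq lift_inj).
  rewrite (bigD1 (lift 0 j)) //= !mxE (negbTE jj') eqxx mul1r big1 ?addr0 //.
  move=> l /andP[/negbTE l1 /negbTE l2]; rewrite !mxE l1 eq_sym l2.
  by rewrite mul0r.
split=> [|j]; rewrite MX mxE.
  rewrite big_ord_recl Y0 !mxE !unlift_none mul1r big1 ?addr0 // => j _.
  by rewrite mxE liftK mul0r.
rewrite big_ord_recl Y0 !mxE unlift_none liftK -addrA; congr (_ + _).
rewrite (bigD1 j) //= big1 ?addr0 => [|l lj].
  by rewrite YS mxE liftK eqxx mul1r.
by rewrite mxE !liftK (inj_eq lift_inj) eq_sym (negbTE lj) mul0r.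
Qed.

End good_points.

Section nearby_points.
Context {R : realType} {d n : nat}.
Implicit Types (P Q : 'rV[R]_d * R) (x : 'rV[R]_d).

(** The target of the transference is shifted by [Y0] in the row of [q], and by [y j * Y0] in the
    others to compensate. Since the unshifted solution is at most C e^s / A, the shift 2 C e^s / A
    makes [q] positive and of the exact order e^s / A. *)
Lemma inhomogeneous_approx : exists2 C : R, 0 < C &
  forall (w : 'I_n -> R) j1 s A e y g (theta : 'I_n -> R), 0 < A -> 0 < e ->
  lattice_ge (sheared_flow w j1 s A e y g) 1 ->
  exists (q : int) (xi : R) (be : 'I_n -> R) (z : 'I_n -> int),
    [/\ C * expR s / A <= q%:~R, q%:~R <= 3 * C * expR s / A,
      `|xi| <= C * expR (- (w j1 * s)) / e,
      forall j, `|be j| <= C * expR (- (w j * s)) / A &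
      forall j, q%:~R * y j + g j * xi + be j = theta j + (z j)%:~R].
Proof.
have [C C0 HC] := transference (R := R) n.+1 n.+1.
exists C => // w j1 s A e y g theta A0 e0 hM.
pose Y0 := - (2 * C * expR s / A).
pose Y : 'cV[R]_n.+1 :=
  \col_i if unlift 0 i is Some j then theta j + y j * Y0 else Y0.
have [x [z [xC Mx]]] := HC _ _ ltr01 hM Y.
rewrite divr1 in xC.
have [r0 rS] := row_sheared w j1 s A e y g x.
pose D j := shear_diag w j1 s A e 0 j * x j 0.
have D0E : D 0 = expR s / A * x 0 0.
  by rewrite /D !mxE unlift_none /=.
have z0E : (z 0 0)%:~R = D 0 - Y0.
  have := congr1 (fun M : 'cV[R]__ => M 0 0) Mx.
  by rewrite r0 [RHS]mxE int_mxE [Y _ _]mxE unlift_none -/(D 0) => ->; rewrite addrAC subrr add0r.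
have zSE j : y j * D 0 + g j * D (lift 0 j1) + (if j == j1 then 0 else D (lift 0 j)) =
   theta j + y j * Y0 + (z (lift 0 j) 0)%:~R.
  have := congr1 (fun M : 'cV[R]__ => M (lift 0 j) 0) Mx.
  by rewrite rS [RHS]mxE int_mxE [Y _ _]mxE liftK.
have /andP[x1 x2] : - C <= x 0 0 <= C by rewrite -ler_norml.
have sA : 0 < expR s / A by rewrite divr_gt0 // expR_gt0.
have DS j (b : R) : 0 < b -> (if lift 0 j == lift 0 j1 then e else A) = b ->
    `|D (lift 0 j)| <= C * expR (- (w j * s)) / b.
  move=> b0 bE; rewrite /D [shear_diag _ _ _ _ _ _ _]mxE bE [flow_diag _ _ _ _]mxE liftK.
  rewrite normrM ger0_norm; last by rewrite divr_ge0 ?expR_ge0 // ltW.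
  by rewrite mulrC -mulrA ler_wpM2r // divr_ge0 ?expR_ge0 // ltW.
exists (z 0 0), (D (lift 0 j1)), (fun j => if j == j1 then 0 else D (lift 0 j)),
  (fun j => z (lift 0 j) 0); split.
- rewrite z0E D0E /Y0 opprK.
  have -> : C * expR s / A = expR s / A * C by ring.
  have -> : 2 * C * expR s / A = expR s / A * (2 * C) by ring.
  by rewrite -mulrDr ler_pM2l //; lra.
- rewrite z0E D0E /Y0 opprK.
  have -> : 3 * C * expR s / A = expR s / A * (3 * C) by ring.
  have -> : 2 * C * expR s / A = expR s / A * (2 * C) by ring.
  by rewrite -mulrDr ler_pM2l //; lra.
- by apply: DS; rewrite ?eqxx.
- move=> j; case: eqP => [_|/eqP jj].
    by rewrite normr0 divr_ge0 ?mulr_ge0 ?expR_ge0 // ltW.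
  by apply: DS => //; rewrite (inj_eq lift_inj) (negbTE jj).
- move=> j; have := zSE j; rewrite z0E => h; lra.
Qed.

Definition badly_approximable_set (w : 'I_n -> R)
    (phi : 'I_n -> seq 'I_d -> 'rV[R]_d -> R) theta (eps : R) (N : nat) :=
  [set x : 'rV[R]_d | forall (q : nat) (z : 'I_n -> int), (N <= q)%N -> (0 < q)%N ->
     ~ forall j, `|q%:R * phi j [::] x - theta j - (z j)%:~R| < (eps / q%:R) `^ w j].

Lemma expR_powR (s v : R) : expR (- s) `^ v = expR (- (v * s)).
Proof. by rewrite /powR gt_eqF ?expR_gt0 // expRK mulrN. Qed.

(** The term [g j * xi] is absorbed by moving [x] by xi / q along [i1]. Three errors remain: the
    variation over the ball around the new point, the Taylor remainder, controlled by [tau], and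
    [be j]. They are at most 3/16, 1/4 and 1/4 of e^(-w_j s). *)
Lemma nearby_point (w : 'I_n -> R) phi (C eps A e tau Kg : R) i1 j1 theta N P0 P x s :
  (forall j, 0 < w j) -> (forall j, w j <= w j1) ->
  0 < C -> 0 < eps -> 3 * C / eps <= A -> 4 * C <= A -> 0 < e -> 0 <= tau ->
  8 * C * tau <= e -> 0 < Kg -> 0 <= s -> (0 < d)%N ->
  (lattice_ge (sheared_flow w j1 s A e (value phi x) (fun j => phi j [:: i1] x)) 1 ->
    exists (q : int) (xi : R) (be : 'I_n -> R) (z : 'I_n -> int),
    [/\ C * expR s / A <= q%:~R, q%:~R <= 3 * C * expR s / A,
      `|xi| <= C * expR (- (w j1 * s)) / e,
      forall j, `|be j| <= C * expR (- (w j * s)) / A &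
      forall j, q%:~R * value phi x j + phi j [:: i1] x * xi + be j =
        theta j + (z j)%:~R]) ->
  0 < P0.2 -> (forall j, jet_on 1 (in_cube P0) (phi j)) ->
  (forall j z z', in_cube P0 z -> in_cube P0 z' ->
     `|phi j [:: i1] z - phi j [:: i1] z'| <= 2 * tau) ->
  (forall j i z, in_cube P0 z -> `|phi j [:: i] z| <= Kg) ->
  cube_le P P0 -> in_cube P x ->
  (forall u, `|u| <= A / e * expR (- (s + w j1 * s)) ->
     P.1 0 i1 <= x 0 i1 + u <= P.1 0 i1 + P.2) ->
  N%:R <= C * expR s / A ->
  lattice_ge (sheared_flow w j1 s A e (value phi x) (fun j => phi j [:: i1] x)) 1 ->
  exists2 x', in_cube P x' & forall z, in_cube P0 z ->
    (forall i, `|z 0 i - x' 0 i| <= (4 * Kg * d%:R)^-1 * expR (- (s + w j1 * s))) ->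
    ~ badly_approximable_set w phi theta eps N z.
Proof.
move=> w0 wm C0 eps0 Aeps AC e0 tau0 taue Kg0 s0 d0 approx P00 jets osc gK PP0 Px room
  Ns good.
have A0 : 0 < A by apply: lt_le_trans AC; rewrite mulr_gt0.
have [q [xi [be [z [q1 q2 hxi hbe hz]]]]] := approx good.
have qpos : 0 < (q%:~R : R).
  by apply: lt_le_trans q1; rewrite divr_gt0 // mulr_gt0 // expR_gt0.
pose u := xi / q%:~R.
have uU : `|u| <= A / e * expR (- (s + w j1 * s)).
  rewrite /u normrM normfV (gtr0_norm qpos) ler_pdivrMr //.
  apply: le_trans hxi _.
  apply: (@le_trans _ _ (A / e * expR (- (s + w j1 * s)) * (C * expR s / A))).
    rewrite opprD expRD [expR (- s)]expRN le_eqVlt; apply/orP; left; apply/eqP.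
    by field; rewrite !gt_eqF // expR_gt0.
  by apply: ler_wpM2l => //; rewrite mulr_ge0 ?expR_ge0 // divr_ge0 // ltW.
pose x' := upd x i1 (x 0 i1 + u).
have Px' : in_cube P x' by apply: in_cube_upd => //; exact: room.
have P0x := in_cube_le PP0 Px; have P0x' := in_cube_le PP0 Px'.
exists x' => // x'' P0x'' near'' bad.
set E := expR (- (w j1 * s)).
have E0 : 0 < E by exact: expR_gt0.
have EE : expR (- (s + w j1 * s)) = (expR s)^-1 * E.
  by rewrite opprD expRD expRN.
have es0 : 0 < expR s by exact: expR_gt0.
have taylor j : `|phi j [::] x' - phi j [::] x - phi j [:: i1] x * u| <= 2 * tau * `|u|.
  have Pt r : P.1 0 i1 <= r <= P.1 0 i1 + P.2 -> in_cube P0 (upd x i1 r).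
    by move=> hr; apply: (in_cube_le PP0); exact: in_cube_upd.
  have base : P.1 0 i1 <= x 0 i1 <= P.1 0 i1 + P.2 by exact: Px.
  have top : P.1 0 i1 <= x 0 i1 + u <= P.1 0 i1 + P.2 by exact: room.
  have wlog a b : P.1 0 i1 <= a <= P.1 0 i1 + P.2 ->
      P.1 0 i1 <= b <= P.1 0 i1 + P.2 -> a < b ->
      `|phi j [::] (upd x i1 b) - phi j [::] (upd x i1 a) - phi j [:: i1] x * (b - a)|
        <= 2 * tau * `|b - a|.
    move=> /andP[a1 a2] /andP[b1 b2] ab.
    have [r /andP[r1 r2]|r [r1 r2 ->]] := @mvt _ (fun t => phi j [::] (upd x i1 t))
       (fun t => phi j [:: i1] (upd x i1 t)) _ _ ab.
      by apply: (jet_upd (jets j)) => //; apply: Pt; apply/andP; split; lra.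
    rewrite -mulrBl normrM ler_wpM2r //; apply: osc => //.
    by apply: Pt; apply/andP; split; lra.
  suff : `|phi j [::] (upd x i1 (x 0 i1 + u)) - phi j [::] (upd x i1 (x 0 i1)) -
      phi j [:: i1] x * (x 0 i1 + u - x 0 i1)| <= 2 * tau * `|x 0 i1 + u - x 0 i1|.
    rewrite upd_id (_ : x 0 i1 + u - x 0 i1 = u) //.
    by rewrite [x 0 i1 + u]addrC addrK.
  have [lt|lt|eq] := ltgtP (x 0 i1) (x 0 i1 + u).
  - exact: wlog.
  - have := wlog _ _ top base lt; rewrite [`|x 0 i1 - _|]distrC.
    move=> h; apply: le_trans h; rewrite le_eqVlt; apply/orP; left; apply/eqP.
    by rewrite -normrN; congr (`|_|); ring.
  - by rewrite -eq !subrr mulr0 subrr normr0 mulr0.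
have sig0 : 0 <= (4 * Kg * d%:R)^-1 * expR (- (s + w j1 * s)).
  by rewrite mulr_ge0 ?expR_ge0 // invr_ge0 !mulr_ge0 // ltW.
have lip j := jet_lipschitz P00 (jets j) (ltW Kg0) sig0 (gK j) P0x'' P0x' near''.
have dn0 : d%:R != 0 :> R by rewrite pnatr_eq0 -lt0n.
have qz : (0 < q)%R by rewrite -(ltr0z R).
have qN : q = `|q|%N :> int by rewrite gez0_abs // ltW.
have qR : (q%:~R : R) = (`|q|%N)%:R by rewrite {1}qN -pmulrn.
apply: (bad `|q|%N z).
- by rewrite -(ler_nat R) -qR; exact: le_trans Ns q1.
- by rewrite absz_gt0 gt_eqF.
move=> j; rewrite -qR.
(* From 3 C / eps <= A one gets q <= eps * e^s, so errors measured in e^(-w_j s) suffice. *)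
have Ej : expR (- (w j * s)) <= (eps / q%:~R) `^ w j.
  rewrite -expR_powR; apply: ge0_ler_powR; rewrite ?nnegrE ?expR_ge0 //.
  - exact: ltW.
  - by rewrite divr_ge0 // ltW.
  rewrite expRN ler_pdivlMr // mulrC ler_pdivrMr //.
  apply: le_trans q2 _; rewrite ler_pdivrMr // [leRHS]mulrAC ler_wpM2r ?(ltW es0) //.
  by move: Aeps; rewrite ler_pdivrMr // [A * eps]mulrC.
apply: lt_le_trans Ej.
have E_Ej : E <= expR (- (w j * s)).
  by rewrite ler_expR lerN2 ler_wpM2r.
set F := expR (- (w j * s)) in E_Ej *.
have F0 : 0 < F by exact: expR_gt0.
have -> : q%:~R * phi j [::] x'' - theta j - (z j)%:~R =
  q%:~R * (phi j [::] x'' - phi j [::] x') +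
  (q%:~R * (phi j [::] x' - phi j [::] x - phi j [:: i1] x * u) - be j).
  have := hz j; rewrite /value => h.
  have -> : phi j [:: i1] x * u = phi j [:: i1] x * xi / q%:~R by rewrite /u mulrA.
  rewrite mulrBr [q%:~R * (_ - _ / _)]mulrBr mulrCA [q%:~R * q%:~R^-1]mulfV ?gt_eqF //.
  rewrite mulr1 mulrBr; lra.
apply: le_lt_trans (ler_normD _ _) _.
have b1 : `|q%:~R * (phi j [::] x'' - phi j [::] x')| <= 3 / 16 * F.
  rewrite normrM (gtr0_norm qpos).
  apply: (@le_trans _ _ (3 * C * expR s / A * (d%:R * (Kg *
      ((4 * Kg * d%:R)^-1 * expR (- (s + w j1 * s))))))).
    by apply: ler_pM => //; exact: ltW.
  have -> : 3 * C * expR s / A * (d%:R * (Kg *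
      ((4 * Kg * d%:R)^-1 * expR (- (s + w j1 * s))))) = 3 / 4 * (C / A) * E.
    by rewrite EE; field; rewrite dn0 !gt_eqF.
  have CA : C / A <= 1 / 4 by rewrite ler_pdivrMr //; lra.
  have CA0 : 0 <= C / A by rewrite divr_ge0 // ltW.
  have : C / A * E <= 1 / 4 * F by apply: ler_pM => //; exact: ltW.
  lra.
have b2 : `|q%:~R * (phi j [::] x' - phi j [::] x - phi j [:: i1] x * u)| <= 1 / 4 * F.
  rewrite normrM (gtr0_norm qpos).
  apply: (@le_trans _ _ (q%:~R * (2 * tau * `|u|))).
    by apply: ler_wpM2l; [exact: ltW | exact: taylor].
  have -> : q%:~R * (2 * tau * `|u|) = 2 * tau * `|xi|.
    by rewrite /u normrM normfV (gtr0_norm qpos); field; rewrite gt_eqF.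
  apply: (@le_trans _ _ (2 * tau * (C * E / e))).
    by apply: ler_wpM2l => //; rewrite mulr_ge0.
  have -> : 2 * tau * (C * E / e) = 8 * C * tau / e * (1 / 4) * E.
    by field; rewrite gt_eqF.
  have h1 : 8 * C * tau / e <= 1 by rewrite ler_pdivrMr // mul1r.
  rewrite -mulrA; apply: (@le_trans _ _ (1 * (1 / 4 * E))).
    by apply: ler_wpM2r => //; rewrite mulr_ge0 // ltW.
  lra.
have b3 : `|be j| <= 1 / 4 * F.
  apply: le_trans (hbe j) _; rewrite mulrAC; apply: ler_wpM2r; first exact: ltW.
  by rewrite ler_pdivrMr //; lra.
have := ler_normB (q%:~R * (phi j [::] x' - phi j [::] x - phi j [:: i1] x * u)) (be j).
lra.
Qed.

End nearby_points.

(** * Nullity on a small cube *)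

Section local_nullity.
Context {R : realType} {d n : nat}.
Implicit Types (P Q : 'rV[R]_d * R) (x : 'rV[R]_d).

Lemma cnt_exists_le M P (T : seq R) (B : R -> set ('rV[R]_d * R)) (X : R) :
  (forall o, o \in T -> (cnt M P (B o))%:R <= X) ->
  (cnt M P [set Q | exists2 o, o \in T & B o Q])%:R <= (size T)%:R * X.
Proof.
elim: T => [|o T IH] hT.
  rewrite mul0r lern0 -leqn0; apply: leq_trans (_ : _ <= cnt M P set0)%N _.
    by apply: cntS => v [].
  by rewrite cnt_set0.
apply: (@le_trans _ _ (cnt M P (B o `|` [set Q | exists2 o, o \in T & B o Q]))%:R).
  rewrite ler_nat; apply: cntS => v [r]; rewrite inE => /orP[/eqP ->|rT] h.
    by left.
  by right; exists r.
apply: (@le_trans _ _ ((cnt M P (B o))%:R +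
    (cnt M P [set Q | exists2 o, o \in T & B o Q])%:R)).
  by rewrite -natrD ler_nat cntU.
rewrite /= -natr1 mulrDl mul1r addrC; apply: lerD.
  by apply: IH => r rT; apply: hT; rewrite inE rT orbT.
by apply: hT; rewrite inE eqxx.
Qed.

Lemma exists_large_time (t0 X Y c : R) : 0 < X -> 0 < c ->
  exists t, [/\ t0 <= t, 0 <= t, X * expR (- t) <= c & Y <= c * expR t].
Proof.
move=> X0 c0; exists (`|t0| + (X / c + `|Y| / c)).
have h1 : 0 <= X / c by rewrite divr_ge0 // ltW.
have h2 : 0 <= `|Y| / c by rewrite divr_ge0 // ltW.
set t := _ + _.
have tX : X / c <= t by rewrite /t; have := normr_ge0 t0; lra.
have tY : `|Y| / c <= t by rewrite /t; have := normr_ge0 t0; lra.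
have et := expR_ge1Dx t.
split.
- by rewrite /t; have := ler_norm t0; lra.
- by lra.
- rewrite expRN ler_pdivrMr ?expR_gt0 // mulrC -ler_pdivrMr //; lra.
- rewrite mulrC -ler_pdivrMr //; apply: le_trans (_ : `|Y| / c <= _); last lra.
  by rewrite ler_pM2r ?invr_gt0 // ler_norm.
Qed.

(** The relevant scale is [E t], the order of the displacements. At least half of the cubes of this
    scale in [P] contain a good point with room to move, and each of them loses a subcube of
    relative volume M2^-d. As [M2] depends neither on [P] nor on [t], [null_criterion] applies. *)
Lemma local_null (w : 'I_n -> R) j1 i1 theta l (c eps Kg : R) :
  (0 < d)%N -> (0 < l)%N -> \sum_j w j = 1 -> (forall j, 0 < w j) ->
  (forall j, w j <= w j1) -> 0 < c -> 0 < eps -> 0 < Kg ->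
  exists2 tau, 0 < tau & forall phi x0 P0 N,
  0 < P0.2 -> P0.2 <= 1 ->
  nondegenerate_jet phi l c x0 -> (forall j, jet_on l (in_cube P0) (phi j)) ->
  jets_near phi l tau x0 (in_cube P0) ->
  (forall x, in_cube P0 x -> phi j1 [:: i1] x = 1) ->
  (forall j i x, in_cube P0 x -> `|phi j [:: i] x| <= Kg) ->
  lebesgue_outer (badly_approximable_set w phi theta eps N `&` in_cube P0) = 0%E.
Proof.
move=> d0 l0 w1 w0 wm c0 eps0 Kg0.
pose Kw : R := (window_size n)%:R.
have Kw0 : 0 < Kw by rewrite ltr0n; case: n.
(* Each of the [Kw] times excludes at most a proportion [eta] of the leaves: in total half of 4^-d,
   as [cnt_inner_leaf] demands. *)
pose eta := (2 * 4 ^+ d * Kw)^-1.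
have eta0 : 0 < eta by rewrite invr_gt0 !mulr_gt0 // exprn_gt0.
have [tau1 tau10 [dl dl0 Hcnt]] := cnt_short_on n l d0 c0 eta0.
have [C C0 approx] := inhomogeneous_approx (R := R) (n := n).
(* The first summand gives q <= eps * e^s, the second keeps C / A below 1/4 in the error terms. *)
pose A := 3 * C / eps + 4 * C.
have Ceps : 0 <= 3 * C / eps by rewrite divr_ge0 ?mulr_ge0 // ltW.
have A0 : 0 < A by rewrite ltr_wpDl // mulr_gt0.
have dl20 : 0 < dl / 2 by rewrite divr_gt0.
have [T [L [e [sT e0 TL win]]]] := sheared_window w1 w0 wm dl20 A0 (ltW Kg0).
exists (Num.min tau1 (e / (8 * C))).
  by rewrite lt_min tau10 divr_gt0 // mulr_gt0.
set tau := Num.min _ _ => phi x0 P0 N P00 P01 nd jets near g1 gK.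
have tau0 : 0 <= tau by rewrite le_min (ltW tau10) divr_ge0 ?mulr_ge0 // ltW.
have taue : 8 * C * tau <= e.
  rewrite mulrC -ler_pdivlMr ?mulr_gt0 //; by rewrite ge_min lexx orbT.
have near1 : jets_near phi l tau1 x0 (in_cube P0).
  by move=> x j s Px sl; apply: le_trans (near x j s Px sl) _; rewrite ge_min lexx.
have jets1 j : jet_on 1 (in_cube P0) (phi j) by apply: jet_onS (jets j).
have osc j z z' : in_cube P0 z -> in_cube P0 z' ->
    `|phi j [:: i1] z - phi j [:: i1] z'| <= 2 * tau.
  move=> Pz Pz'; have h1 := near z j [:: i1] Pz l0; have h2 := near z' j [:: i1] Pz' l0.
  have := ler_normB (phi j [:: i1] z - phi j [:: i1] x0) (phi j [:: i1] z' - phi j [:: i1] x0).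
  rewrite opprB addrA subrK; lra.
pose E t := expR (- (t + w j1 * t)).
pose kp := (4 * Kg * d%:R)^-1.
have dn0 : 0 < d%:R :> R by rewrite ltr0n.
have kp0 : 0 < kp by rewrite invr_gt0 !mulr_gt0.
have Ae0 : 0 < A / e by rewrite divr_gt0.
(* The cubes have side below 8 (A / e) E t, and E t <= e^(2L) E s for every time [s] of the window;
   this number of subdivisions brings the side below [kp * E s], uniformly in [t]. *)
pose M2 := (Num.truncn (8 * (A / e) * expR (L + L) / kp)).+1.
have M20 : 0 < (M2 ^ d)%:R :> R by rewrite ltr0n expn_gt0.
have M2i : ((M2 ^ d)%:R : R)^-1 <= 1.
  by rewrite invf_le1 // ler1n expn_gt0.
have M2i0 : 0 < ((M2 ^ d)%:R : R)^-1 by rewrite invr_gt0.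
have wj1 := weight_le1 w1 w0 j1.
have wj0 : 0 <= w j1 by exact: ltW.
apply: (@null_criterion _ _ _ P0 ((M2 ^ d)%:R^-1 / 2)) => //.
- by rewrite divr_gt0.
- lra.
move=> P cc PP0 cc0 hc; have P_0 : 0 < P.2 by case: PP0.
have [t0 Ht0] := Hcnt w phi x0 P0 w1 w0 nd jets near1 P01 P PP0.
have [t [t0t tt tX tY]] : exists t, [/\ t0 <= t, 0 <= t,
    4 * (A / e) * expR (- t) <= P.2 & N%:R <= C / A * expR t].
  have X0 : 0 < 4 * (A / e) by rewrite mulr_gt0.
  have c'0 : 0 < Num.min P.2 (C / A) by rewrite lt_min P_0 divr_gt0.
  have [t [a b h1 h2]] := exists_large_time t0 N%:R X0 c'0.
  exists t; split => //.
    by apply: le_trans h1 _; rewrite ge_min lexx.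
  apply: le_trans h2 _; rewrite ler_wpM2r ?expR_ge0 //.
  by rewrite ge_min lexx orbT.
pose r0 := 4 * (A / e) * E t.
have r00 : 0 < r0 by apply: mulr_gt0; [exact: mulr_gt0 | exact: expR_gt0].
have r0P : r0 <= P.2.
  apply: le_trans tX; apply: ler_wpM2l; first by rewrite mulr_ge0 // ltW.
  rewrite ler_expR.
  by rewrite lerN2 lerDl mulr_ge0.
have [D0 [D0a D0b]] := dyadic_scale r00 r0P.
pose side := P.2 / (2 ^ D0)%:R.
have p2 D : (0 < 2 ^ D)%N by rewrite expn_gt0.
have p2R D : 0 < (2 ^ D)%:R :> R by rewrite ltr0n.
(* Leaves of side at most P.2 / Y satisfy the smallness condition of [lattice_ge_of_leaf] at all
   times up to t + L. *)
pose Y := 2 * n%:R * d%:R * Kg * P.2 * expR ((t + L) + (t + L)).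
have Y0 : 0 <= Y by rewrite !mulr_ge0 ?expR_ge0 // ltW.
pose D1 := (Num.truncn Y).+1.
have YD1 : Y <= (2 ^ D1)%:R.
  apply/ltW/(lt_trans (truncnS_gt _)); by rewrite ltr_nat ltn_expl.
pose B := [set Q | exists2 o, o \in T & short_on w phi (t + o) dl Q].
have half : ((2 ^ D0) ^ d <= 2 * cnt (2 ^ D0) P (has_inner_leaf D1 B))%N.
  apply: (@cnt_inner_leaf R d P D0 D1 B (Kw * eta)) => //.
    by rewrite le_eqVlt; apply/orP; left; apply/eqP; rewrite /eta; field;
      rewrite !gt_eqF // exprn_gt0.
  rewrite -mulrA /Kw -sT; apply: cnt_exists_le => o oT; apply: Ht0.
  by have /andP[? _] := TL o oT; apply: le_trans t0t _; rewrite lerDl.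
apply: (outer_half_subcubes P_0 (p2 D0) cc0 _ half _ hc); first exact: ltW.
move=> v [u hu].
set Q := subcube P v; have Qle : cube_le Q P by exact: subcube_le.
have Q0 : 0 < Q.2 by case: Qle.
have QP0 : cube_le Q P0 := cube_le_trans Qle PP0.
have Qside : Q.2 = side by [].
have Ile : cube_le (inner_cube Q) Q by exact: subcube_le.
have I0 : 0 < (inner_cube Q).2 by case: Ile.
set Q' := subcube (inner_cube Q) u in hu.
have Q'le : cube_le Q' (inner_cube Q) by exact: subcube_le.
have Q'0 : 0 < Q'.2 by case: Q'le.
have Q'P0 : cube_le Q' P0 := cube_le_trans (cube_le_trans Q'le Ile) QP0.
pose x := Q'.1.
have Q'x : in_cube Q' x by move=> i; rewrite lexx lerDl ltW.
have Ix := in_cube_le Q'le Q'x; have Qx := in_cube_le Ile Ix.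
have P0x := in_cube_le QP0 Qx.
have Q'side : Q'.2 <= P.2 / (2 ^ D1)%:R.
  rewrite /Q' /= /Q /=.
  rewrite ler_pM2r ?invr_gt0 //.
  apply: (@le_trans _ _ (P.2 / (2 ^ D0)%:R)).
    by rewrite ler_pdivrMr // ler_peMr ?ler1n // divr_ge0 // ltW.
  by rewrite ler_pdivrMr // ler_peMr ?ler1n // ltW.
have good o : o \in T -> lattice_ge (flow w (t + o) (value phi x)) (dl / 2).
  move=> oT; have /andP[q1 q2] := TL o oT.
  apply: (@lattice_ge_of_leaf R d n w phi w1 w0 (t + o) dl
    (d%:R * (Kg * (P.2 / (2 ^ D1)%:R))) Q' x) => //.
  - by rewrite addr_ge0.
  - by rewrite !mulr_ge0 ?invr_ge0 // ltW.
  - apply: (@le_trans _ _ (Y / (2 ^ D1)%:R / 2)); last first.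
      by rewrite ler_pM2r // ler_pdivrMr // mul1r.
    have -> : Y / (2 ^ D1)%:R / 2 = n%:R * (d%:R * (Kg * (P.2 / (2 ^ D1)%:R))) *
      expR (t + L + (t + L)) by rewrite /Y; field; rewrite gt_eqF.
    apply: ler_wpM2l.
      by rewrite !mulr_ge0 ?invr_ge0 // ltW.
    by rewrite ler_expR; lra.
  - move=> j z Q'z; apply: (jet_lipschitz P00 (jets1 j)) => //.
    + exact: ltW.
    + by rewrite divr_ge0 // ltW.
    + by move=> i z' Pz'; exact: gK.
    + exact: in_cube_le Q'P0 _ Q'z.
    + move=> i; apply: le_trans Q'side.
      have /andP[z1 z2] := Q'z i; have /andP[x1 x2] := Q'x i.
      by rewrite ler_norml; apply/andP; split; rewrite /x in z1 z2 x1 x2 *; lra.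
  - by move=> sh; apply: hu; exists o.
have [r rT hr] := win t (value phi x) (fun j => phi j [:: i1] x) tt (g1 x P0x)
  (fun j => gK j i1 x P0x) good.
have /andP[ra rb] := TL r rT.
pose s := t + r.
have s0 : 0 <= s by rewrite addr_ge0.
have Est : E s <= E t.
  by rewrite /E ler_expR lerN2 /s; have : 0 <= w j1 * r by [rewrite mulr_ge0]; lra.
have Ets : E t <= expR (L + L) * E s.
  rewrite /E -expRD ler_expR /s.
  have : w j1 * r <= L by apply: le_trans rb; rewrite ler_piMl.
  lra.
(* The displacement is at most r0 / 4, hence at most a quarter of the side: the margin of the inner
   cube. *)
have room (q : R) : `|q| <= A / e * E s -> Q.1 0 i1 <= x 0 i1 + q <= Q.1 0 i1 + Q.2.
  move=> hq; have qE : `|q| <= side / 4.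
    apply: le_trans hq _; rewrite ler_pdivlMr //.
    apply: le_trans D0a; rewrite /r0.
    have -> : A / e * E s * 4 = 4 * (A / e) * E s by rewrite mulrAC [_ * 4]mulrC.
    by apply: ler_wpM2l => //; rewrite mulr_ge0 // ltW.
  have /andP[a b] := Ix i1; move: a b; rewrite /inner_cube [in X in X <= _]/= Qside.
  rewrite /= !mxE ffunE /=.
  rewrite ler_norml in qE; case/andP: qE => qa qb.
  rewrite -/side mulr1 => a b; apply/andP; split; lra.
have Ns : N%:R <= C * expR s / A.
  apply: le_trans tY _; rewrite [leRHS]mulrAC ler_wpM2l //; first by rewrite divr_ge0 // ltW.
  by rewrite ler_expR /s lerDl.
have AC : 4 * C <= A by rewrite lerDr.
have ACe : 3 * C / eps <= A by rewrite lerDl mulr_ge0 // ltW.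
have [x' Qx' avoid] := nearby_point w0 wm C0 eps0 ACe AC e0 tau0 taue Kg0 s0 d0
  (approx w j1 s A e (value phi x) (fun j => phi j [:: i1] x) theta A0 e0)
  P00 jets1 (fun j z z' => osc j z z') gK QP0 Qx room Ns hr.
have QM : Q.2 / M2%:R <= kp * E s.
  rewrite ler_pdivrMr ?ltr0n //.
  apply: (@le_trans _ _ (8 * (A / e) * expR (L + L) / kp * (kp * E s))).
    have -> : 8 * (A / e) * expR (L + L) / kp * (kp * E s) =
      8 * (A / e) * (expR (L + L) * E s) by field; rewrite !gt_eqF.
    apply: le_trans (ltW D0b) _; rewrite /r0.
    have : 8 * (A / e) * E t <= 8 * (A / e) * (expR (L + L) * E s).
      by rewrite ler_wpM2l // mulr_ge0 // ltW.
    lra.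
  rewrite mulrC ler_wpM2l //; first by rewrite mulr_ge0 ?expR_ge0 // ltW.
  exact/ltW/truncnS_gt.
have M2p : (0 < M2)%N by [].
have [v0 hv0] := mem_subcube_cover Q0 M2p Qx' QM.
apply: (outer_drop_subcube Q0 M2p (v0 := v0)).
  apply/seteqP; split => // z [bz zv]; have [Qz zx'] := hv0 z zv.
  exact: (avoid z (in_cube_le QP0 Qz) zx' bz).
by move=> Q2 Q2Q; apply: hc; exact: cube_le_trans Q2Q Qle.
Qed.

End local_nullity.

(** * From partial derivatives to the local theorem *)

Section jets_of_partial.
Context {R : realType} {d n : nat}.
Implicit Types (F : 'rV[R]_d -> 'rV[R]_n) (x : 'rV[R]_d) (V : set 'rV[R]_d).

Lemma derivable_coord (G : 'rV[R]_d -> 'rV[R]_n) x (i : 'I_d) (c : 'I_n) :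
  derivable G x 'e_i ->
  is_derive (x 0 i) (1 : R) (fun t => G (upd x i t) 0 c) ('D_('e_i) G x 0 c).
Proof.
move=> dG.
have cv : (fun h : R => h^-1 *: ((fun t => G (upd x i t) 0 c) \o shift (x 0 i)) (h *: 1)
    - h^-1 *: G (upd x i (x 0 i)) 0 c) @ 0^' --> 'D_('e_i) G x 0 c.
  have -> : (fun h : R => h^-1 *: ((fun t => G (upd x i t) 0 c) \o shift (x 0 i)) (h *: 1)
    - h^-1 *: G (upd x i (x 0 i)) 0 c) =
    (fun M : 'rV[R]_n => M 0 c) \o (fun h : R => h^-1 *: ((G \o shift x) (h *: 'e_i) - G x)).
    apply/funext => h /=; rewrite upd_id.
    have -> : upd x i (h *: 1 + x 0 i) = h *: 'e_i + x.
      apply/rowP => j; rewrite !mxE eqxx /=.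
      case: eqP => [->|_]; first by rewrite -[h *: 1]/(h * 1) !mulr1.
      by rewrite mulr0 add0r.
    by rewrite !mxE -scalerBr.
  apply: continuous_cvg; last exact: dG.
  exact: coord_continuous.
have cv' : (fun h : R => h^-1 *: (((fun t => G (upd x i t) 0 c) \o shift (x 0 i)) (h *: 1)
    - G (upd x i (x 0 i)) 0 c)) @ 0^' --> 'D_('e_i) G x 0 c.
  move: cv; apply: cvg_trans; apply: near_eq_cvg; apply: nearW => h.
  by rewrite scalerBr.
apply: DeriveDef; first by apply/cvg_ex; exists ('D_('e_i) G x 0 c).
exact: (cvg_lim (@Rhausdorff R) cv').
Qed.

Lemma jet_of_partial l V F c : Ck_on l V F -> jet_on l V (fun s x => partial s F x 0 c).
Proof. by move=> [_ hd] s i x sl Vx; apply: derivable_coord; exact: hd. Qed.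

(** Only finitely many lists are involved: at each length the filter is intersected over the
    finitely many possible heads. *)
Lemma near_short_lists (T : Type) (G : set_system T) (FG : Filter G) l :
  forall Q : seq 'I_d -> set T,
  (forall s, (size s <= l)%N -> G (Q s)) ->
  G [set x | forall s, (size s <= l)%N -> Q s x].
Proof.
elim: l => [|l IH] Q hQ.
  by have := hQ [::] isT; apply: filterS => x Qx [].
have h1 i : G [set x | forall s, (size s <= l)%N -> Q (i :: s) x].
  by apply: IH => s sl; exact: hQ.
have h2 : G [set x | forall i s, (size s <= l)%N -> Q (i :: s) x].
  exact: filter_forall h1.
have h3 := filterI (hQ [::] isT) h2.
have sub : Q [::] `&` [set x | forall i s, (size s <= l)%N -> Q (i :: s) x] `<=`
    [set x | forall s, (size s <= l.+1)%N -> Q s x].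
  by move=> x [q0 q1] [|i s] sl; [exact: q0 | exact: q1].
exact: (filterS sub (h3 FG)).
Qed.

Lemma jets_near_nbhs k l V F (sg : 'I_k -> 'I_n) x0 (tau : R) : Ck_on l V F ->
  V x0 -> 0 < tau ->
  \forall x \near x0, forall j s, (size s <= l)%N ->
    `|partial s F x 0 (sg j) - partial s F x0 0 (sg j)| <= tau.
Proof.
move=> [hc _] Vx0 tau0.
have h j : \forall x \near x0, forall s, (size s <= l)%N ->
    `|partial s F x 0 (sg j) - partial s F x0 0 (sg j)| <= tau.
  apply: (near_short_lists (nbhs_filter x0)
    (Q := fun s x => `|partial s F x 0 (sg j) - partial s F x0 0 (sg j)| <= tau)).
  move=> s sl; have cs := hc s sl x0 Vx0.
  have : (fun x => partial s F x 0 (sg j)) @ x0 --> partial s F x0 0 (sg j).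
    exact: (continuous_comp cs (@coord_continuous R 1 n 0 (sg j) _)).
  move=> /cvgrPdist_le /(_ _ tau0); apply: filterS => x.
  by rewrite distrC.
exact: filter_forall h.
Qed.

(** Rational corners and sides make the family of cubes countable. *)
Definition rat_cube (pr : 'rV[rat]_d * rat) : 'rV[R]_d * R :=
  (map_mx ratr pr.1, ratr pr.2).

Lemma rat_cube_nbhs x0 (W : set 'rV[R]_d) : nbhs x0 W ->
  exists pr, [/\ 0 < (rat_cube pr).2, (rat_cube pr).2 <= 1,
    in_cube (rat_cube pr) x0 & in_cube (rat_cube pr) `<=` W].
Proof.
move=> /nbhs_ballP[e e0 eW].
have m0 : 0 < Num.min e 1 by rewrite lt_min e0 ltr01.
have [r] := rat_in_itvoo m0; rewrite in_itv /= => /andP[r0 rm].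
have re : ratr r < e by apply: lt_le_trans rm _; rewrite ge_min lexx.
have r1 : ratr r <= 1 :> R.
  by apply: ltW; apply: lt_le_trans rm _; rewrite ge_min lexx orbT.
have hp i : exists q : rat, x0 0 i - ratr r < ratr q < x0 0 i.
  have lt : x0 0 i - ratr r < x0 0 i by rewrite ltrBlDr ltrDl.
  by have [q] := rat_in_itvoo lt; rewrite in_itv /=; exists q.
have [q hq] := choice hp.
exists (\row_i q i, r); split => //=.
  move=> i; rewrite /= !mxE; have /andP[a b] := hq i.
  by apply/andP; split; lra.
move=> x xP; apply: eW; split => // i j; rewrite (ord1 i) {i}.
have := xP j; rewrite /= !mxE => /andP[a b]; have /andP[a' b'] := hq j.
rewrite -ball_normE /= ltr_norml; apply/andP; split; lra.
Qed.

(** The product [T *m v] lists derivatives of the form with coefficients [b]. As [T] is invertible,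
    they cannot all be small compared with the coefficients. *)
Lemma nondegenerate_dual k l F (sg : 'I_k -> 'I_n) x0
  (t : 'I_n -> seq 'I_d) : (0 < n)%N -> injective sg ->
  (forall j, (1 <= size (t j) <= l)%N) ->
  row_free (\matrix_(j < n) partial (t j) F x0) ->
  exists2 c : R, 0 < c &
  nondegenerate_jet (fun j s x => partial s F x 0 (sg j)) l c x0.
Proof.
move=> n0 inj_sg ht; set T := \matrix_(j < n) _ => fT.
have uT : T \in unitmx by rewrite -row_free_unit.
pose K : R := \sum_i \sum_j `|invmx T i j|.
have K0 : 0 <= K by apply: sumr_ge0 => i _; apply: sumr_ge0.
pose c := (K + 1)^-1.
have c0 : 0 < c by rewrite invr_gt0 ltr_wpDl.
have Kc : K * c < 1 by rewrite /c ltr_pdivrMr ?ltr_wpDl // mul1r ltrDl.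
exists c => // b.
(* The coefficients [b], placed at the positions [sg j] and extended by 0. *)
pose v : 'cV[R]_n := \col_c' \sum_(j | sg j == c') b 0 (lift 0 j).
have vE j : v (sg j) 0 = b 0 (lift 0 j).
  by rewrite mxE (big_pred1 j) // => j' /=; rewrite (inj_eq inj_sg).
have Tv q : (T *m v) q 0 = form (fun j s x => partial s F x 0 (sg j)) b (t q) x0.
  rewrite /form; have := ht q; case tq : (t q) => [|i s] // _; rewrite add0r -tq.
  rewrite mxE; transitivity (\sum_c' \sum_(j | sg j == c')
    b 0 (lift 0 j) * partial (t q) F x0 0 (sg j)).
    apply: eq_bigr => c' _; rewrite [v _ _]mxE mulr_sumr; apply: eq_bigr => j /eqP <-.
    by rewrite !mxE mulrC.
  by rewrite [RHS](partition_big sg xpredT).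
have [[q hq]|none] := pselect (exists q, c * form_norm b <= `|(T *m v) q 0|).
  by exists (t q); split; [exact: ht | rewrite -Tv].
have small q : `|(T *m v) q 0| < c * form_norm b.
  by rewrite ltNge; apply/negP => h; apply: none; exists q.
have normv : form_norm b <= K * (c * form_norm b).
  apply: (@le_trans _ _ (\sum_i `|v i 0|)).
    rewrite /form_norm; under eq_bigr do rewrite -vE.
    rewrite -(big_imset (fun i => `|v i 0|)) /=; last by move=> ? ? _ _; exact: inj_sg.
    rewrite [leRHS](bigID (mem (sg @: predT)%SET)) /=.
    by rewrite lerDl; apply: sumr_ge0.
  rewrite /K mulr_suml; apply: ler_sum => i _; rewrite mulr_suml.
  rewrite -{1}(mulKmx uT v) mxE; apply: le_trans (ler_norm_sum _ _ _) _.
  apply: ler_sum => j _; rewrite normrM; apply: ler_wpM2l => //.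
  exact/ltW/small.
have := form_norm_ge0 b; rewrite le_eqVlt => /orP[/eqP f0|f0].
  exists (t (Ordinal n0)); split; first exact: ht.
  by rewrite -f0 mulr0.
have : K * c * form_norm b < form_norm b by rewrite gtr_pMl.
by rewrite -mulrA ltNge normv.
Qed.

End jets_of_partial.

Section bad_points.
Context {R : realType}.

Lemma limf_einf_gt0 (G : int -> R) :
  (0 < limf_einf (fun q : int => (G q)%:E) int_infty)%E ->
  exists2 e : R, 0 < e & exists N : nat, forall q : int, q != 0 -> (N <= `|q|)%N ->
    e <= G q.
Proof.
rewrite /limf_einf /limf_esup oppe_gt0 => /ereal_inf_lt[_ [V [N _ NV] <-] sup0].
have [e [e0 he]] : exists e : R, 0 < e /\ forall q, V q -> e <= G q.
  set S := [set _ | _ in V] in sup0.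
  have le q : V q -> (- (G q)%:E <= ereal_sup S)%E.
    by move=> Vq; apply: ereal_sup_ubound; exists q.
  case: (ereal_sup S) sup0 le => [r|//|_] h.
  - move=> le; exists (- r); split; first by rewrite oppr_gt0 -lte_fin.
    by move=> q /le; rewrite -EFinN lee_fin lerNl.
  (* The supremum is -oo only if [V] is empty; any positive constant serves then. *)
  - by exists 1; split => // q /h.
by exists e => //; exists N => q q0 Nq; apply: he; apply: NV.
Qed.

Lemma dist_int_le (x : R) (z : int) : dist_int x <= `|x - z%:~R|.
Proof.
apply: ge_inf; last by exists z.
by exists 0 => _ [z' _ <-].
Qed.

Lemma dist_int_ge0 (x : R) : 0 <= dist_int x.
Proof. by apply: lb_le_inf; [exists `|x - 0%:~R|, 0 | move=> _ [z _ <-]]. Qed.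

(** A violation at [q] makes every term of positive weight smaller than (1 / (p + 1)) / q, while
    terms of weight 0 are 0 by convention; the maximum times [q] then falls below the lower bound
    [e]. *)
Lemma Bad_badly_approximable d n k (theta w : 'rV[R]_n) (F : 'rV[R]_d -> 'rV[R]_n)
    (sg : 'I_k -> 'I_n) x : (forall i, 0 <= w 0 i) ->
  (forall i, w 0 i != 0 -> exists j, sg j = i) ->
  (forall j, 0 < w 0 (sg j)) ->
  Bad theta w (F x) -> exists p N : nat,
  badly_approximable_set (fun j => w 0 (sg j)) (fun j s x => partial s F x 0 (sg j))
    (fun j => theta 0 (sg j)) p.+1%:R^-1 N x.
Proof.
move=> w0 hsg wsg /limf_einf_gt0[e e0 [N hN]].
have [p pe] : exists p : nat, p.+1%:R^-1 <= e.
  exists (Num.truncn e^-1); rewrite invf_ple ?posrE //.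
  exact/ltW/truncnS_gt.
exists p, N => q z Nq q0 h.
have q0' : 0 < q%:R :> R by rewrite ltr0n.
have := hN q%:Z; rewrite absz_nat => /(_ _ Nq).
rewrite -lt0n q0 => /(_ isT); rewrite -pmulrn.
set mx := \big[_/_]_(i < n) _ => emx.
have p0 : 0 < p.+1%:R^-1 :> R by rewrite invr_gt0.
have pq0 : 0 < p.+1%:R^-1 / q%:R :> R by rewrite divr_gt0.
have : mx < p.+1%:R^-1 / q%:R.
  rewrite /mx; elim/big_ind: _ => //.
    by move=> a b ha hb; rewrite gt_max ha hb.
  move=> i _; rewrite /dist_int_pow; case: eqP => // /eqP wi.
  have [j <-] := hsg i wi.
  have lt : dist_int (q%:~R * F x 0 (sg j) - theta 0 (sg j)) <
      (p.+1%:R^-1 / q%:R) `^ w 0 (sg j).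
    apply: le_lt_trans (dist_int_le _ (z j)) _.
    by have := h j; rewrite -pmulrn.
  have wj := wsg j.
  have := gt0_ltr_powR (r := (w 0 (sg j))^-1); rewrite invr_gt0 => /(_ wj _ _ _ _ lt).
  rewrite !nnegrE dist_int_ge0 powR_ge0 -powRrM mulfV ?gt_eqF // powRr1 ?(ltW pq0) //.
  by apply.
rewrite ltr_pdivlMr // ltNge; apply/negP; rewrite negbK.
exact: le_trans pe emx.
Qed.

End bad_points.

Lemma outer_null_bigcup (R : realType) d (I : countType) (A : I -> set 'rV[R]_d) :
  (forall i, lebesgue_outer (A i) = 0%E) -> lebesgue_outer (\bigcup_i A i) = 0%E.
Proof.
move=> A0; pose B k := if @unpickle I k is Some i then A i else set0.
have B0 k : lebesgue_outer (B k) = 0%E.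
  by rewrite /B; case: unpickle => [i|]; rewrite ?A0 ?outer_measure0.
apply/eqP; rewrite eq_le outer_measure_ge0 andbT.
apply: (@le_trans _ _ (lebesgue_outer (\bigcup_k B k))).
  by apply: outer_le => x [i _ Ax]; exists (pickle i) => //; rewrite /B pickleK.
apply: le_trans (outer_measure_sigma_subadditive _ _) _.
by rewrite eseries0 // => k _ _; exact: B0.
Qed.

(** Sets of outer measure zero are Caratheodory measurable, so almost everywhere statements reduce
    to outer measure. *)
Lemma outer_null_ae (R : realType) d (P : set 'rV[R]_d) :
  lebesgue_outer (~` P) = 0%E -> \forall x \ae lebesgue_measure_rV, P x.
Proof.
move=> P0; exists (~` P); split => //.
apply: le_caratheodory_measurable => X.
have XP : (lebesgue_outer (X `&` ~` P) <= 0)%E.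
  by rewrite -P0; apply: outer_le; exact: subIsetr.
have XC : (lebesgue_outer (X `&` ~` ~` P) <= lebesgue_outer X)%E.
  by apply: outer_le; exact: subIsetl.
by have := leeD XP XC; rewrite add0e.
Qed.

Lemma ae_outer_null (R : realType) d (P : set 'rV[R]_d) :
  (\forall x \ae lebesgue_measure_rV, P x) -> lebesgue_outer (~` P) = 0%E.
Proof.
move=> [N [_ N0 PN]]; apply/eqP; rewrite eq_le outer_measure_ge0 andbT.
by rewrite -N0; exact: outer_le.
Qed.
Theorem theorem6 (R : realType) (d m : nat) (hd : (1 <= d)%N) (hm : (1 <= m)%N)
    (theta w : 'rV[R]_(d + m)) (hw : weight w)
    (hmax : forall i : 'I_d,
       w 0 (lshift m i) = \big[Num.max/0]_(j < d + m) w 0 j)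
    (U : set 'rV[R]_d) (hU : open U) (f : 'rV[R]_d -> 'rV[R]_m)
    (hf : nondegenerate_map U (fun x => row_mx x (f x))) :
  \forall x \ae lebesgue_measure_rV, U x -> ~ Bad theta w (row_mx x (f x)).
Proof.
have [w0 w1] := hw; have [l hl] := hf.
pose F x : 'rV[R]_(d + m) := row_mx x (f x).
(* From here on only the coordinates of positive weight are kept, listed by [sg]; their weights
   still sum to 1. *)
pose n := #|[pred i : 'I_(d + m) | 0 < w 0 i]|.
pose sg : 'I_n -> 'I_(d + m) := enum_val.
have sg_inj : injective sg by exact: enum_val_inj.
have wsg j : 0 < w 0 (sg j) by have := enum_valP j; rewrite inE.
pose i1 : 'I_d := Ordinal hd.
have wmax i : w 0 i <= w 0 (lshift m i1).
  by rewrite hmax; exact: le_bigmax.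
have wi1 : 0 < w 0 (lshift m i1).
  rewrite lt_neqAle w0 andbT eq_sym; apply/eqP => h.
  have : \sum_i w 0 i = 0.
    by apply: big1 => i _; apply/eqP; rewrite eq_le w0 andbT -h.
  by rewrite w1; exact/eqP/oner_neq0.
have sgP i : w 0 i != 0 -> exists j, sg j = i.
  move=> wi; have hi : i \in [pred i : 'I_(d + m) | 0 < w 0 i].
    by rewrite inE lt_neqAle eq_sym wi w0.
  by exists (enum_rank_in hi i); exact: enum_rankK_in.
have [j1 j1E] : exists j, sg j = lshift m i1 by apply: sgP; rewrite gt_eqF.
pose w' j := w 0 (sg j).
have w'1 : \sum_j w' j = 1.
  rewrite -w1 [RHS](bigID (fun i => 0 < w 0 i)) /= [X in _ + X]big1 ?addr0.
    transitivity (\sum_(i in [pred i : 'I_(d + m) | 0 < w 0 i]) w 0 i).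
      by symmetry; exact: big_enum_val.
    by apply: eq_bigl.
  by move=> i; rewrite -leNgt => h; apply/eqP; rewrite eq_le h w0.
have w'max j : w' j <= w' j1 by rewrite /w' j1E.
pose phi (j : 'I_n) s x := partial s F x 0 (sg j).
pose theta' j := theta 0 (sg j).
pose bad p N := badly_approximable_set w' phi theta' p.+1%:R^-1 N.
pose null_cube (i : nat * nat * ('rV[rat]_d * rat)) : set 'rV[R]_d :=
  bad i.1.1 i.1.2 `&` in_cube (rat_cube i.2).
(* The triples giving a null set are not known explicitly. Replacing the other sets by the empty set
   makes the countable union null, and the local result places each bad nondegenerate point in
   it. *)
pose A i := if lebesgue_outer (null_cube i) == 0%E then null_cube i else set0.
have A0 i : lebesgue_outer (A i) = 0%E.
  by rewrite /A; case: eqP => // _; exact: outer_measure0.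
apply: outer_null_ae.
apply/eqP; rewrite eq_le outer_measure_ge0 andbT.
apply: (@le_trans _ _ (lebesgue_outer
  (~` [set x | U x -> nondegenerate_at l U F x] `|` \bigcup_i A i))); last first.
  apply: le_trans (outer_measureU2 _ _ _) _.
  have N0 : lebesgue_outer (~` [set x | U x -> nondegenerate_at l U F x]) = 0%E.
    exact: ae_outer_null hl.
  have : (lebesgue_outer (~` [set x | U x -> nondegenerate_at l U F x]) +
      lebesgue_outer (\bigcup_i A i) <= 0)%E.
    by rewrite N0 (outer_null_bigcup A0) adde0.
  by [].
apply: outer_le => x0 /= nx0.
have [Ux0 badx0] : U x0 /\ Bad theta w (F x0).
  by split; apply: contrapT => h; apply: nx0 => // ? ?; exact: h.
have [nd|] := pselect (nondegenerate_at l U F x0); last by move=> h; left => /(_ Ux0).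
right; have [[V [oV Vx0 VU ck]] [t [ht fT]]] := nd.
have [p [N bx0]] := Bad_badly_approximable w0 sgP wsg badx0.
have n0 : (0 < d + m)%N by rewrite addn_gt0 hd.
have [c c0 ndj] := nondegenerate_dual n0 sg_inj ht fT.
have l0 : (0 < l)%N by have /andP[a b] := ht (Ordinal n0); exact: leq_trans a b.
(* The summand 1 allows for the variation of the first derivatives, at most [Num.min tau 1] on the
   cube. *)
pose Kg : R := 1 + \sum_j \sum_i `|phi j [:: i] x0|.
have S0 : 0 <= \sum_j \sum_i `|phi j [:: i] x0|.
  by apply: sumr_ge0 => j _; exact: sumr_ge0.
have Kg0 : 0 < Kg by rewrite ltr_wpDr.
have eps0 : 0 < p.+1%:R^-1 :> R by rewrite invr_gt0.
have [tau tau0 null] :=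
  local_null i1 theta' hd l0 w'1 wsg w'max c0 eps0 Kg0.
have m0 : 0 < Num.min tau 1 by rewrite lt_min tau0 ltr01.
have nV : nbhs x0 V by exact: open_nbhs_nbhs.
have [pr [r0 r1 Px0 sub]] :=
  rat_cube_nbhs (filterI nV (jets_near_nbhs sg ck Vx0 m0)).
have subV : in_cube (rat_cube pr) `<=` V by move=> x /sub[].
have jets j : jet_on l V (phi j) by exact: jet_of_partial.
exists (p, N, pr) => //; rewrite /A.
suff -> : lebesgue_outer (null_cube (p, N, pr)) = 0%E by rewrite eqxx.
apply: (null phi x0) => //.
- by move=> j; apply: jet_onS (jets j).
- move=> x j s /sub[_ near] sl; apply: le_trans (near j s sl) _.
  by rewrite ge_min lexx.
(* The component [j1] of the map is the coordinate [i1] itself, so its derivative in that direction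
   is 1. *)
- move=> x /subV Vx; have := jets j1 [::] i1 x l0 Vx => /(@derive_val _ _ _ _ _ _ _) <-.
  have -> : (fun t => phi j1 [::] (upd x i1 t)) = id.
    by apply/funext => u; rewrite /phi /= j1E row_mxEl updE.
  exact: derive_val.
- move=> j i x /sub[_ near]; have := near j [:: i] l0.
  have h1 : `|phi j [:: i] x0| <= \sum_j \sum_i `|phi j [:: i] x0|.
    rewrite (bigD1 j) //= (bigD1 i) //= -addrA lerDl.
    by rewrite addr_ge0 // ?sumr_ge0 // => j' _; exact: sumr_ge0.
  rewrite le_min => /andP[_ h2].
  have := ler_normD (phi j [:: i] x - phi j [:: i] x0) (phi j [:: i] x0).
  rewrite subrK /Kg; move: h2; rewrite -/(phi j [:: i] x) -/(phi j [:: i] x0); lra.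
Qed.
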